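(* Let $T:X\to X$ be a continuous map of a compact metric space and let $\mathcal{E}:\mathscr{P}\to\mathbb{R}$ be an energy. Assume that $(T,\mathcal{E})$ has an abundance of ergodic measures. Then $$\sup_{\mu\in\mathscr{P}(T)} \Pi^{\mathcal{E}}(T,\mu) = \Pi^{\mathcal{E}}_{\mathrm{top}}(T) = \underline{\Pi}^{\mathcal{E}}_{\mathrm{top}}(T).$$ If, additionally, $T$ is an expansive homeomorphism with expansivity constant $\varepsilon_0>0$, then the following limit exists and $$\Pi^{\mathcal{E}}_{\mathrm{top}}(T)=\lim_{n\to\infty}\frac1n\log\zeta(\varepsilon_0,n).$$
   Context: $(X,d)$ is a compact metric space. $\mathscr{P}$ is the set of Borel probability measures on $X$ with the weak-star topology; $\mathscr{P}(T)$ is the subset of $T$-invariant measures and $\mathscr{P}_{\mathrm{erg}}(T)$ the subset of ergodic invariant measures. $h(T,\mu)$ is the Kolmogorov–Sinai entropy. An energy is a function $\mathcal{E}:\mathscr{P}\to\mathbb{R}$ that is continuous in the weak-star topology. The nonlinear pressure of $\mu\in\mathscr{P}(T)$ is $\Pi^{\mathcal{E}}(T,\mu)=h(T,\mu)+\mathcal{E}(\mu)$. $(T,\mathcal{E})$ has an abundance of ergodic measures if for every $\mu\in\mathscr{P}(T)$ and $\varepsilon>0$ there is $\nu\in\mathscr{P}_{\mathrm{erg}}(T)$ with $h(T,\nu)+\mathcal{E}(\nu)>h(T,\mu)+\mathcal{E}(\mu)-\varepsilon$. For $\varepsilon>0$, $n\in\mathbb{N}$, let $B(x,\varepsilon,n)=\{y\in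 X:\forall\,0\le k<n,\ d(T^ky,T^kx)<\varepsilon\}$. A finite set $\mathcal{C}\subset X$ is $(\varepsilon,n)$-separated if $x'\notin B(x,\varepsilon,n)$ for all distinct $x,x'\in\mathcal{C}$. Put $\Delta_x^n=\frac1n\sum_{i=0}^{n-1}\delta_{T^ix}$, $\omega_n(\mathcal{C})=\sum_{x\in\mathcal{C}}e^{n\mathcal{E}(\Delta_x^n)}$ and $\zeta(\varepsilon,n)=\sup_{\mathcal{C}}\omega_n(\mathcal{C})$, the supremum being over all $(\varepsilon,n)$-separated sets. Define $$\Pi^{\mathcal{E}}_{\mathrm{top}}(T)=\lim_{\varepsilon\to0}\limsup_{n\to\infty}\frac1n\log\zeta(\varepsilon,n),\qquad \underline{\Pi}^{\mathcal{E}}_{\mathrm{top}}(T)=\lim_{\varepsilon\to0}\liminf_{n\to\infty}\frac1n\log\zeta(\varepsilon,n).$$ A homeomorphism $T$ is expansive with expansivity constant $\varepsilon_0>0$ if for all $x,y\in X$: $\sup_{n\in\mathbb{Z}}d(T^nx,T^ny)\le\varepsilon_0$ implies $x=y$. *)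

(* Defs.v *)
From HB Require Import structures.
From mathcomp Require Import all_boot all_order all_algebra finmap.
From mathcomp Require Import all_classical all_reals all_analysis.

Set Implicit Arguments.
Unset Strict Implicit.
Unset Printing Implicit Defensive.

Import Order.TTheory GRing.Theory Num.Theory.
Import numFieldNormedType.Exports.

Local Open Scope classical_set_scope.
Local Open Scope ring_scope.

(* The sigma-algebras of the library live on pointed types, hence this join;
   it restricts to nonempty metric spaces. *)
#[short(type="pointedMetricType")]
HB.structure Definition PointedMetric (K : numDomainType) :=
  { M of Metric K M & isPointed M }.

Notation borel X := (g_sigma_algebraType (@open X)).

(* A [probability] is a function on all subsets, unconstrained on the
   non-measurable ones: several terms may represent one Borel measure. Such
   terms have the same integrals, so they are topologically indistinguishable
   in [weak_prob] and a continuous real-valued function identifies them. *)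
Definition weak_prob (R : realType) (X : pointedMetricType R) :=
  initial_topology (fun mu : probability (borel X) R =>
    (fun f : continuousType X R => (\int[mu]_x (f x))%R)
      : {ptws continuousType X R -> R}).

HB.instance Definition _ (R : realType) (X : pointedMetricType R) :=
  Topological.on (weak_prob X).

Section measures.
Context {R : realType} {X : pointedMetricType R}.
Local Notation prob := (probability (borel X) R).
Implicit Types (T : X -> X) (E : prob -> R) (mu : prob).

Definition energy E := continuous (E : weak_prob X -> R).

Definition invariant_measures T : set prob := [set mu |
  forall A : set (borel X), measurable A -> mu (T @^-1` A) = mu A].

Definition ergodic_measures T : set prob := [set mu | invariant_measures T mu /\
  forall A : set (borel X), measurable A -> T @^-1` A = A ->
    mu A = 0%E \/ mu A = 1%E].

(* Blocks may be empty. *)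
Definition mpartition k (A : 'I_k -> set (borel X)) :=
  [/\ forall i, measurable (A i), trivIset setT A & \bigcup_i A i = setT].

Definition join_atom T k (A : 'I_k -> set (borel X)) n
    (w : {ffun 'I_n -> 'I_k}) : set (borel X) :=
  \bigcap_(i : 'I_n) (iter i T @^-1` A (w i)).

(* [ln 0 = 0], so that null atoms contribute [0]. *)
Definition join_entropy T mu k (A : 'I_k -> set (borel X)) n : R :=
  - \sum_(w : {ffun 'I_n -> 'I_k})
      let p := fine (mu (join_atom T A w)) in p * ln p.

(* For an invariant [mu] this limit exists, by subadditivity. *)
Definition partition_entropy T mu k (A : 'I_k -> set (borel X)) : R :=
  limn (fun n => n%:R^-1 * join_entropy T mu A n).

Definition entropy T mu : \bar R :=
  ereal_sup [set h | exists k, exists2 A : 'I_k -> set (borel X),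
    mpartition A & h = (partition_entropy T mu A)%:E].

Definition pressure T E mu : \bar R := (entropy T mu + (E mu)%:E)%E.

(* When the pressure of [mu] is infinite, "larger than it up to [eps]" means
   arbitrarily large. *)
Definition ergodic_abundance T E := forall mu, invariant_measures T mu ->
  if pressure T E mu == +oo%E
  then forall M : R, exists2 nu, ergodic_measures T nu & (M%:E < pressure T E nu)%E
  else forall eps : R, 0 < eps ->
    exists2 nu, ergodic_measures T nu & (pressure T E mu - eps%:E < pressure T E nu)%E.

End measures.

Section topological_pressure.
Context {R : realType} {X : pointedMetricType R}.
Variables (T : X -> X) (E : probability (borel X) R -> R).
Implicit Types (eps : R) (n : nat) (C : {fset X}).

Definition bowen_ball x eps n : set X :=
  [set y | forall k, (k < n)%N -> mdist (iter k T y) (iter k T x) < eps].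

Definition separated eps n : set {fset X} := [set C |
  forall x x', x \in C -> x' \in C -> x <> x' -> ~ bowen_ball x eps n x'].

(* The second argument of [mnormalize] is only used for [n = 0]. *)
Definition empirical n (x : X) : probability (borel X) R :=
  mnormalize (msum (fun i => \d_(iter i T x : borel X)) n) \d_(x : borel X).

Lemma empiricalE n x (A : set (borel X)) : (0 < n)%N ->
  empirical n x A = ((n%:R^-1)%:E * \sum_(i < n) \d_(iter i T x : borel X) A)%E.
Proof.
move=> n0; rewrite /empirical /= /mnormalize.
set M := (X in fine X); have mT : M = n%:R%:E.
  transitivity (\sum_(i < n) (1%E : \bar R))%E.
    by apply: eq_bigr => i _; exact: diracT.
  by rewrite sumEFin sumr_const card_ord.
rewrite ifF; first by rewrite mT /= muleC.
apply/negbTE; rewrite negb_or; apply/andP.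
split; apply/eqP => /(etrans (esym mT)) // [] /eqP.
by rewrite pnatr_eq0 gtn_eqF.
Qed.

Definition weight n C : R :=
  \sum_(x <- C) expR (n%:R * E (empirical n x)).

Definition zeta eps n : \bar R :=
  ereal_sup [set (weight n C)%:E | C in separated eps n].

Definition growth eps n : \bar R := ((n%:R^-1)%:E * lne (zeta eps n))%E.

Lemma growth_nonincreasing n :
  {homo (fun eps => growth eps n) : eps eps' / eps <= eps' >-> (eps' <= eps)%E}.
Proof.
move=> e e' ee'; apply: lee_wpmul2l; first by rewrite lee_fin invr_ge0.
have zeta_ge0 d : (0 <= zeta d n)%E.
  by apply: ereal_sup_ubound; exists fset0 => //; rewrite /weight big_seq_fset0.
rewrite lee_lne ?in_itv/= ?zeta_ge0 ?leey//.
apply: ereal_sup_le => _ [C sC <-].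
exists C => // x x' xC x'C xx' B; apply: (sC _ _ xC x'C xx') => k kn.
exact: lt_le_trans (B k kn) ee'.
Qed.

Lemma is_cvg_top_pressure : cvg (limn_esup (growth eps) @[eps --> 0^'+]).
Proof.
apply: nonincreasing_at_right_is_cvge; near=> d => e e' _ _ ee'.
apply: le_ereal_inf_tmp => _ [V FV <-]; apply: ge_ereal_inf; exists (ereal_sup (growth e' @` V)).
  by exists V.
apply: ge_ereal_sup => _ [n Vn <-].
apply: le_trans (growth_nonincreasing n ee') _.
by apply: ereal_sup_ubound; exists n.
Unshelve. all: by end_near. Qed.

Lemma is_cvg_lower_top_pressure :
  cvg (limn_einf (growth eps) @[eps --> 0^'+]).
Proof.
apply: nonincreasing_at_right_is_cvge; near=> d => e e' _ _ ee'.
rewrite leeN2.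
apply: le_ereal_inf_tmp => _ [V FV <-]; apply: ge_ereal_inf; exists (ereal_sup ((\- growth e)%E @` V)).
  by exists V.
apply: ge_ereal_sup => _ [n Vn <-].
apply: (@le_trans _ _ (- growth e' n)%E).
  by rewrite leeN2; exact: growth_nonincreasing.
by apply: ereal_sup_ubound; exists n.
Unshelve. all: by end_near. Qed.

Definition top_pressure : \bar R :=
  lim (limn_esup (growth eps) @[eps --> 0^'+]).

Definition lower_top_pressure : \bar R :=
  lim (limn_einf (growth eps) @[eps --> 0^'+]).

End topological_pressure.

Section expansivity.
Context {R : realType} {X : pointedMetricType R}.

Definition iterz (T S : X -> X) (n : int) : X -> X :=
  match n with Posz k => iter k T | Negz k => iter k.+1 S end.

Definition expansive_homeo (T : X -> X) (eps0 : R) := exists S : X -> X,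
  [/\ continuous T, continuous S, cancel T S, cancel S T &
   forall x y, (ereal_sup (range (fun n : int =>
       (mdist (iterz T S n x) (iterz T S n y))%:E)) <= eps0%:E)%E -> x = y].

End expansivity.

(* Main.v *)
(** Let [S] be the supremum of the pressures; it lies below the liminf of the growth
rates and above their limsup, up to errors that vanish with the scale.

Lower bound: by abundance only ergodic [nu] matter. The labels of a finite partition
agree, off a set [Z] of small [nu]-measure, with a continuous function up to
[1/4], so that two nearby points outside [Z] have the same label. By the
ergodic theorem most points have an empirical measure close to [nu] and visit [Z]
rarely; hence among such points the names of nearby orbits are close in the Hamming
metric. Hamming balls are small, while about [exp (n h(T, nu))] names occur, so some
separated set has about that many elements, each of weight about [exp (n E(nu))].
If [T] is expansive with constant [eps0], orbits that are [eps0]-close on a long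
time interval are [eps]-close away from its two ends, by a bounded margin: the same
count works at scale [eps0] itself.

Upper bound: finitely many convex weak-star neighbourhoods on which [E] is almost
constant cover the measures, and one of them carries a fixed proportion of the
weight for infinitely many [n]. An ultralimit of the averaged empirical measures of
its points is, by Riesz representation, an invariant measure in its closure, whose
entropy dominates the growth of the number of points by Misiurewicz's argument,
applied to a partition into small sets that are continuity sets of the limit. *)

From HB Require Import structures.
Require Import Defs.
From mathcomp Require Import all_boot all_order all_algebra finmap.
From mathcomp Require Import all_classical all_reals all_analysis.
From mathcomp Require Import measurable_realfun lra zify.

Set Implicit Arguments.
Unset Strict Implicit.
Unset Printing Implicit Defensive.

Import Order.TTheory GRing.Theory Num.Theory.
Import numFieldNormedType.Exports.
Local Open Scope classical_set_scope.
Local Open Scope ring_scope.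

(** * Entropy of finite distributions *)

Section finite_entropy.
Context {R : realType}.

(** The energy is only continuous, so an invariant measure cannot be traded for its ergodic
    components; yet orbits with empirical measures close to [nu] come from the ergodic theorem,
    which supplies them for ergodic [nu]. Abundance bridges exactly this gap. Names are counted
    through Shannon entropy rather than through the measure of single atoms: up to [ln 2] and a term
    proportional to the mass of a bad set, the entropy of the names is at most the logarithm of the
    number of names seen off that set, so the ergodic theorem is used in measure. Hamming balls
    appear because the partition is arbitrary: its boundary may tell nearby orbits apart, but only
    at a small proportion of times. Convexity of the neighbourhoods lets an average of empirical
    measures stay where the energy is controlled, although the energy itself has no relation to
    averages. The main entropy estimates on both sides are Gibbs' inequality with a well-chosen
    reference distribution. *)

Definition shannon (W : finType) (p : W -> R) := - \sum_w p w * ln (p w).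

(** [ln x <= x - 1] at [x = q w / p w], summed with weights [p w]. The total masses are only
    compared, so that reference weights may be bounded instead of normalised, as in
    [shannon_le_split]. *)
Lemma gibbs (W : finType) (p q : W -> R) :
  (forall w, 0 <= p w) -> (forall w, 0 <= q w) ->
  (forall w, 0 < p w -> 0 < q w) -> \sum_w q w <= \sum_w p w ->
  shannon p <= - \sum_w p w * ln (q w).
Proof.
move=> p0 q0 pq qp; rewrite /shannon lerN2 -subr_ge0 -sumrB.
apply: (@le_trans _ _ (\sum_w p w - \sum_w q w)); first by rewrite subr_ge0.
rewrite -sumrB; apply: ler_sum => w _; rewrite -mulrBr.
have [pw0|pw0] := eqVneq (p w) 0; first by rewrite pw0 mul0r sub0r oppr_le0.
have pw : 0 < p w by rewrite lt_neqAle eq_sym pw0 p0.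
have qw := pq _ pw.
have -> : ln (p w) - ln (q w) = - ln (1 + (q w / p w - 1)).
  by rewrite [1 + _]addrC subrK ln_div ?posrE// opprB.
rewrite mulrN -opprB lerN2.
have : ln (1 + (q w / p w - 1)) <= q w / p w - 1.
  by apply: le_ln1Dx; rewrite ltrBDr addrC subrr divr_gt0.
move/(ler_wpM2l (p0 w))/le_trans; apply.
by rewrite mulrBr mulr1 mulrCA divff// mulr1.
Qed.

Lemma shannon_le_card (W : finType) (p : W -> R) :
  (forall w, 0 <= p w) -> \sum_w p w = 1 -> shannon p <= ln #|W|%:R.
Proof.
move=> p0 p1.
have W0 : (0 < #|W|)%N.
  rewrite lt0n; apply/eqP => W0; move/eqP: p1.
  rewrite big_pred0 ?(eq_sym 0) ?oner_eq0// => w.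
  by have := card0_eq W0 w; rewrite !inE.
have W0r : 0 < #|W|%:R :> R by rewrite ltr0n.
apply: le_trans (gibbs (q := fun=> #|W|%:R^-1) _ _ _ _) _ => //.
- by move=> w _; rewrite invr_gt0.
- by rewrite p1 sumr_const -[_ *+ _]mulr_natr mulVf// gt_eqF.
- by rewrite -mulr_suml p1 mul1r lnV ?posrE// opprK.
Qed.

(** Gibbs for every [p i] against one common reference, their average: the right-hand sides then add
    up to its entropy. *)
Lemma concave_shannon (I W : finType) (p : I -> W -> R) :
  (0 < #|I|)%N -> (forall i w, 0 <= p i w) -> (forall i, \sum_w p i w = 1) ->
  \sum_i shannon (p i) <=
  #|I|%:R * shannon (fun w => #|I|%:R^-1 * \sum_i p i w).
Proof.
move=> I0 p0 p1; pose q w := #|I|%:R^-1 * \sum_i p i w; rewrite -[X in shannon X]/q.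
have I0r : 0 < #|I|%:R :> R by rewrite ltr0n.
have q0 w : 0 <= q w by rewrite mulr_ge0 ?sumr_ge0// invr_ge0 ltW.
have q1 : \sum_w q w = 1.
  rewrite -mulr_sumr exchange_big/= (eq_bigr (fun=> 1))// sumr_const.
  by rewrite mulVf// gt_eqF.
apply: (@le_trans _ _ (\sum_i - \sum_w p i w * ln (q w))).
- apply: ler_sum => i _; apply: gibbs => //; last by rewrite q1 p1.
  move=> w piw; rewrite mulr_gt0 ?invr_gt0//.
  by apply: lt_le_trans piw _; rewrite (bigD1 i)//= lerDl sumr_ge0.
- rewrite sumrN exchange_big/= /shannon mulrN lerN2 mulr_sumr.
  apply: ler_sum => w _; rewrite -mulr_suml.
  by rewrite {1}/q !mulrA divff ?mul1r// gt_eqF.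
Qed.

Section law.
Variables (Om : finType) (p : Om -> R).
Hypothesis p0 : forall o, 0 <= p o.
Hypothesis p1 : \sum_o p o = 1.

Definition law (W : finType) (f : Om -> W) (w : W) : R :=
  \sum_(o | f o == w) p o.

Lemma law_ge0 (W : finType) (f : Om -> W) w : 0 <= law f w.
Proof. exact: sumr_ge0. Qed.

Lemma sum_law (W : finType) (f : Om -> W) (F : W -> R) :
  \sum_w law f w * F w = \sum_o p o * F (f o).
Proof.
rewrite [RHS](partition_big f xpredT)//=; apply: eq_bigr => w _.
by rewrite mulr_suml; apply: eq_bigr => o /eqP ->.
Qed.

Lemma sum_law1 (W : finType) (f : Om -> W) : \sum_w law f w = 1.
Proof. by rewrite -p1 [RHS](partition_big f xpredT). Qed.

Lemma law_gt0 (W : finType) (f : Om -> W) o : 0 < p o -> 0 < law f (f o).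
Proof.
by move=> po; rewrite /law (bigD1 o)//= ltr_pwDl// sumr_ge0.
Qed.

Lemma law_id : law (@id Om) = p.
Proof. by apply/funext => o; rewrite /law big_pred1_eq. Qed.

Lemma shannon_lawE (W : finType) (f : Om -> W) :
  shannon (law f) = - \sum_o p o * ln (law f (f o)).
Proof. by rewrite /shannon sum_law. Qed.

(** [h] is a function of [f], so the fibre of [h] through a point contains that of [f], and the
    logarithms compare pointwise. *)
Lemma shannon_law_le (W W' : finType) (f : Om -> W) (h : Om -> W') :
  (forall o o', f o = f o' -> h o = h o') ->
  shannon (law h) <= shannon (law f).
Proof.
move=> fh; rewrite !shannon_lawE lerN2; apply: ler_sum => o _.
have [pz|po0] := eqVneq (p o) 0; first by rewrite pz !mul0r.
have po : 0 < p o by rewrite lt_neqAle eq_sym po0 p0.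
rewrite ler_wpM2l// ler_ln ?posrE ?law_gt0//.
rewrite /law [leRHS]big_mkcond [leLHS]big_mkcond; apply: ler_sum => o' _.
by case: eqP => [/fh ->|_]; [rewrite eqxx|case: ifP].
Qed.

(** [h] is a function of the pair of [f] and [g], whose entropy is bounded by Gibbs against the
    product of the two laws. *)
Lemma shannon_lawD (W1 W2 W' : finType) (f : Om -> W1) (g : Om -> W2) (h : Om -> W') :
  (forall o o', f o = f o' -> g o = g o' -> h o = h o') ->
  shannon (law h) <= shannon (law f) + shannon (law g).
Proof.
move=> fgh.
apply: (@le_trans _ _ (shannon (law (fun o => (f o, g o))))).
  by apply: shannon_law_le => o o' [/fgh /[apply]].
apply: le_trans (gibbs (q := fun w => law f w.1 * law g w.2) _ _ _ _) _.
- by move=> w; exact: law_ge0.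
- by move=> w; rewrite mulr_ge0// law_ge0.
- move=> [a b] /=; apply: contraTT; rewrite -!leNgt => ab.
  have /eqP : law f a * law g b = 0.
    by apply/eqP; rewrite eq_le ab mulr_ge0// law_ge0.
  rewrite mulf_eq0 => /orP[] /eqP fa.
    rewrite -fa /law [leRHS]big_mkcond [leLHS]big_mkcond; apply: ler_sum => o _.
    by case: eqP => [[-> _]|_]; [rewrite eqxx|case: ifP].
  rewrite -fa /law [leRHS]big_mkcond [leLHS]big_mkcond; apply: ler_sum => o _.
  by case: eqP => [[_ ->]|_]; [rewrite eqxx|case: ifP].
- rewrite sum_law1 -(pair_bigA _ (fun a b => law f a * law g b))/=.
  under eq_bigr do rewrite -mulr_sumr sum_law1 mulr1.
  by rewrite sum_law1.
- rewrite (sum_law _ (fun w => ln (law f w.1 * law g w.2)))/= !shannon_lawE.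
  rewrite -opprD lerN2 -big_split/=; apply: ler_sum => o _.
  have [pz|po0] := eqVneq (p o) 0; first by rewrite pz !mul0r addr0.
  have po : 0 < p o by rewrite lt_neqAle eq_sym po0 p0.
  by rewrite lnM ?posrE ?law_gt0// mulrDr.
Qed.

Lemma shannon_law_sum (W W' : finType) (s : seq nat) (f : nat -> Om -> W) (h : Om -> W') :
  (forall o o', {in s, forall i, f i o = f i o'} -> h o = h o') ->
  shannon (law h) <= \sum_(i <- s) shannon (law (f i)).
Proof.
elim: s W' h => [|i s IH] W' h fh.
  have [x0 _|noO] := pickP (@predT Om); last first.
    by move: p1; rewrite big_pred0// => /esym/eqP; rewrite oner_eq0.
  rewrite big_nil shannon_lawE oppr_le0 sumr_ge0// => o _.
  suff -> : law h (h o) = 1 by rewrite ln1 mulr0.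
  by rewrite -p1; apply: eq_bigl => o'; rewrite (fh o' o)// eqxx.
(* The joint variable of the [f j] with [j] in [s], encoded by its own fibre: a value in a fixed
   finite type whatever the length of [s]. *)
pose g o := [set o' | all (fun j => f j o' == f j o) s]%SET.
rewrite big_cons; apply: le_trans (shannon_lawD (f := f i) (g := g) _) _.
  move=> o o' fi go; apply: fh => j; rewrite inE => /predU1P[->//|js].
  have : o \in g o' by rewrite -go inE; apply/allP.
  by rewrite inE => /allP/(_ _ js)/eqP.
rewrite lerD2l; apply: IH => o o' oo'; apply/setP => u; rewrite !inE.
by apply: eq_in_all => j /oo' ->.
Qed.

End law.

End finite_entropy.

(** * Finite subcovers *)

Section compact_covers.
Context {T : topologicalType}.

(** Otherwise the complements of finite unions generate a proper filter, and a cluster point [p] of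
    it would meet the complement of [V p] inside [V p]. Neighbourhoods rather than open sets suit
    the closed basic sets of the weak-star topology. *)
Lemma compact_nbhs_cover (V : T -> set T) : compact [set: T] ->
  (forall t, nbhs t (V t)) -> exists s : seq T, forall x, exists2 t, t \in s & V t x.
Proof.
move=> cT nV; apply: contrapT => /forallNP noV.
pose F := [set A : set T | exists s : seq T,
  [set x | forall t, t \in s -> ~ V t x] `<=` A].
have FF : ProperFilter F.
  apply: Build_ProperFilter_ex => [B [s sB]|].
    have /existsNP[x Vx] := noV s.
    by exists x; apply: sB => t ts Vtx; apply: Vx; exists t.
  split.
  - by exists [::].
  - move=> P Q [s sP] [s' s'Q]; exists (s ++ s') => x xV; split.
      by apply: sP => t ts; apply: xV; rewrite mem_cat ts.
    by apply: s'Q => t ts; apply: xV; rewrite mem_cat ts orbT.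
  - by move=> P Q PQ [s sP]; exists s; apply: subset_trans sP PQ.
have [|p [_ clp]] := cT F FF; first by exists [::].
have Fp : F (~` V p) by exists [:: p] => x; apply; rewrite inE.
by have [x [Vx]] := clp _ _ Fp (nV p).
Qed.

(** Monotonicity turns a finite subcover into a single index. Boundedness, Dini's argument and the
    uniformity of expansivity all use compactness in this form. *)
Lemma compact_nondecreasing_cover (W : nat -> set T) : compact [set: T] ->
  (forall n, open (W n)) -> (forall m n, (m <= n)%N -> W m `<=` W n) ->
  (forall x, exists n, W n x) -> exists n, forall x, W n x.
Proof.
move=> cT oW mW /choice[n Wn].
have [|s scov] := @compact_nbhs_cover (fun x => W (n x)) cT.
  by move=> x; apply: open_nbhs_nbhs; split.
exists (\max_(x <- s) n x)%N => x; have [t ts Wtx] := scov x.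
by apply: mW Wtx; exact: leq_bigmax_seq.
Qed.

End compact_covers.

(** * Continuous real functions *)

Section continuous_real_functions.
Context {R : realType} {T : topologicalType}.
Implicit Types f g : T -> R.

Lemma continuous_addr f g : continuous f -> continuous g ->
  continuous (fun x => f x + g x).
Proof. by move=> cf cg x; apply: cvgD; [exact: cf|exact: cg]. Qed.

Lemma continuous_subr f g : continuous f -> continuous g ->
  continuous (fun x => f x - g x).
Proof. by move=> cf cg x; apply: cvgB; [exact: cf|exact: cg]. Qed.

Lemma continuous_mulr f g : continuous f -> continuous g ->
  continuous (fun x => f x * g x).
Proof. by move=> cf cg x; apply: cvgM; [exact: cf|exact: cg]. Qed.

Lemma continuous_cstr (c : R) : continuous (fun _ : T => c).
Proof. by move=> x; exact: cvg_cst. Qed.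

Lemma continuous_normr f : continuous f -> continuous (fun x => `|f x|).
Proof. by move=> cf x; apply: cvg_norm; exact: cf. Qed.

Lemma continuous_minr f g : continuous f -> continuous g ->
  continuous (fun x => Num.min (f x) (g x)).
Proof.
move=> cf cg; rewrite (_ : (fun _ => _) =
    fun x => (f x + g x - `|f x - g x|) * 2^-1); last first.
  by apply/funext => x; exact: minr_absE.
apply: continuous_mulr; last exact: continuous_cstr.
apply: continuous_subr; first exact: continuous_addr.
by apply: continuous_normr; exact: continuous_subr.
Qed.

Lemma continuous_maxr f g : continuous f -> continuous g ->
  continuous (fun x => Num.max (f x) (g x)).
Proof.
move=> cf cg; rewrite (_ : (fun _ => _) =
    fun x => (f x + g x + `|f x - g x|) * 2^-1); last first.
  by apply/funext => x; exact: maxr_absE.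
apply: continuous_mulr; last exact: continuous_cstr.
apply: continuous_addr; first exact: continuous_addr.
by apply: continuous_normr; exact: continuous_subr.
Qed.

Lemma continuous_sumr I (s : seq I) (f : I -> T -> R) :
  (forall i, continuous (f i)) -> continuous (fun x => \sum_(i <- s) f i x).
Proof.
move=> cf; elim: s => [|i s IH].
  rewrite (_ : (fun _ => _) = fun=> 0); first exact: continuous_cstr.
  by apply/funext => x; rewrite big_nil.
rewrite (_ : (fun _ => _) = fun x => f i x + \sum_(j <- s) f j x).
  exact: continuous_addr.
by apply/funext => x; rewrite big_cons.
Qed.

Lemma open_ltr f g : continuous f -> continuous g -> open [set x | f x < g x].
Proof.
move=> cf cg; rewrite (_ : mkset _ = (fun x => g x - f x) @^-1` [set y | 0 < y]).
  apply: open_comp; last exact: open_gt.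
  by move=> x _; exact: continuous_subr.
by apply/funext => x; rewrite /= subr_gt0.
Qed.

End continuous_real_functions.

Section metric_functions.
Context {R : realType} {X : pointedMetricType R}.

Lemma lipschitz_continuous (f : X -> R) :
  (forall x y, f x <= f y + mdist x y) -> continuous f.
Proof.
move=> fl x; apply/cvgrPdist_lt => e e0.
near=> y.
have : mdist x y < e.
  by near: y; have := nbhsx_ballx x e e0; rewrite ballEmdist.
have := fl x y; have := fl y x; rewrite [mdist y x]metric_sym => h1 h2 h3.
by rewrite ltr_norml; lra.
Unshelve. all: by end_near. Qed.

Lemma mdist_continuous (x : X) : continuous (mdist x).
Proof.
apply: lipschitz_continuous => y z.
by rewrite [mdist y z]metric_sym; exact: metric_triangle.
Qed.

Lemma open_cozero (U : set X) : open U -> exists phi : X -> R,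
  [/\ continuous phi, forall x, 0 <= phi x <= 1 & forall x, 0 < phi x <-> U x].
Proof.
(* The infimum of [D x] is the distance to the complement of [U], cut off at [1]; the extra element
   [1] keeps [D x] nonempty when [U] is the whole space. *)
move=> oU; pose D x := [set Num.min 1 (mdist x y) | y in ~` U] `|` [set 1].
have D1 x : D x 1 by right.
have Dlb x : lbound (D x) 0.
  by move=> _ [[y _ <-]|->]//; rewrite le_min ler01 mdist_ge0.
have Dhl x : has_lbound (D x) by exists 0.
have Dhi x : has_inf (D x) by split=> //; exists 1.
exists (fun x => inf (D x)); split.
- apply: lipschitz_continuous => x z; rewrite -lerBlDr.
  apply: lb_le_inf; first by exists 1.
  move=> _ [[y yU <-]|->]; last first.
    by rewrite lerBlDr ler_wpDr ?mdist_ge0//; apply: ge_inf => //; exact: D1.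
  rewrite lerBlDr.
  apply: (@le_trans _ _ (Num.min 1 (mdist x y))).
    by apply: ge_inf => //; left; exists y.
  have := metric_triangle x z y; have := mdist_ge0 x z.
  move=> dxz dxy; rewrite -lerBlDr le_min; apply/andP; split.
    by rewrite lerBlDr ge_min lerDl dxz.
  by rewrite lerBlDr ge_min addrC dxy orbT.
- by move=> x; rewrite lb_le_inf//=; [apply: ge_inf|exists 1].
- move=> x; split.
    apply: contraPP => xU; apply/negP; rewrite -leNgt; apply: ge_inf => //.
    by left; exists x => //; rewrite mdistxx; apply/min_idPr.
  move=> Ux; have /nbhs_ballP[e /= e0 xeU] : nbhs x U by exact: open_nbhs_nbhs.
  apply: (@lt_le_trans _ _ (Num.min 1 e)); first by rewrite lt_min ltr01.
  apply: lb_le_inf; first by exists 1.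
  move=> _ [[y yU <-]|->]; last by rewrite ge_min lexx.
  rewrite le_min ge_min lexx/= ge_min; apply/orP; right.
  rewrite leNgt; apply/negP => xye; apply: yU; apply: xeU.
  by rewrite ballEmdist.
Qed.

End metric_functions.

(** * Integrals of bounded measurable functions *)

Section bounded_measurable_functions.
Context {R : realType}.
Implicit Types d : measure_display.

(** A class stable under the algebraic operations and integrable for every probability, so that
    linearity and monotonicity of integrals have one side condition that does not mention the
    measure. *)
Definition bounded_measurable d (T : measurableType d) (f : T -> R) :=
  measurable_fun setT f /\ exists M, forall x, `|f x| <= M.

Lemma bounded_measurable_comp d d' (T : measurableType d) (T' : measurableType d')
    (g : T' -> T) (f : T -> R) :
  measurable_fun setT g -> bounded_measurable f ->
  bounded_measurable (fun x => f (g x)).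
Proof.
by move=> mg [mf [M fM]]; split; [exact: measurableT_comp mf mg|exists M].
Qed.

Context d (T : measurableType d).
Implicit Types (mu : probability T R) (f g : T -> R).

Lemma bounded_integrable mu f (M : R) :
  measurable_fun [set: T] f -> (forall x, `|f x| <= M) ->
  mu.-integrable setT (EFin \o f).
Proof.
move=> mf fM; apply: measurable_bounded_integrable => //.
  by rewrite (le_lt_trans (probability_le1 _ _)) ?ltry.
by exists M; split; rewrite ?num_real// => y My x _; exact: le_trans (fM x) (ltW My).
Qed.

Lemma bounded_measurable_integrable mu f : bounded_measurable f ->
  mu.-integrable setT (EFin \o f).
Proof. by move=> [mf [M fM]]; exact: bounded_integrable fM. Qed.

Lemma bounded_measurable_cst c : bounded_measurable (fun _ : T => c).
Proof. by split; [exact: measurable_cst|exists `|c|]. Qed.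

Lemma bounded_measurableD f g : bounded_measurable f -> bounded_measurable g ->
  bounded_measurable (fun x => f x + g x).
Proof.
move=> [mf [M fM]] [mg [N gN]]; split; first exact: measurable_funD.
by exists (M + N) => x; rewrite (le_trans (ler_normD _ _))// lerD.
Qed.

Lemma bounded_measurableM f g : bounded_measurable f -> bounded_measurable g ->
  bounded_measurable (fun x => f x * g x).
Proof.
move=> [mf [M fM]] [mg [N gN]]; split; first exact: measurable_funM.
by exists (M * N) => x; rewrite normrM ler_pM.
Qed.

Lemma bounded_measurableB f g : bounded_measurable f -> bounded_measurable g ->
  bounded_measurable (fun x => f x - g x).
Proof.
move=> bf bg; have := bounded_measurableM (bounded_measurable_cst (-1)) bg.
move/(bounded_measurableD bf); congr bounded_measurable.
by apply/funext => x; rewrite mulN1r.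
Qed.

Lemma bounded_measurable_sum I (s : seq I) (f : I -> T -> R) :
  (forall i, bounded_measurable (f i)) ->
  bounded_measurable (fun x => \sum_(i <- s) f i x).
Proof.
move=> bf; elim: s => [|i s IH].
  rewrite (_ : (fun _ => _) = fun=> 0); first exact: bounded_measurable_cst.
  by apply/funext => x; rewrite big_nil.
rewrite (_ : (fun _ => _) = fun x => f i x + \sum_(j <- s) f j x).
  exact: bounded_measurableD.
by apply/funext => x; rewrite big_cons.
Qed.

Lemma bounded_measurable_indic (A : set T) : measurable A ->
  bounded_measurable (\1_A : T -> R).
Proof.
move=> mA; split; first exact: measurable_indic.
by exists 1 => x; rewrite indicE; case: (_ \in _); rewrite ?normr1 ?normr0.
Qed.

Lemma bounded_measurable_maxr f g : bounded_measurable f -> bounded_measurable g ->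
  bounded_measurable (fun x => Num.max (f x) (g x)).
Proof.
move=> [mf [M fM]] [mg [N gN]]; split; first exact: measurable_maxr.
exists (M + N) => x; have M0 := le_trans (normr_ge0 _) (fM x).
have N0 := le_trans (normr_ge0 _) (gN x).
by case: (leP (f x) (g x)) => _; [apply: le_trans (gN x) _|apply: le_trans (fM x) _]; lra.
Qed.

Lemma measurable_set_ler f g : measurable_fun setT f -> measurable_fun setT g ->
  measurable [set x | f x <= g x].
Proof.
move=> mf mg; have := measurable_fun_ler mf mg measurableT (Logic.I : measurable [set true]).
by rewrite setTI; congr measurable; apply/funext => x /=; apply/propext; split.
Qed.

Lemma measurable_set_ltr f g : measurable_fun setT f -> measurable_fun setT g ->
  measurable [set x | f x < g x].
Proof.
move=> mf mg; have := measurable_fun_ltr mf mg measurableT (Logic.I : measurable [set true]).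
by rewrite setTI; congr measurable; apply/funext => x /=; apply/propext; split.
Qed.

Lemma fine_probability_le1 mu A : measurable A -> fine (mu A) <= 1.
Proof.
by move=> mA; rewrite -lee_fin fineK ?fin_num_measure// probability_le1.
Qed.

Lemma probability_lt1_ex mu B : fine (mu B) < 1 -> exists x, ~ B x.
Proof.
move=> B1; apply: contrapT => /forallNP nB; move: B1.
rewrite (_ : B = setT) ?probability_setT ?ltxx//.
by apply/seteqP; split => // x _; have /contrapT := nB x.
Qed.

Lemma le_fine_probability mu A B : measurable A -> measurable B -> A `<=` B ->
  fine (mu A) <= fine (mu B).
Proof.
move=> mA mB AB; rewrite fine_le ?fin_num_measure//.
by apply: le_measure; rewrite ?inE.
Qed.

Lemma fine_probability_setU mu A B : measurable A -> measurable B ->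
  fine (mu (A `|` B)) <= fine (mu A) + fine (mu B).
Proof.
move=> mA mB; rewrite -fineD ?fin_num_measure// fine_le ?fin_num_measure//.
- exact: measurableU.
- by rewrite fin_numD !fin_num_measure.
- exact: measureU2.
Qed.

(** Continuity from above, in the form by which the exceptional sets below are made small. *)
Lemma probability_vanish mu (F : nat -> set T) : (forall n, measurable (F n)) ->
  (forall n, F n.+1 `<=` F n) -> mu (\bigcap_n F n) = 0%E ->
  forall e, 0 < e -> exists N, forall n, (N <= n)%N -> fine (mu (F n)) <= e.
Proof.
move=> mF niF F0 e e0.
have : mu \o F @ \oo --> mu (\bigcap_n F n).
  apply: nonincreasing_cvg_mu => //.
  - by rewrite (le_lt_trans (probability_le1 _ _)) ?ltry.
  - exact: bigcapT_measurable.
  - by apply/nonincreasing_seqP => n; apply/subsetPset.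
rewrite F0 => /fine_cvg/cvgrPdist_le/(_ _ e0)[N _ FN].
exists N => n /FN; rewrite sub0r normrN; exact: le_trans (ler_norm _).
Qed.

Lemma Rintegral_add mu f g : bounded_measurable f -> bounded_measurable g ->
  \int[mu]_x (f x + g x) = \int[mu]_x f x + \int[mu]_x g x.
Proof. by move=> bf bg; rewrite RintegralD//; exact: bounded_measurable_integrable. Qed.

Lemma Rintegral_sub mu f g : bounded_measurable f -> bounded_measurable g ->
  \int[mu]_x (f x - g x) = \int[mu]_x f x - \int[mu]_x g x.
Proof. by move=> bf bg; rewrite RintegralB//; exact: bounded_measurable_integrable. Qed.

Lemma Rintegral_scale mu c f : bounded_measurable f ->
  \int[mu]_x (c * f x) = c * \int[mu]_x f x.
Proof. by move=> bf; rewrite RintegralZl//; exact: bounded_measurable_integrable. Qed.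

Lemma Rintegral_le mu f g : bounded_measurable f -> bounded_measurable g ->
  (forall x, f x <= g x) -> \int[mu]_x f x <= \int[mu]_x g x.
Proof.
by move=> bf bg fg; apply: le_Rintegral => //; exact: bounded_measurable_integrable.
Qed.

Lemma Rintegral_const mu c : \int[mu]_x c = c.
Proof. by rewrite Rintegral_cst//= probability_setT mulr1. Qed.

Lemma Rintegral_sum mu I (s : seq I) (f : I -> T -> R) :
  (forall i, bounded_measurable (f i)) ->
  \int[mu]_x (\sum_(i <- s) f i x) = \sum_(i <- s) \int[mu]_x f i x.
Proof.
move=> bf; elim: s => [|i s IH].
  by rewrite big_nil; under eq_Rintegral do rewrite big_nil; rewrite Rintegral_const.
rewrite big_cons -IH -Rintegral_add//; last exact: bounded_measurable_sum.
by apply: eq_Rintegral => x _; rewrite big_cons.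
Qed.

Lemma Rintegral_indic mu (A : set T) : measurable A ->
  \int[mu]_x \1_A x = fine (mu A).
Proof. by move=> mA; rewrite /Rintegral integral_indic// setIT. Qed.

End bounded_measurable_functions.

Section borel.
Context {R : realType} {X : pointedMetricType R}.
Implicit Types f : X -> R.

Lemma open_borel (U : set X) : open U -> measurable (U : set (borel X)).
Proof. by move=> oU; exact: sub_sigma_algebra. Qed.

Lemma measurable_fun_borel f : continuous f ->
  measurable_fun [set: borel X] (f : borel X -> R).
Proof.
move=> /continuousP cf; apply: (measurability _ (RGenOpens.measurableE R)).
move=> _ [_ [a [b ->] <-]]; rewrite setTI; apply: open_borel.
exact/cf/interval_open.
Qed.

Lemma continuous_compact_bounded f : compact [set: X] -> continuous f ->
  exists M, forall x, `|f x| <= M.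
Proof.
move=> cX cf; have [] := @compact_nondecreasing_cover X
    (fun n => [set x | `|f x| < n%:R]) cX.
- move=> n; apply: open_ltr; [exact: continuous_normr|exact: continuous_cstr].
- by move=> m n mn x /= /lt_le_trans; apply; rewrite ler_nat.
- move=> x; exists (Num.truncn `|f x|).+1 => /=; exact: truncnS_gt.
- by move=> n fn; exists n%:R => x; exact/ltW/fn.
Qed.

Lemma continuous_bounded_measurable f : compact [set: X] -> continuous f ->
  bounded_measurable (f : borel X -> R).
Proof.
move=> cX cf; split; first exact: measurable_fun_borel.
exact: continuous_compact_bounded.
Qed.

End borel.

(** * Riesz representation on a compact metric space *)

Section riesz.
Context {R : realType} {X : pointedMetricType R}.
Variable L : (X -> R) -> R.
Hypothesis cX : compact [set: X].
Hypothesis L_ge0 : forall f : X -> R, continuous f -> (forall x, 0 <= f x) -> 0 <= L f.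
Hypothesis LD : forall f g : X -> R, continuous f -> continuous g ->
  L (fun x => f x + g x) = L f + L g.
Hypothesis LZ : forall c (f : X -> R), continuous f -> L (fun x => c * f x) = c * L f.
Hypothesis L1 : L (fun=> 1) = 1.

Let Lcst c : L (fun=> c) = c.
Proof.
rewrite -[RHS]mulr1 -L1 -LZ; last exact: continuous_cstr.
by congr L; apply/funext => x; rewrite mulr1.
Qed.

Let LB (f g : X -> R) : continuous f -> continuous g -> L (fun x => f x - g x) = L f - L g.
Proof.
move=> cf cg; apply/eqP; rewrite eq_sym subr_eq -LD//; last exact: continuous_subr.
by apply/eqP; congr L; apply/funext => x; rewrite subrK.
Qed.

Let le_L (f g : X -> R) : continuous f -> continuous g -> (forall x, f x <= g x) ->
  L f <= L g.
Proof.
move=> cf cg fg; rewrite -subr_ge0 -LB//; apply: L_ge0.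
  exact: continuous_subr.
by move=> x; rewrite subr_ge0.
Qed.

Let L_sum I (s : seq I) (f : I -> X -> R) : (forall i, continuous (f i)) ->
  L (fun x => \sum_(i <- s) f i x) = \sum_(i <- s) L (f i).
Proof.
move=> cf; elim: s => [|i s IH].
  rewrite big_nil -[RHS](Lcst 0); congr L; apply/funext => x.
  by rewrite big_nil.
rewrite big_cons -IH -LD//; last exact: continuous_sumr.
by congr L; apply/funext => x; rewrite big_cons.
Qed.

(** Vanishing off [U] takes the place of compact support inside [U]: open sets of a metric space are
    cozero sets, which is what the countable subadditivity of [theta] exploits. *)
Let subord (U : set X) := [set f : X -> R | [/\ continuous f,
  forall x, 0 <= f x <= 1 & forall x, ~ U x -> f x = 0]].

Let theta U := sup (L @` subord U).

Let subord0 U : (L @` subord U) 0.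
Proof.
exists (fun=> 0); last exact: Lcst.
split; [exact: continuous_cstr| |by []].
by move=> x; rewrite lexx ler01.
Qed.

Let subord1 U : ubound (L @` subord U) 1.
Proof.
move=> _ [f [cf f01 _] <-]; rewrite -L1; apply: le_L => //.
  exact: continuous_cstr.
by move=> x; have /andP[] := f01 x.
Qed.

Let subord_sup U : has_sup (L @` subord U).
Proof. by split; [exists 0|exists 1]. Qed.

Let theta_ub U f : subord U f -> L f <= theta U.
Proof. by move=> Uf; apply: ub_le_sup; [exists 1|exists f]. Qed.

Let theta_ge0 U : 0 <= theta U.
Proof. by apply: ub_le_sup; [exists 1|]. Qed.

Let theta_adh U e : 0 < e -> exists2 f, subord U f & theta U - e < L f.
Proof.
move=> e0; have [_ [f Uf <-] Lf] := sup_adherent e0 (subord_sup U).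
by exists f.
Qed.

Let theta0 : theta set0 = 0.
Proof.
rewrite /theta (_ : L @` subord set0 = [set 0]) ?sup1//.
apply/seteqP; split=> [_ [f [cf f01 f0] <-]|_ -> //].
rewrite /= -[RHS](Lcst 0); congr L; apply/funext => x; exact: f0.
Qed.

Let thetaT : theta setT = 1.
Proof.
apply/eqP; rewrite eq_le; apply/andP; split.
  by apply: ge_sup; [exists 0|exact: subord1].
rewrite -[leLHS]L1; apply: theta_ub; split.
- exact: continuous_cstr.
- by move=> x; rewrite ler01 lexx.
- by move=> x [].
Qed.

(* Dini: on the compact space [X], [f <= \sum_(i < N) min 1 (N phi_i) + e] for
   [N] large, where [phi_i] is positive exactly on [U i]. *)
Let theta_bigcup (U : nat -> set X) : (forall i, open (U i)) ->
  ((theta (\bigcup_i U i))%:E <= \sum_(i <oo) (theta (U i))%:E)%E.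
Proof.
move=> oU.
have [phi phiP] := choice (fun i => open_cozero (oU i)).
have cphi i : continuous (phi i) by have [] := phiP i.
have phi01 i x : 0 <= phi i x by have [_ /(_ x)/andP[]] := phiP i.
pose h N i x := Num.min 1 (N%:R * phi i x).
have ch N i : continuous (h N i).
  apply: continuous_minr; first exact: continuous_cstr.
  by apply: continuous_mulr => //; exact: continuous_cstr.
have h0 N i x : 0 <= h N i x by rewrite le_min ler01 mulr_ge0.
have hU N i : subord (U i) (h N i).
  split=> // x; first by rewrite h0 ge_min lexx.
  have [_ _ phiU] := phiP i => nUx.
  have phi0 : phi i x = 0.
    by apply/eqP; rewrite eq_le phi01 andbT leNgt; apply/negP => /phiU.
  by rewrite /h phi0 mulr0; apply/min_idPr.
apply/lee_addgt0Pr => e e0.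
suff H f : subord (\bigcup_i U i) f ->
    ((L f)%:E <= \sum_(i <oo) (theta (U i))%:E + e%:E)%E.
  have [s_|s_] := leP (+oo%E) (\sum_(i <oo) (theta (U i))%:E)%E.
    by move: s_; rewrite leye_eq => /eqP ->; rewrite addye// leey.
  have sfin : (\sum_(i <oo) (theta (U i))%:E)%E \is a fin_num.
    rewrite ge0_fin_numE//; apply: nneseries_ge0 => i _ _.
    by rewrite lee_fin theta_ge0.
  rewrite -(fineK sfin) -EFinD lee_fin; apply: ge_sup; first by exists 0.
  by move=> _ [f Uf <-]; rewrite -lee_fin EFinD fineK//; exact: H.
move=> [cf f01 fU].
have [| | |N fN] := @compact_nondecreasing_cover X
    (fun N => [set x | f x < \sum_(i <- index_iota 0 N) h N i x + e]) cX.
- move=> N; apply: open_ltr => //; apply: continuous_addr.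
    exact: continuous_sumr.
  exact: continuous_cstr.
- move=> m n mn x /= /lt_le_trans; apply; rewrite lerD2r.
  rewrite (big_cat_nat (leq0n m) mn)/= ler_wpDr ?sumr_ge0//; apply: ler_sum => i _.
  by rewrite le_min !ge_min lexx/= ler_wpM2r ?orbT// ler_nat.
- move=> x; have [[j _ Ujx]|nU] := pselect ((\bigcup_i U i) x); last first.
    by exists 0%N => /=; rewrite fU// big_geq// add0r.
  have phix : 0 < phi j x by have [_ _ /(_ x)[_]] := phiP j; apply.
  pose N := maxn j.+1 (Num.truncn (phi j x)^-1).+1.
  have N1 : 1 <= N%:R * phi j x.
    rewrite -ler_pdivrMr// mul1r; apply: le_trans (ltW (truncnS_gt _)) _.
    by rewrite ler_nat leq_maxr.
  exists N => /=; apply: (@le_lt_trans _ _ 1); first by have /andP[] := f01 x.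
  rewrite (bigD1_seq j)/= ?mem_index_iota ?iota_uniq ?leq_maxl//.
  rewrite {1}/h (min_idPl N1) -addrA ltrDl ltr_wpDl// sumr_ge0//.
have : L f <= \sum_(i <- index_iota 0 N) theta (U i) + e.
  apply: le_trans (_ : L (fun x => \sum_(i <- index_iota 0 N) h N i x + e) <= _).
    apply: le_L => //; last by move=> x; exact/ltW/fN.
    by apply: continuous_addr; [exact: continuous_sumr|exact: continuous_cstr].
  rewrite LD; [|exact: continuous_sumr|exact: continuous_cstr].
  rewrite Lcst lerD2r L_sum//; apply: ler_sum => i _; exact: theta_ub.
rewrite -lee_fin => /le_trans; apply; rewrite EFinD leeD2r// -sumEFin.
by apply: nneseries_lim_ge => i _; rewrite lee_fin theta_ge0.
Qed.

Let rho (A : set X) : R := inf [set theta U | U in [set U | open U /\ A `<=` U]].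

Let rho_lb A : has_lbound [set theta U | U in [set U | open U /\ A `<=` U]].
Proof. by exists 0 => _ [U _ <-]. Qed.

Let rho_n0 A : [set theta U | U in [set U | open U /\ A `<=` U]] !=set0.
Proof. by exists (theta setT); exists setT => //; split=> //; exact: openT. Qed.

Let rho_ub A U : open U -> A `<=` U -> rho A <= theta U.
Proof. by move=> oU AU; apply: ge_inf => //; exists U. Qed.

Let rho_ge0 A : 0 <= rho A.
Proof. by apply: lb_le_inf => // _ [U _ <-]. Qed.

Let rho_adh A e : 0 < e -> exists U, [/\ open U, A `<=` U & theta U < rho A + e].
Proof.
move=> e0.
have [_ [U [oU AU] <-] Ue] := inf_adherent e0 (conj (rho_n0 A) (rho_lb A)).
by exists U.
Qed.

Let rhoE A : \bar R := (rho A)%:E.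

Let rhoE0 : rhoE set0 = 0%E.
Proof.
congr EFin; apply/eqP; rewrite eq_le rho_ge0 andbT -theta0.
by apply: rho_ub => //; exact: open0.
Qed.

Let rhoE_ge0 A : (0 <= rhoE A)%E.
Proof. by rewrite lee_fin. Qed.

Let rhoE_le : {homo rhoE : A B / A `<=` B >-> (A <= B)%E}.
Proof.
move=> A B AB; rewrite lee_fin; apply: lb_le_inf => // _ [U [oU BU] <-].
by apply: rho_ub => //; exact: subset_trans BU.
Qed.

Let rhoE_subadd : sigma_subadditive rhoE.
Proof.
move=> A; apply/lee_addgt0Pr => e e0.
have en n : 0 < e / (2 ^ n.+1)%:R by rewrite divr_gt0// ltr0n expn_gt0.
have [U UP] := choice (fun n => rho_adh (A n) (en n)).
have oU n : open (U n) by have [] := UP n.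
apply: (@le_trans _ _ (theta (\bigcup_n U n))%:E).
  rewrite lee_fin; apply: rho_ub; first exact: bigcup_open.
  by apply: subset_bigcup => i _; have [] := UP i.
apply: le_trans (theta_bigcup oU) _.
apply: le_trans (epsilon_trick _ _ (ltW e0)); last by move=> n; exact: rhoE_ge0.
apply: lee_nneseries => n _; first by rewrite lee_fin.
by rewrite -EFinD lee_fin; have [_ _ /ltW] := UP n.
Qed.

HB.instance Definition _ :=
  isOuterMeasure.Build R X rhoE rhoE0 rhoE_ge0 rhoE_le rhoE_subadd.

(** For an open [V] containing [A], take [f] nearly optimal for the part of [V] in [U]. The set [W]
    where [f < e / 3] contains the rest of [V], as [f] vanishes off [U]; for [g] nearly optimal on
    [W], the sum [f + g] is at most [1 + e / 3], so after rescaling it is subordinate to [V]. *)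
Let open_caratheodory (U : set X) : open U -> caratheodory_measurable rhoE U.
Proof.
move=> oU; apply: le_caratheodory_measurable => A.
rewrite -EFinD lee_fin; apply: lb_le_inf => // _ [V [oV AV] <-].
apply/ler_addgt0Pl => e e0; have e3 : 0 < e / 3 by rewrite divr_gt0.
have [f [cf f01 fVU] Lf] := theta_adh (V `&` U) e3.
pose W := V `&` [set x | f x < e / 3].
have oW : open W by apply: openI => //; apply: open_ltr => //; exact: continuous_cstr.
have [g [cg g01 gW] Lg] := theta_adh W e3.
have h1 : rho (A `&` U) <= theta (V `&` U).
  by apply: rho_ub; [exact: openI|exact: setSI].
have h2 : rho (A `&` ~` U) <= theta W.
  apply: rho_ub => // x [Ax nUx]; split; first exact: AV.
  by rewrite /= fVU// => -[].
have h3 : L f + L g <= (1 + e / 3) * theta V.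
  rewrite -ler_pdivrMl ?addr_gt0// -LD// -LZ; last exact: continuous_addr.
  apply: theta_ub; split.
  - apply: continuous_mulr; first exact: continuous_cstr.
    exact: continuous_addr.
  - move=> x; have /andP[f0 f1] := f01 x; have /andP[g0 g1] := g01 x.
    rewrite mulr_ge0 ?addr_ge0 ?invr_ge0 ?addr_ge0 ?(ltW e3)//=.
    rewrite ler_pdivrMl ?addr_gt0// mulr1.
    have [[Vx /= fx]|nWx] := pselect (W x); first lra.
    by rewrite (gW _ nWx); lra.
  - move=> x nVx; rewrite fVU ?gW ?addr0 ?mulr0//; by case.
have thV : theta V <= 1 by apply: ge_sup; [exists 0|exact: subord1].
have h4 : e / 3 * theta V <= e / 3 by rewrite ler_piMr// ltW.
by lra.
Qed.

Let borel_caratheodory (A : set (borel X)) : measurable A ->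
  caratheodory_measurable rhoE A.
Proof.
move=> mA; have : sigma_algebra setT (caratheodory_measurable rhoE).
  split; first exact: caratheodory_measurable_set0.
    by move=> B mB; rewrite setTD; exact: caratheodory_measurable_setC.
  exact: caratheodory_measurable_bigcup.
by move=> sC; apply: (smallest_sub sC _ mA) => B; exact: open_caratheodory.
Qed.

Let riesz : set (borel X) -> \bar R := rhoE.

Let riesz_sigma_additive : semi_sigma_additive riesz.
Proof.
move=> A mA tA mbA; apply: (@caratheodory_measure_sigma_additive _ _ rhoE) => //.
  by move=> i; exact: borel_caratheodory.
exact: borel_caratheodory.
Qed.

HB.instance Definition _ :=
  isMeasure.Build _ _ _ riesz rhoE0 rhoE_ge0 riesz_sigma_additive.

Let riesz_setT : riesz setT = 1%E.
Proof.
congr EFin; apply/eqP; rewrite eq_le -{1}thetaT rho_ub//; last exact: openT.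
apply: lb_le_inf => // _ [U [oU TU] <-].
by rewrite (_ : U = setT) ?thetaT//; apply/seteqP; split.
Qed.

HB.instance Definition _ :=
  Measure_isProbability.Build _ _ _ riesz riesz_setT.

(** The set where [g] is at least [1] need not be open, so it is enlarged to the set where [g]
    exceeds [(1 + e)^-1]; there [(1 + e) g] dominates every subordinate function. *)
Let riesz_le (A : set (borel X)) (g : X -> R) : continuous g ->
  (forall x, 0 <= g x) -> (forall x, A x -> 1 <= g x) -> fine (riesz A) <= L g.
Proof.
move=> cg g0 gA; rewrite /=.
suff H e : 0 < e -> (1 + e)^-1 * rho A <= L g.
  apply/ler_addgt0Pl => e e0.
  have Lg0 : 0 <= L g by exact: L_ge0.
  (* This value makes the multiplicative error in [L g] at most [e]. *)
  have d0 : 0 < e / (1 + L g) by rewrite divr_gt0// ltr_pwDl.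
  have := H _ d0; rewrite ler_pdivrMl ?addr_gt0// => /le_trans; apply.
  rewrite mulrDl mul1r addrC lerD2r -mulrA ler_piMr ?(ltW e0)//.
  by rewrite mulrC ler_pdivrMr ?ltr_pwDl// mul1r lerDr.
move=> e0; rewrite ler_pdivrMl ?addr_gt0//.
apply: (@le_trans _ _ (theta [set x | (1 + e)^-1 < g x])).
  apply: rho_ub; first by apply: open_ltr => //; exact: continuous_cstr.
  move=> x /gA/=; apply: lt_le_trans.
  by rewrite invf_lt1 ?addr_gt0// ltrDl.
apply: ge_sup; first by exists 0.
move=> _ [f [cf f01 fU] <-]; rewrite -LZ//; apply: le_L => //.
  by apply: continuous_mulr => //; exact: continuous_cstr.
move=> x; have /andP[f0 f1] := f01 x.
have [Ux|nUx] := ltP (1 + e)^-1 (g x); last first.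
  by rewrite fU ?mulr_ge0 ?addr_ge0 ?(ltW e0)//=; rewrite ltNge nUx.
by apply: le_trans f1 _; rewrite -ler_pdivrMl ?addr_gt0// mulr1 ltW.
Qed.

(* Slicing [f] into the pieces [min f ((i+1)d) - min f (id)]: the [i]-th one is
   at most [d] on [f > id], where the previous one equals [d]. *)
Let riesz_int_le (f : X -> R) : continuous f -> (forall x, 0 <= f x) ->
  \int[riesz]_x f x <= L f.
Proof.
move=> cf f0; apply/ler_addgt0Pl => e e0.
have [M fM] := continuous_compact_bounded cX cf.
pose N := (Num.truncn (M / e)).+1.
have MN : M <= e * N%:R by rewrite mulrC -ler_pdivrMr// ltW// truncnS_gt.
pose r (i : nat) x := Num.min (f x) (e * i.+1%:R) - Num.min (f x) (e * i%:R).
have cr i : continuous (r i).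
  by apply: continuous_subr; apply: continuous_minr => //; exact: continuous_cstr.
have br i : bounded_measurable (r i : borel X -> R).
  exact: continuous_bounded_measurable.
have fE x : f x = \sum_(i <- index_iota 0 N) r i x.
  rewrite telescope_sumr// mulr0 (min_idPr (f0 x)) subr0; apply/esym/min_idPl.
  by apply: le_trans MN; apply: le_trans (fM x); exact: ler_norm.
have rle i x : r i x <= e.
  rewrite /r lerBlDr -lerBlDl le_min !lerBlDl !ge_min lerDr (ltW e0)/=.
  by rewrite -natr1 mulrDr mulr1 addrC lexx orbT.
have r0 i x : 0 <= r i x.
  rewrite subr_ge0 le_min !ge_min lexx/= ler_wpM2l ?orbT ?ler_nat//.
  exact: ltW.
have rmu i : \int[riesz]_x r i x <= e * fine (riesz [set x | e * i%:R < f x]).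
  rewrite -Rintegral_indic; last first.
    by apply: open_borel; apply: open_ltr => //; exact: continuous_cstr.
  have mI : bounded_measurable (\1_[set x | e * i%:R < f x] : borel X -> R).
    apply: bounded_measurable_indic; apply: open_borel.
    by apply: open_ltr => //; exact: continuous_cstr.
  rewrite -Rintegral_scale//; apply: Rintegral_le => //.
    by apply: bounded_measurableM => //; exact: bounded_measurable_cst.
  move=> x; rewrite indicE; have [fx|fx] := ltP (e * i%:R) (f x).
    by rewrite mem_set// mulr1.
  rewrite memNset ?mulr0; last by apply/negP; rewrite -leNgt.
  rewrite /r !(min_idPl _) ?subrr//; apply: le_trans fx _.
  by rewrite ler_wpM2l ?ler_nat// ltW.
have murL i : e * fine (riesz [set x | e * i.+1%:R < f x]) <= L (r i).
  rewrite -ler_pdivlMl// -LZ//; apply: riesz_le.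
  - by apply: continuous_mulr => //; exact: continuous_cstr.
  - by move=> x; rewrite mulr_ge0// invr_ge0 ltW.
  - move=> x /= fx; rewrite ler_pdivlMl// mulr1 /r.
    rewrite (min_idPr (ltW fx)) (min_idPr _); last first.
      by apply: le_trans (ltW fx); rewrite ler_wpM2l ?ler_nat// ltW.
    by rewrite -mulrBr -natr1 addrAC subrr add0r mulr1.
have -> : \int[riesz]_x f x = \int[riesz]_x (\sum_(i <- index_iota 0 N) r i x).
  by apply: eq_Rintegral => x _; exact: fE.
rewrite Rintegral_sum//.
have -> : L f = \sum_(i <- index_iota 0 N) L (r i).
  by rewrite -L_sum//; congr L; apply/funext => x; exact: fE.
(* Slices are compared with a shift by one: the integral of the first one is left over and costs at
   most [e], while the last value of [L] is nonnegative and dropped. *)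
rewrite big_nat_recl//; apply: lerD.
  apply: le_trans (rmu _) _; rewrite ler_piMr ?(ltW e0)//.
  by rewrite -thetaT; apply: rho_ub => //; exact: openT.
rewrite [leRHS]big_nat_recr//= ler_wpDr//; first by apply: L_ge0.
apply: ler_sum => i _; exact: le_trans (rmu _) (murL _).
Qed.

(** [riesz_int_le] is one-sided; applied to the nonnegative functions [f + M] and [M - f] it yields
    both inequalities, since integral and [L] agree on constants. *)
Lemma riesz_representation : exists mu : probability (borel X) R,
  forall f : X -> R, continuous f -> \int[mu]_x f x = L f.
Proof.
exists riesz => f cf; have [M fM] := continuous_compact_bounded cX cf.
have bf : bounded_measurable (f : borel X -> R).
  exact: continuous_bounded_measurable.
have bc : bounded_measurable ((fun=> M) : borel X -> R).
  exact: bounded_measurable_cst.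
have cc : continuous (fun _ : X => M) by exact: continuous_cstr.
have h1 : \int[riesz]_x (f x + M) <= L (fun x => f x + M).
  apply: riesz_int_le; first exact: continuous_addr.
  by move=> x; have := fM x; rewrite ler_norml; lra.
have h2 : \int[riesz]_x (M - f x) <= L (fun x => M - f x).
  apply: riesz_int_le; first exact: continuous_subr.
  by move=> x; have := fM x; rewrite ler_norml; lra.
move: h1 h2; rewrite Rintegral_add// Rintegral_sub// Rintegral_const LD// LB//.
by rewrite Lcst => h1 h2; apply/eqP; rewrite eq_le; apply/andP; split; lra.
Qed.

End riesz.

Lemma ptws_cvgP (U : choiceType) (V : topologicalType)
    (F : set_system {ptws U -> V}) (f : {ptws U -> V}) : Filter F ->
  F --> f <-> forall t : U, (fun g : {ptws U -> V} => g t) @ F --> f t.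
Proof.
move=> FF.
have ptT t : (fun g : {ptws U -> V} => g t) @` setT = setT.
  by rewrite eqEsubset; split=> v // _; exists (fun=> v).
rewrite cvg_sup; split=> Ff t; have := Ff t.
  move=> /(cvg_image _ _ (ptT t)) Fft W /Fft[B FB BW].
  suff : F ((fun g : {ptws U -> V} => g t) @^-1` W) by [].
  by apply: filterS FB => g Bg; rewrite /= -BW; exists g.
move=> Fft; apply/(cvg_image _ _ (ptT t)) => W /Fft FW.
exists ((fun g : {ptws U -> V} => g t) @^-1` W) => //.
by rewrite image_preimage// ptT.
Qed.

(** * Weak-star topology and ultralimits of functionals *)

Section weak_topology.
Context {R : realType} {X : pointedMetricType R}.
Local Notation prob := (probability (borel X) R).
Implicit Types mu nu : prob.

Lemma weak_cvg (F : set_system prob) mu : Filter F ->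
  (forall f : X -> R, continuous f ->
    (fun nu : prob => \int[nu]_x f x) @ F --> \int[mu]_x f x) ->
  F --> (mu : weak_prob X).
Proof.
move=> FF Fmu A [_ [[B oB <-] Bmu] BA].
pose I (nu : prob) : {ptws continuousType X R -> R} :=
  (fun f : continuousType X R => (\int[nu]_x (f x))%R).
have FI : fmap I F --> I mu.
  apply/ptws_cvgP => f; exact: (Fmu f (@cts_fun _ _ f)).
have /FI : nbhs (I mu) B by exact: open_nbhs_nbhs.
by move=> FB; apply: (filterS BA); exact: FB.
Qed.

(** The inequality is not strict, so that it survives both averages and limits of measures. *)
Definition weak_basic mu (fs : seq (X -> R)) (e : R) : set prob :=
  [set nu : prob | forall f, List.In f fs -> `|\int[nu]_x f x - \int[mu]_x f x| <= e].

(** The supersets of basic sets form a filter that converges to [mu] by [weak_cvg]; convergence says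
    precisely that it contains all neighbourhoods of [mu]. *)
Lemma weak_nbhs_basic mu (A : set (weak_prob X)) : nbhs (mu : weak_prob X) A ->
  exists fs e, [/\ 0 < e, forall f, List.In f fs -> continuous f
                 & weak_basic mu fs e `<=` A].
Proof.
pose F : set_system prob := [set A : set prob | exists fs e, [/\ 0 < e,
  forall f, List.In f fs -> continuous f & weak_basic mu fs e `<=` A]].
have FF : Filter F.
  split.
  - by exists [::], 1.
  - move=> P Q [fs [e [e0 cfs sP]]] [gs [d [d0 cgs sQ]]].
    exists (fs ++ gs), (Num.min e d); split.
    + by rewrite lt_min e0.
    + by move=> f ffg; case: (List.in_app_or _ _ _ ffg); [exact: cfs|exact: cgs].
    + move=> nu nuB; split.
        apply: sP => f ffs; apply: le_trans (nuB f _) _.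
          by apply: List.in_or_app; left.
        by rewrite ge_min lexx.
      apply: sQ => f ffs; apply: le_trans (nuB f _) _.
        by apply: List.in_or_app; right.
      by rewrite ge_min lexx orbT.
  - move=> P Q PQ [fs [e [e0 cfs sP]]]; exists fs, e; split=> //.
    exact: subset_trans PQ.
suff : F --> (mu : weak_prob X) by move=> /[apply].
apply: weak_cvg => f cf; apply/cvgrPdist_le => e e0.
exists [:: f], e; split=> //; first by move=> g [<-|].
by move=> nu /(_ f); rewrite distrC; apply; left.
Qed.

Lemma nbhs_weak_basic mu (fs : seq (X -> R)) (e : R) : 0 < e ->
  (forall f, List.In f fs -> continuous f) ->
  nbhs (mu : weak_prob X) (weak_basic mu fs e).
Proof.
move=> e0; elim: fs => [_|f fs IH cfs].
  by apply: filterS (filterT) => nu _ f [].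
have cf : continuous f by apply: cfs; left.
have nf : nbhs (mu : weak_prob X)
    [set nu : prob | `|\int[nu]_x f x - \int[mu]_x f x| <= e].
  pose I (nu : weak_prob X) : {ptws continuousType X R -> R} :=
    (fun g : continuousType X R => (\int[nu]_x (g x))%R).
  have cI : continuous I by exact: initial_continuous.
  have FI : Filter (fmap I (nbhs (mu : weak_prob X))) by apply: fmap_filter; exact: nbhs_filter.
  have := iffLR (@ptws_cvgP _ _ _ _ FI) (cI mu) (mkcts cf).
  move=> /cvgrPdist_le/(_ _ e0) nI.
  have {}nI : nbhs (mu : weak_prob X)
      [set nu : weak_prob X | `|I mu (mkcts cf) - I nu (mkcts cf)| <= e] by exact: nI.
  by apply: filterS nI => nu /=; rewrite distrC.
have nfs : nbhs (mu : weak_prob X) (weak_basic mu fs e).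
  by apply: IH => g gfs; apply: cfs; right.
by apply: (filterS _ (filterI nf nfs)) => nu [h1 h2] g [<-|/h2].
Qed.

End weak_topology.

Section ultralimits.
Context {R : realType}.

Lemma ultrafilter_bounded_cvg (I : Type) (F : set_system I) (u : I -> R) (M : R) :
  UltraFilter F -> (forall i, `|u i| <= M) -> cvg (u @ F).
Proof.
move=> FU uM.
have FF : ProperFilter F by exact: ultra_proper.
have uF : ProperFilter (u @ F) by exact: fmap_proper_filter.
have [l [_ ul]] : `[- M, M]%classic `&` cluster (u @ F) !=set0.
  apply: (@segment_compact R (- M) M (u @ F) uF).
  suff : F [set i | `[- M, M]%classic (u i)] by [].
  by apply: filterE => i; rewrite /= in_itv/= -ler_norml.
apply/cvg_ex; exists l; apply/cvgrPdist_lt => e e0.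
have [//|FC] := in_ultra_setVsetC [set i | `|l - u i| < e] FU.
have uC : (u @ F) [set x | e <= `|l - x|].
  suff : F [set i | e <= `|l - u i|] by [].
  by apply: filterS FC => i /negP; rewrite -leNgt.
have nl : nbhs l [set x | `|l - x| < e] by exact: nbhsx_ballx.
by have [x [/= h1 h2]] := ul _ _ uC nl; move: h1; rewrite leNgt h2.
Qed.

Context {X : pointedMetricType R}.

(** Positivity at [M + f] and [M - f] bounds the values at [f], so along an ultrafilter they
    converge for all continuous [f] at once; positivity and linearity pass to the limit
    functional. *)
Lemma riesz_ultralimit (I : Type) (F : set_system I) (L : I -> (X -> R) -> R) :
  compact [set: X] -> UltraFilter F ->
  (forall i (f : X -> R), continuous f -> (forall x, 0 <= f x) -> 0 <= L i f) ->
  (forall i (f g : X -> R), continuous f -> continuous g ->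
    L i (fun x => f x + g x) = L i f + L i g) ->
  (forall i c (f : X -> R), continuous f -> L i (fun x => c * f x) = c * L i f) ->
  (forall i, L i (fun=> 1) = 1) ->
  exists mu : probability (borel X) R, forall f : X -> R, continuous f ->
    L^~ f @ F --> (\int[mu]_x f x : R).
Proof.
move=> cX FU L0 LD LZ L1.
have FF : ProperFilter F by exact: ultra_proper.
have cc c : continuous (fun _ : X => c : R) by exact: continuous_cstr.
have cvgL (f : X -> R) : continuous f -> cvg (L^~ f @ F).
  move=> cf; have [M fM] := continuous_compact_bounded cX cf.
  apply: (ultrafilter_bounded_cvg FU (M := M)) => i.
  have LM : L i (fun=> M) = M.
    by rewrite -[RHS]mulr1 -(L1 i) -LZ//; congr (L i); apply/funext => x; rewrite mulr1.
  have Lp : L i (fun x => M + f x) = M + L i f by rewrite LD// LM.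
  have Lm : L i (fun x => M + -1 * f x) = M - L i f.
    by rewrite LD ?LM ?LZ ?mulN1r//; apply: continuous_mulr.
  have p0 : 0 <= L i (fun x => M + f x).
    apply: L0; first exact: continuous_addr.
    by move=> x; have := fM x; rewrite ler_norml; lra.
  have m0 : 0 <= L i (fun x => M + -1 * f x).
    apply: L0; first by apply: continuous_addr => //; exact: continuous_mulr.
    by move=> x; have := fM x; rewrite ler_norml; lra.
  by rewrite ler_norml; lra.
pose LL (f : X -> R) : R := lim (L^~ f @ F).
have LLcvg (f : X -> R) : continuous f -> L^~ f @ F --> LL f by move=> /cvgL.
have [||||mu muL] := @riesz_representation _ _ LL cX.
- by move=> f cf f0; apply: limr_ge; [exact: cvgL|apply: filterE => i; exact: L0].
- move=> f g cf cg; apply: cvg_lim => //.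
  rewrite (_ : (fun i => _) = fun i => L i f + L i g); last first.
    by apply/funext => i; rewrite LD.
  by apply: cvgD; exact: LLcvg.
- move=> c f cf; apply: cvg_lim => //.
  rewrite (_ : (fun i => _) = fun i => c * L i f); last first.
    by apply/funext => i; rewrite LZ.
  by apply: cvgMr; exact: LLcvg.
- rewrite /LL (_ : (fun i => _) = fun=> 1); first exact: lim_cst.
  by apply/funext => i; rewrite L1.
- by exists mu => f cf; rewrite muL//; exact: LLcvg.
Qed.

(** [riesz_ultralimit] with the measures themselves as indices, compactness being tested on
    ultrafilters. *)
Lemma weak_prob_compact : compact [set: X] -> compact [set: weak_prob X].
Proof.
move=> cX; rewrite compact_ultra => F FU _.
have bf (f : X -> R) : continuous f -> bounded_measurable (f : borel X -> R).
  exact: continuous_bounded_measurable.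
have [||||mu muF] := @riesz_ultralimit (probability (borel X) R) F
    (fun nu f => \int[nu]_x f x) cX FU.
- by move=> nu f _ f0; exact: Rintegral_ge0.
- by move=> nu f g cf cg; rewrite Rintegral_add//; exact: bf.
- by move=> nu c f cf; rewrite Rintegral_scale//; exact: bf.
- by move=> nu; rewrite Rintegral_const.
- by exists mu; split=> //; apply: weak_cvg.
Qed.

End ultralimits.

(** * Ergodic theorem *)

Section ergodic_sums.
Context {R : realType} d {Y : measurableType d} (P : probability Y R) (phi : Y -> Y).
Hypothesis mphi : measurable_fun setT phi.
Hypothesis Pphi : forall A, measurable A -> P (phi @^-1` A) = P A.

Lemma invariant_Rintegral (f : Y -> R) : bounded_measurable f ->
  \int[P]_x f (phi x) = \int[P]_x f x.
Proof.
move=> bf; have bfp : bounded_measurable (fun x => f (phi x)).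
  exact: bounded_measurable_comp bf.
congr fine.
have mf : measurable_fun setT (EFin \o f) by apply/measurable_EFinP; case: bf.
have := @integral_pushforward _ _ _ _ _ phi mphi P setT (EFin \o f) mf.
rewrite preimage_setT => /(_ (bounded_measurable_integrable P bfp) measurableT) <-.
by apply: eq_measure_integral => A mA _; exact: Pphi.
Qed.

Lemma iter_measurable n : measurable_fun setT (iter n phi).
Proof.
elim: n => [|n IH]; first exact: measurable_id.
exact: measurableT_comp mphi IH.
Qed.

Lemma invariant_iter n A : measurable A -> P (iter n phi @^-1` A) = P A.
Proof.
elim: n A => // n IH A mA; rewrite -[RHS]Pphi// -[RHS]IH//.
by rewrite -[_ @^-1` _]setTI; exact: mphi.
Qed.

Definition birkhoff_sum (f : Y -> R) n x : R := \sum_(i < n) f (iter i phi x).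

Lemma birkhoff_sumS f n x :
  birkhoff_sum f n.+1 x = f x + birkhoff_sum f n (phi x).
Proof.
by rewrite /birkhoff_sum big_ord_recl; congr (_ + _); apply: eq_bigr => i _; rewrite -iterSr.
Qed.

Lemma bounded_measurable_birkhoff f n : bounded_measurable f ->
  bounded_measurable (birkhoff_sum f n).
Proof.
move=> bf; rewrite /birkhoff_sum.
have := @bounded_measurable_sum _ _ _ _ (index_enum 'I_n) (fun i x => f (iter i phi x)).
apply=> i; apply: bounded_measurable_comp bf; exact: iter_measurable.
Qed.

(** The maximum of [birkhoff_sum f j x] over [j <= n], written as the recursion that Garsia's
    argument uses. *)
Fixpoint maximal_sum (f : Y -> R) n x : R :=
  if n is n'.+1 then Num.max 0 (f x + maximal_sum f n' (phi x)) else 0.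

Lemma maximal_sum_ge0 f n x : 0 <= maximal_sum f n x.
Proof. by case: n => //= n; rewrite le_max lexx. Qed.

Lemma maximal_sum_leS f n x : maximal_sum f n x <= maximal_sum f n.+1 x.
Proof.
elim: n x => [|n IH] x; first exact: maximal_sum_ge0.
by rewrite [leLHS]/= [leRHS]/= ge_max le_max lexx/= le_max lerD2l; rewrite IH orbT.
Qed.

Lemma birkhoff_le_maximal f n x : birkhoff_sum f n x <= maximal_sum f n x.
Proof.
elim: n x => [|n IH] x; first by rewrite /birkhoff_sum big_ord0.
by rewrite birkhoff_sumS /= le_max lerD2l IH orbT.
Qed.

Lemma bounded_measurable_maximal f n : bounded_measurable f ->
  bounded_measurable (maximal_sum f n).
Proof.
move=> bf; elim: n => [|n IH]; first exact: bounded_measurable_cst.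
apply: bounded_measurable_maxr; first exact: bounded_measurable_cst.
by apply: bounded_measurableD => //; exact: bounded_measurable_comp IH.
Qed.

(* Garsia: [f >= M - M o phi] where [M := maximal_sum f n > 0]. *)
Lemma maximal_ergodic f n : bounded_measurable f ->
  0 <= \int[P]_x (f x * \1_[set x | 0 < maximal_sum f n x] x).
Proof.
move=> bf; have bM := bounded_measurable_maximal n bf.
have mA : measurable [set x | 0 < maximal_sum f n x].
  by apply: measurable_set_ltr; [exact: measurable_cst|case: bM].
have bMp : bounded_measurable (fun x => maximal_sum f n (phi x)).
  exact: bounded_measurable_comp bM.
apply: (@le_trans _ _ (\int[P]_x (maximal_sum f n x - maximal_sum f n (phi x)))).
  by rewrite Rintegral_sub// invariant_Rintegral// subrr.
apply: Rintegral_le; first exact: bounded_measurableB.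
  by apply: bounded_measurableM => //; exact: bounded_measurable_indic.
move=> x; rewrite indicE; have [M0|M0] := ltP 0 (maximal_sum f n x).
  rewrite mem_set// mulr1; case: n M0 {bM mA bMp} => [|n]; first by rewrite ltxx.
  rewrite lerBlDr => M0; apply: le_trans (_ : f x + maximal_sum f n (phi x) <= _).
    by move: M0 => /=; rewrite lt_max ltxx/= ge_max lexx andbT => /ltW.
  by rewrite lerD2l maximal_sum_leS.
rewrite memNset ?mulr0; last by apply/negP; rewrite -leNgt.
by rewrite subr_le0 (le_trans M0)// maximal_sum_ge0.
Qed.

(** The sets [F n] where the maximal sum vanishes decrease to a null set; including [F N] in the
    integral of [maximal_ergodic] changes it by at most [K] times a small measure. *)
Lemma maximal_ergodic_full f : bounded_measurable f ->
  (forall A, measurable A -> (forall x, A x -> forall n, birkhoff_sum f n x <= 0) ->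
    P A = 0%E) ->
  0 <= \int[P]_x f x.
Proof.
move=> bf Pf; have [K fK] := bf.2.
pose F n := [set x | maximal_sum f n x <= 0].
have mF n : measurable (F n).
  apply: measurable_set_ler; last exact: measurable_cst.
  by case: (bounded_measurable_maximal n bf).
have F0 : P (\bigcap_n F n) = 0%E.
  apply: Pf; first exact: bigcapT_measurable.
  by move=> x Fx n; apply: le_trans (birkhoff_le_maximal _ _ _) _; exact: Fx.
have K0 : 0 <= K by apply: le_trans (fK point); exact: normr_ge0.
apply/ler_addgt0Pr => e e0.
have eK : 0 < e / (K + 1) by rewrite divr_gt0// ltr_wpDl.
have [N /(_ N (leqnn N)) FN] := probability_vanish mF
  (fun n x => le_trans (maximal_sum_leS f n x)) F0 eK.
have mA : measurable [set x | 0 < maximal_sum f N x].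
  apply: measurable_set_ltr; first exact: measurable_cst.
  by case: (bounded_measurable_maximal N bf).
have b1 := bounded_measurableM bf (bounded_measurable_indic (R := R) mA).
have b2 : bounded_measurable (fun x => K * \1_(F N) x).
  apply: bounded_measurableM; first exact: bounded_measurable_cst.
  exact: bounded_measurable_indic.
have := maximal_ergodic N bf; have : \int[P]_x (f x * \1_[set x | 0 < maximal_sum f N x] x) <=
   \int[P]_x (f x + K * \1_(F N) x).
  apply: Rintegral_le => //; first exact: bounded_measurableD.
  move=> x; rewrite !indicE; have [M0|M0] := ltP 0 (maximal_sum f N x).
    by rewrite mem_set// memNset ?mulr0 ?mulr1 ?addr0// /F/= => /(lt_le_trans M0); rewrite ltxx.
  rewrite memNset ?mulr0; last by apply/negP; rewrite -leNgt.
  rewrite mem_set// mulr1; have := fK x; rewrite ler_norml; lra.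
rewrite Rintegral_add// Rintegral_scale ?Rintegral_indic//; last exact: bounded_measurable_indic.
move=> h1 h2; have : K * fine (P (F N)) <= K * (e / (K + 1)) by rewrite ler_wpM2l.
have : K * (e / (K + 1)) <= e.
  by rewrite mulrCA ler_piMr ?(ltW e0)// ler_pdivrMr ?ltr_wpDl// mul1r lerDl.
lra.
Qed.

Hypothesis ergP : forall A, measurable A -> phi @^-1` A = A -> P A = 0%E \/ P A = 1%E.

(** Let [c'] lie strictly between the integral and [c]. The set [I] where the sums of [f - c'] are
    unbounded above is invariant; full measure would give [f - c'] a nonnegative integral by the
    maximal ergodic theorem, so [I] is null. Points that deviate at infinitely many times lie in
    [I], hence late deviations have small measure. *)
Lemma ergodic_deviation f c : bounded_measurable f -> \int[P]_x f x < c ->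
  forall e, 0 < e -> exists N, forall n, (N <= n)%N ->
    fine (P [set x | c * n%:R <= birkhoff_sum f n x]) <= e.
Proof.
move=> bf fc; set c' := (c + \int[P]_x f x) / 2.
have [c1 c2] : \int[P]_x f x < c' /\ c' < c by rewrite /c'; split; lra.
pose g x := f x - c'.
have bg : bounded_measurable g.
  by apply: bounded_measurableB => //; exact: bounded_measurable_cst.
have [K gK] := bg.2.
(* Unboundedness is insensitive to the first term of the sums, so [I] equals its own preimage
   exactly, as the notion of ergodicity in use requires. *)
pose I := [set x | forall m : nat, exists n, m%:R <= birkhoff_sum g n x].
have mI : measurable I.
  have -> : I = \bigcap_m \bigcup_n [set x | m%:R <= birkhoff_sum g n x].
    apply/seteqP; split => x /= Ix m; first by move=> _; have [n mn] := Ix m; exists n.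
    by have [n _ mn] := Ix m Logic.I; exists n.
  apply: bigcapT_measurable => m; apply: bigcupT_measurable => n.
  apply: measurable_set_ler; first exact: measurable_cst.
  by case: (bounded_measurable_birkhoff n bg).
have K0 : 0 <= K by apply: le_trans (gK point); exact: normr_ge0.
have [k Kk] : exists k : nat, K <= k%:R.
  by exists (Num.truncn K).+1; exact/ltW/truncnS_gt.
have invI : phi @^-1` I = I.
  apply/seteqP; split => x /= Ix m.
    have [n mn] := Ix (m + k)%N; exists n.+1; rewrite birkhoff_sumS.
    by have := gK x; rewrite natrD in mn; rewrite ler_norml; lra.
  (* [k] absorbs the dropped term [g x]; the additional [1] excludes the empty sum. *)
  have [[|n] mn] := Ix (m + k).+1.
    by move: mn; rewrite /birkhoff_sum big_ord0 leNgt ltr0n.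
  exists n; rewrite birkhoff_sumS in mn.
  by have := gK x; rewrite -natr1 natrD in mn; rewrite ler_norml; lra.
have PI : P I = 0%E.
  have [//|PI1] := ergP mI invI.
  suff : 0 <= \int[P]_x g x.
    move=> g0; exfalso; move: g0; have bc' : bounded_measurable (fun _ : Y => c') by exact: bounded_measurable_cst.
    by rewrite Rintegral_sub// Rintegral_const; lra.
  apply: maximal_ergodic_full => // A mA Ag.
  have AI : A `<=` ~` I.
    move=> x Ax Ix; have [n] := Ix 1%N; have := Ag x Ax n; lra.
  apply/eqP; rewrite eq_le measure_ge0 andbT.
  have <- : P (~` I) = 0%E by rewrite probability_setC// PI1 subee.
  by apply: le_measure; rewrite ?inE//; exact: measurableC.
move=> e e0; pose D n := [set x | c * n%:R <= birkhoff_sum f n x].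
have mD n : measurable (D n).
  apply: measurable_set_ler; first exact: measurable_cst.
  by case: (bounded_measurable_birkhoff n bf).
pose F n := \bigcup_(j in [set j | (n <= j)%N]) D j.
have mF n : measurable (F n) by apply: bigcup_measurable => j _.
have [||N FN] := @probability_vanish _ _ _ P F mF _ _ _ e0.
- by move=> n x [j /= nj Dj]; exists j => //=; exact: ltnW.
- apply/eqP; rewrite eq_le measure_ge0 andbT -PI.
  apply: le_measure; rewrite ?inE//; first exact: bigcapT_measurable.
  move=> x Fx m.
  pose n0 := (Num.truncn (m%:R / (c - c'))).+1.
  have [j /= nj Dj] := Fx n0 Logic.I; exists j.
  have -> : birkhoff_sum g j x = birkhoff_sum f j x - c' * j%:R.
    by rewrite /birkhoff_sum sumrB sumr_const card_ord mulr_natr.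
  have : m%:R / (c - c') <= j%:R.
    by apply: le_trans (ltW (truncnS_gt _)) _; rewrite ler_nat.
  by rewrite ler_pdivrMr ?subr_gt0// mulrBr; rewrite /D/= in Dj; lra.
- exists N => n Nn; apply: le_trans (FN n Nn).
  by apply: le_fine_probability; [exact: mD|exact: mF|move=> x Dx; exists n => //=].
Qed.

End ergodic_sums.

Lemma fekete {R : realType} (u : nat -> R) : (forall n, 0 <= u n) ->
  (forall m n, u (m + n)%N <= u m + u n) -> cvgn (fun n => n%:R^-1 * u n).
Proof.
move=> u0 uD; pose S := [set n.+1%:R^-1 * u n.+1 | n in [set: nat]].
have Slb : has_lbound S by exists 0 => _ [n _ <-]; rewrite mulr_ge0 ?invr_ge0.
have Sinf : has_inf S by split=> //; exists (1%:R^-1 * u 1%N); exists 0%N.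
have uq m q r : u (q * m + r)%N <= q%:R * u m + u r.
  elim: q => [|q IH]; first by rewrite mul0n mul0r add0r.
  rewrite mulSn -addnA; apply: le_trans (uD _ _) _.
  by rewrite -natr1 mulrDl mul1r [_ + u m]addrC -addrA lerD2l.
apply/cvg_ex; exists (inf S); apply/cvgrPdist_le => e e0.
have e2 : 0 < e / 2 by rewrite divr_gt0.
have [_ [m _ <-] mS] := inf_adherent e2 Sinf.
pose B := \sum_(r < m.+1) u r.
have uB r : (r < m.+1)%N -> u r <= B.
  by move=> rm; rewrite /B (bigD1 (Ordinal rm))//= lerDl sumr_ge0.
exists (Num.truncn (B / (e / 2))).+1 => // n /= nN.
have n0 : (0 < n)%N by apply: leq_ltn_trans nN.
have n0r : 0 < n%:R :> R by rewrite ltr0n.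
have Bn : B / n%:R <= e / 2.
  rewrite ler_pdivrMr// mulrC -ler_pdivrMr//.
  by apply: le_trans (ltW (truncnS_gt _)) _; rewrite ler_nat.
have infn : inf S <= n%:R^-1 * u n by apply: ge_inf => //; exists n.-1; rewrite ?prednK.
have un : n%:R^-1 * u n <= m.+1%:R^-1 * u m.+1 + B / n%:R.
  rewrite mulrC ler_pdivrMr// mulrDl divfK ?gt_eqF//.
  rewrite {1}(divn_eq n m.+1); apply: le_trans (uq _ _ _) _.
  apply: lerD; last by apply: uB; rewrite ltn_mod.
  rewrite mulrC -mulrA mulrCA ler_wpM2l// ler_pdivlMl//.
  by rewrite -natrM ler_nat mulnC leq_divM.
have {}un := le_trans un (lerD (ltW mS) Bn).
by rewrite ler_norml; apply/andP; move: (inf S) (n%:R^-1 * u n) infn un => a b ab ba; split; lra.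
Qed.

(** * Names and partition entropy *)

Section distributions.
Context {R : realType} d {Y : measurableType d} (P : probability Y R).

Definition distr (W : finType) (N : Y -> W) (w : W) : R :=
  fine (P (N @^-1` [set w])).

Definition measurable_fibers (W : finType) (N : Y -> W) :=
  forall w, measurable (N @^-1` [set w]).

Lemma measurable_preim (W : finType) (N : Y -> W) (B : pred W) :
  measurable_fibers N -> measurable [set x | B (N x)].
Proof.
move=> mN; rewrite (_ : mkset _ = \bigcup_(w in [set w | B w]) (N @^-1` [set w])).
  apply: fin_bigcup_measurable; first exact: finite_finset.
  by move=> w _; exact: mN.
by apply/seteqP; split=> x /= => [Bx|[w Bw ->//]]; exists (N x).
Qed.

Lemma distr_ge0 (W : finType) (N : Y -> W) w : 0 <= distr N w.
Proof. exact: fine_ge0. Qed.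

(** Transfers the inequalities for finite probability spaces to names: the set of names with its
    distribution is the finite space. *)
Lemma law_distr (W W' : finType) (N : Y -> W) (f : W -> W') :
  measurable_fibers N -> law (distr N) f = distr (f \o N).
Proof.
move=> mN; apply/funext => u.
have mfN : measurable ((f \o N) @^-1` [set u]).
  have := measurable_preim (fun w => f w == u) mN; congr measurable.
  by apply/seteqP; split => x /= /eqP.
rewrite /distr -Rintegral_indic//.
have -> : \int[P]_x \1_((f \o N) @^-1` [set u]) x =
    \int[P]_x (\sum_(w | f w == u) \1_(N @^-1` [set w]) x : R).
  apply: eq_Rintegral => x _; rewrite indicE.
  have [fNx|fNx] := eqVneq (f (N x)) u.
    rewrite mem_set// (bigD1 (N x)) ?fNx//= big1 ?addr0 ?indicE ?mem_set// => w.
    by move=> /andP[_ wN]; rewrite indicE memNset//= => Nw; rewrite Nw eqxx in wN.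
  rewrite memNset; last by move=> /= /eqP; apply/negP.
  rewrite big1// => w fw; rewrite indicE memNset//= => Nw.
  by move: fNx; rewrite Nw fw.
rewrite /law; under [in RHS]eq_Rintegral do rewrite -big_filter.
rewrite Rintegral_sum; last first.
  by move=> w; apply: bounded_measurable_indic; exact: mN.
rewrite big_filter; apply: eq_bigr => w _; rewrite Rintegral_indic//; exact: mN.
Qed.

Lemma sum_distr (W : finType) (N : Y -> W) : measurable_fibers N ->
  \sum_w distr N w = 1.
Proof.
move=> mN; have := congr1 (fun f => f tt) (law_distr (fun=> tt) mN).
rewrite /law /distr/= (_ : _ @^-1` _ = setT); last by apply/seteqP; split.
by rewrite probability_setT/=.
Qed.

End distributions.

Section names.
Context {R : realType} {X : pointedMetricType R} (T : X -> X).
Local Notation prob := (probability (borel X) R).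
Implicit Types mu : prob.
Hypothesis mT : measurable_fun [set: borel X] (T : borel X -> borel X).

Section partition.
Context k (A : 'I_k -> set (borel X)).
Hypothesis Apart : mpartition A.

Lemma partition_label : exists lab : X -> 'I_k, forall x i, A i x <-> lab x = i.
Proof.
have [mA tA uA] := Apart.
have /choice[lab labP] : forall x, exists i, A i x.
  by move=> x; have : setT x by []; rewrite -uA => -[i _ Aix]; exists i.
exists lab => x i; split=> [Aix|<-//]; apply: contrapT => li.
have : (A (lab x) `&` A i) x by [].
by have /trivIsetP/(_ (lab x) i Logic.I Logic.I) := tA; move=> -> //; exact/eqP.
Qed.

Definition label : X -> 'I_k := projT1 (cid partition_label).

Lemma labelP x i : A i x <-> label x = i.
Proof. by rewrite /label; case: cid. Qed.

Definition name n (x : borel X) : {ffun 'I_n -> 'I_k} :=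
  [ffun i : 'I_n => label (iter i T x)].

Lemma join_atomE n (w : {ffun 'I_n -> 'I_k}) :
  join_atom T A w = name n @^-1` [set w].
Proof.
apply/seteqP; split => x /=.
  by move=> Awx; apply/ffunP => i; rewrite ffunE; apply/labelP; exact: Awx.
by move=> <- i _; rewrite /= ffunE; exact/labelP.
Qed.

Lemma measurable_name n : measurable_fibers (name n).
Proof.
move=> w; rewrite -join_atomE; apply: fin_bigcap_measurable.
  exact: finite_finset.
move=> i _; rewrite -[X in measurable X]setTI.
apply: iter_measurable => //; by have [mA _ _] := Apart.
Qed.

Lemma join_entropyE mu n : join_entropy T mu A n = shannon (distr mu (name n)).
Proof.
by congr (- _); apply: eq_bigr => w _; rewrite /distr -join_atomE.
Qed.

Lemma shannon_ge0 (W : finType) (p : W -> R) : (forall w, 0 <= p w <= 1) ->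
  0 <= shannon p.
Proof.
move=> p01; rewrite /shannon oppr_ge0 sumr_le0// => w _.
by have /andP[p0 p1] := p01 w; rewrite mulr_ge0_le0// ln_le0.
Qed.

Lemma join_entropy_ge0 mu n : 0 <= join_entropy T mu A n.
Proof.
rewrite join_entropyE; apply: shannon_ge0 => w.
by rewrite distr_ge0 fine_probability_le1//; exact: measurable_name.
Qed.

(** A name of length [m + n] is one of length [m] followed by the [n]-name of the [m]-th iterate,
    and invariance gives the latter the distribution of [name n]. *)
Lemma join_entropy_subadd mu : invariant_measures T mu ->
  forall m n, join_entropy T mu A (m + n) <= join_entropy T mu A m + join_entropy T mu A n.
Proof.
move=> muT m n; rewrite !join_entropyE.
pose f (w : {ffun 'I_(m + n) -> 'I_k}) := [ffun i : 'I_m => w (lshift n i)].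
pose g (w : {ffun 'I_(m + n) -> 'I_k}) := [ffun i : 'I_n => w (rshift m i)].
have mN := @measurable_name (m + n).
have -> : distr mu (name m) = law (distr mu (name (m + n))) f.
  rewrite law_distr//; congr distr; apply/funext => x /=.
  by apply/ffunP => i; rewrite !ffunE.
have -> : distr mu (name n) = law (distr mu (name (m + n))) g.
  rewrite law_distr//; apply/funext => w; congr fine.
  have -> : (g \o name (m + n)) @^-1` [set w] =
      (iter m T : borel X -> borel X) @^-1` (name n @^-1` [set w]).
    apply/seteqP; split => x /= <-; apply/ffunP => i; rewrite !ffunE /=.
      by rewrite addnC iterD.
    by rewrite addnC iterD.
  by apply/esym/(invariant_iter mT muT); exact: measurable_name.
rewrite -[X in shannon X](law_id (distr mu (name (m + n)))).
apply: shannon_lawD; [by move=> w; exact: distr_ge0|exact: sum_distr|].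
move=> w w' /ffunP ff /ffunP gg; apply/ffunP => i; case: (split_ordP i) => j ->.
  by have := ff j; rewrite !ffunE.
by have := gg j; rewrite !ffunE.
Qed.

Lemma cvg_partition_entropy mu : invariant_measures T mu ->
  n%:R^-1 * join_entropy T mu A n @[n --> \oo] --> partition_entropy T mu A.
Proof.
move=> muT; apply: fekete; first exact: join_entropy_ge0.
exact: join_entropy_subadd.
Qed.

End partition.
End names.

(** * Uniform continuity and approximation of measurable sets *)

Section uniform_continuity.
Context {R : realType} {X : pointedMetricType R}.

Lemma compact_uniform_continuous (f : X -> R) (e : R) : compact [set: X] ->
  continuous f -> 0 < e ->
  exists2 r, 0 < r & forall x y, mdist x y < r -> `|f x - f y| < e.
Proof.
move=> cX cf e0; have e2 : 0 < e / 2 by rewrite divr_gt0.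
have /choice[r rP] : forall p, exists r, 0 < r /\
    forall x, mdist p x < r -> `|f p - f x| < e / 2.
  move=> p; have /cvgrPdist_lt/(_ _ e2)/nbhs_ballP[r /= r0 rf] := cf p.
  by exists r; split=> // x; move: (rf x); rewrite ballEmdist.
have r0 p : 0 < r p by have [] := rP p.
have r2 p : 0 < r p / 2 by rewrite divr_gt0.
have [s sP] := @compact_nbhs_cover X (fun p => ball p (r p / 2)) cX
  (fun p => nbhsx_ballx p _ (r2 p)).
have [d [d0 dr]] : exists d, 0 < d /\ forall p, p \in s -> d <= r p / 2.
  elim: s {sP} => [|p s [d [d0 dr]]]; first by exists 1.
  exists (Num.min d (r p / 2)); split; first by rewrite lt_min d0 divr_gt0.
  move=> q; rewrite inE => /predU1P[->|/dr]; rewrite ge_min ?lexx ?orbT//.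
  by move=> ->.
exists d => // x y xy; have [p ps] := sP x; rewrite ballEmdist/= => px.
have [_ rf] := rP p.
have fx : `|f p - f x| < e / 2 by apply: rf; have := r0 p; lra.
have fy : `|f p - f y| < e / 2.
  apply: rf; apply: le_lt_trans (metric_triangle p x y) _.
  by have := dr p ps; lra.
by move: fx fy; rewrite !ltr_norml; lra.
Qed.

End uniform_continuity.

Section continuous_approximation.
Context {R : realType} {X : pointedMetricType R}.
Hypothesis cX : compact [set: X].
Variable mu : probability (borel X) R.

Let cbm (f : X -> R) : continuous f -> bounded_measurable (f : borel X -> R).
Proof. exact: continuous_bounded_measurable. Qed.

Let bnorm (f : borel X -> R) : bounded_measurable f -> bounded_measurable (fun x => `|f x|).
Proof.
move=> [mf [M fM]]; split; first exact: measurableT_comp mf.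
by exists M => x; rewrite normr_id.
Qed.

Definition approximable (A : set (borel X)) := forall e : R, 0 < e ->
  exists f : X -> R, [/\ continuous f, forall x, 0 <= f x <= 1 &
    \int[mu]_x `|f x - \1_A x| <= e].

Let bm_diff (f : X -> R) (A : set (borel X)) : continuous f -> measurable A ->
  bounded_measurable (fun x : borel X => `|f x - \1_A x|).
Proof.
move=> cf mA; apply: bnorm; apply: bounded_measurableB; first exact: cbm.
exact: bounded_measurable_indic.
Qed.

Lemma approximable_open (U : set X) : open U -> approximable U.
Proof.
move=> oU e e0; have [phi [cphi phi01 phiU]] := open_cozero oU.
pose F n : set (borel X) := U `&` [set x | n.+1%:R * phi x < 1].
have mU := open_borel oU.
have mF n : measurable (F n).
  apply: measurableI => //; apply: open_borel; apply: open_ltr.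
    by apply: continuous_mulr => //; exact: continuous_cstr.
  exact: continuous_cstr.
have [||N /(_ N (leqnn N)) FN] := @probability_vanish _ _ _ mu F mF _ _ _ e0.
- move=> n x [Ux /= xn]; split=> //=; apply: le_lt_trans xn.
  by rewrite ler_wpM2r ?ler_nat//; have /andP[] := phi01 x.
- rewrite (_ : \bigcap_n F n = set0) ?measure0//; apply/seteqP; split => // x Fx.
  have [/phiU px _] := Fx 0%N Logic.I.
  have [_ /=] := Fx (Num.truncn (phi x)^-1) Logic.I.
  rewrite -ltr_pdivlMr// mul1r; apply/negP; rewrite -leNgt; exact/ltW/truncnS_gt.
have cf : continuous (fun x => Num.min 1 (N.+1%:R * phi x)).
  apply: continuous_minr; first exact: continuous_cstr.
  by apply: continuous_mulr => //; exact: continuous_cstr.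
exists (fun x => Num.min 1 (N.+1%:R * phi x)); split => //.
  move=> x; rewrite le_min ler01 ge_min lexx/= andbT mulr_ge0//.
  by have /andP[] := phi01 x.
apply: le_trans FN; rewrite -Rintegral_indic//; apply: Rintegral_le.
- exact: bm_diff.
- exact: bounded_measurable_indic.
move=> x; have /andP[p0 p1] := phi01 x.
have [Ux|nUx] := pselect (U x).
  rewrite [X in _ - X]indicE mem_set// mulr1n.
  have [x1|x1] := ltP (N.+1%:R * phi x) 1.
    have N0 : 0 <= N.+1%:R * phi x by rewrite mulr_ge0.
    by rewrite indicE mem_set// mulr1n ler_norml; lra.
  by rewrite subrr normr0 indicE.
rewrite [X in _ - X]indicE memNset//.
have -> : phi x = 0.
  by apply/eqP; rewrite eq_le p0 andbT leNgt; apply/negP => /phiU.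
by rewrite mulr0 (min_idPr _)// subrr normr0 indicE.
Qed.

Lemma approximable_setC (A : set (borel X)) : approximable A -> approximable (~` A).
Proof.
move=> aA e /aA[f [cf f01 fA]]; exists (fun x => 1 - f x); split.
- by apply: continuous_subr => //; exact: continuous_cstr.
- by move=> x; have := f01 x; lra.
- rewrite (_ : \int[mu]_x _ = \int[mu]_x `|f x - \1_A x|)//.
  apply: eq_Rintegral => x _; rewrite !indicE in_setC.
  by case: (_ \in _) => /=; rewrite -[in RHS]normrN; congr (`|_|); lra.
Qed.

Lemma approximable_setU (A B : set (borel X)) : measurable A -> measurable B ->
  approximable A -> approximable B -> approximable (A `|` B).
Proof.
move=> mA mB aA aB e e0; have e2 : 0 < e / 2 by rewrite divr_gt0.
have [f [cf f01 fA]] := aA _ e2; have [g [cg g01 gB]] := aB _ e2.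
(* This is [1 - (1 - f) (1 - g)]: it stays in the unit interval, and the errors for [A] and [B] add
   up. *)
have ch : continuous (fun x => f x + g x - f x * g x).
  apply: continuous_subr; [exact: continuous_addr|exact: continuous_mulr].
exists (fun x => f x + g x - f x * g x); split=> //.
  move=> x; have /andP[f0 f1] := f01 x; have /andP[g0 g1] := g01 x.
  have h1 : 0 <= (1 - f x) * (1 - g x) by rewrite mulr_ge0 ?subr_ge0.
  have h2 : 0 <= f x * (1 - g x) by rewrite mulr_ge0 ?subr_ge0.
  by move: h1 h2; rewrite !mulrBr !mulrBl !mulr1 !mul1r; lra.
have mfA := bm_diff cf mA; have mgB := bm_diff cg mB.
apply: (@le_trans _ _ (\int[mu]_x (`|f x - \1_A x| + `|g x - \1_B x|))).
  apply: Rintegral_le.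
  - by apply: bm_diff => //; exact: measurableU.
  - exact: bounded_measurableD.
  move=> x; have /andP[f0 f1] := f01 x; have /andP[g0 g1] := g01 x.
  have h1 : 0 <= (1 - f x) * (1 - g x) by rewrite mulr_ge0 ?subr_ge0.
  have h2 : 0 <= f x * (1 - g x) by rewrite mulr_ge0 ?subr_ge0.
  have h3 : 0 <= (1 - f x) * g x by rewrite mulr_ge0 ?subr_ge0.
  have h4 : 0 <= f x * g x by rewrite mulr_ge0.
  move: h1 h2 h3 h4; rewrite !mulrBr !mulrBl !mulr1 !mul1r.
  rewrite !indicE in_setU; set p := f x * g x => h1 h2 h3 h4.
  case: (x \in A); case: (x \in B); rewrite /= ?mulr1n ?mulr0n;
    rewrite ler_norml; case: ger0P => ?; case: ger0P => ?; lra.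
by rewrite Rintegral_add//; lra.
Qed.

Lemma approximable_bigcup (A : nat -> set (borel X)) :
  (forall n, measurable (A n)) -> (forall n, approximable (A n)) ->
  approximable (\bigcup_n A n).
Proof.
move=> mA aA e e0; have e2 : 0 < e / 2 by rewrite divr_gt0.
have mU : measurable (\bigcup_n A n) by exact: bigcupT_measurable.
pose B n := \big[setU/set0]_(i < n) A i.
have mB n : measurable (B n) by apply: bigsetU_measurable.
have aB n : approximable (B n).
  rewrite /B; elim: n => [|n IH].
    by rewrite big_ord0; apply: approximable_open; exact: open0.
  by rewrite big_ord_recr/=; apply: approximable_setU => //; exact: bigsetU_measurable.
pose F n := \bigcup_n A n `\` B n.
have mF n : measurable (F n) by exact: measurableD.
have [||N /(_ N (leqnn N)) FN] := @probability_vanish _ _ _ mu F mF _ _ _ e2.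
- by move=> n; apply: setDS; rewrite /B big_ord_recr/=; exact: subsetUl.
- rewrite (_ : \bigcap_n F n = set0) ?measure0//; apply/seteqP; split => // x Fx.
  have [[n _ An] _] := Fx 0%N Logic.I; have [_] := Fx n.+1 Logic.I; apply.
  by rewrite /B big_ord_recr/=; right.
have [f [cf f01 fB]] := aB N _ e2; exists f; split=> //.
have mfB := bm_diff cf (mB N).
apply: (@le_trans _ _ (\int[mu]_x (`|f x - \1_(B N) x| + \1_(F N) x))).
  apply: Rintegral_le; first exact: bm_diff.
    by apply: bounded_measurableD => //; exact: bounded_measurable_indic.
  move=> x; apply: le_trans (ler_distD (\1_(B N) x) _ _) _; rewrite lerD2l.
  rewrite !indicE; have [Bx|nBx] := pselect (B N x).
    have Ax : (\bigcup_n A n) x.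
      by move: Bx; rewrite /B -bigcup_mkord => -[i _ Aix]; exists i.
    by rewrite (mem_set Bx) (mem_set Ax) subrr normr0.
  rewrite (memNset nBx); have [Ax|nAx] := pselect ((\bigcup_n A n) x).
    by rewrite (mem_set Ax) (mem_set (conj Ax nBx : F N x)) sub0r normrN normr1.
  by rewrite (memNset nAx) subrr normr0.
rewrite Rintegral_add//; last exact: bounded_measurable_indic.
by rewrite Rintegral_indic//; lra.
Qed.

(** The measurable sets whose indicator is an integral-norm limit of continuous functions form a
    sigma-algebra containing the open sets. *)
Lemma measurable_approximable (A : set (borel X)) : measurable A -> approximable A.
Proof.
pose G := [set A : set (borel X) | measurable A /\ approximable A].
move=> mA; suff : G A by case.
apply: (@smallest_sub _ (sigma_algebra setT) open G _ _ A mA).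
  split.
  - by split=> //; apply: approximable_open; exact: open0.
  - move=> B [mB aB]; rewrite setTD; split; first exact: measurableC.
    exact: approximable_setC.
  - move=> B GB; split.
      by apply: bigcupT_measurable => n; have [] := GB n.
    by apply: approximable_bigcup => n; have [] := GB n.
by move=> U oU; split; [exact: open_borel|exact: approximable_open].
Qed.

End continuous_approximation.

(** Gibbs against weights [(2 #|S|)^-1] on [S] and [(2 #|W|)^-1] elsewhere. Half of the mass is
    reserved for each, hence the [ln 2], and only the part of [p] outside [S] pays for the size of
    [W]. *)
Lemma shannon_le_split {R : realType} (W : finType) (p : W -> R) (S : {set W}) :
  (forall w, 0 <= p w) -> \sum_w p w = 1 -> (0 < #|S|)%N ->
  shannon p <= ln 2 + ln #|S|%:R + (\sum_(w in ~: S) p w) * ln #|W|%:R.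
Proof.
move=> p0 p1 S0.
have W0 : (0 < #|W|)%N by apply: leq_trans S0 _; exact: max_card.
pose q w : R := if w \in S then (2 * #|S|%:R)^-1 else (2 * #|W|%:R)^-1.
have q0 w : 0 < q w by rewrite /q; case: ifP => _; rewrite invr_gt0 mulr_gt0// ltr0n.
have W0r : 0 < #|W|%:R :> R by rewrite ltr0n.
have S0r : 0 < #|S|%:R :> R by rewrite ltr0n.
apply: le_trans (gibbs (q := q) _ _ _ _) _ => //.
- by move=> w; exact: ltW.
- rewrite p1 (bigID (fun w => w \in S))/=.
  have -> : \sum_(w in S) q w = 1 / 2.
    rewrite (eq_bigr (fun=> (2 * #|S|%:R)^-1)); last by move=> w wS; rewrite /q wS.
    rewrite sumr_const -[_ *+ _]mulr_natr invfM -mulrA mulVf ?gt_eqF//.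
    by rewrite mulr1 mul1r.
  have : \sum_(w | w \notin S) q w <= \sum_(w : W) (2 * #|W|%:R)^-1.
    rewrite [leRHS](bigID (fun w => w \in S))/= ler_wpDl//.
      by apply: sumr_ge0 => w _; rewrite invr_ge0 mulr_ge0.
    by apply: ler_sum => w wS; rewrite /q (negbTE wS).
  rewrite sumr_const -[_ *+ _]mulr_natr invfM -mulrA mulVf ?gt_eqF//; lra.
- rewrite (bigID (fun w => w \in S))/=.
  rewrite (eq_bigr (fun w => p w * - (ln 2 + ln #|S|%:R))); last first.
    by move=> w wS; rewrite /q wS lnV ?posrE ?mulr_gt0// lnM ?posrE.
  rewrite [X in - (_ + X)](eq_bigr (fun w => p w * - (ln 2 + ln #|W|%:R))); last first.
    by move=> w wS; rewrite /q (negbTE wS) lnV ?posrE ?mulr_gt0// lnM ?posrE.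
  rewrite -!mulr_suml (eq_bigl (fun w => w \notin S)); last by move=> w; rewrite inE.
  have p1' : \sum_(w in S) p w = 1 - \sum_(w | w \notin S) p w.
    by rewrite -p1 [in RHS](bigID (fun w => w \in S))/= addrK.
  have lnS : 0 <= ln #|S|%:R :> R by rewrite ln_ge0// ler1n.
  have pS0 : 0 <= \sum_(w | w \notin S) p w by exact: sumr_ge0.
  have := mulr_ge0 pS0 lnS.
  rewrite p1'; move: (\sum_(w | _) _) => s; rewrite !mulrN !mulrDr !mulrBl !mul1r; lra.
Qed.

(** * Lower bound *)

Section hamming.
Context {R : realType} {k n : nat}.
Implicit Types v w : {ffun 'I_n -> 'I_k}.

Definition hamming v w := (\sum_(i < n) (v i != w i))%N.

(** Chernoff's trick: on the ball [t ^+ a <= t ^+ hamming v w], and the sum of the right-hand side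
    over all [w] factors over the coordinates. The parameter [t] is optimised by the user. *)
Lemma hamming_ball_card v (t : R) (a : nat) : 0 < t -> t <= 1 ->
  #|[set w | (hamming v w <= a)%N]%SET|%:R * t ^+ a <= (1 + k%:R * t) ^+ n.
Proof.
move=> t0 t1.
apply: (@le_trans _ _ (\sum_w t ^+ hamming v w)).
  rewrite mulrC mulr_natr -sumr_const big_mkcond/=; apply: ler_sum => w _.
  case: ifP => [|_]; last by rewrite exprn_ge0// ltW.
  by rewrite inE => wa; rewrite ler_wiXn2l// ltW.
under eq_bigr do rewrite /hamming expr_sum.
rewrite -(bigA_distr_bigA (fun i c => t ^+ (v i != c))).
apply: (@le_trans _ _ (\prod_(i < n) (1 + k%:R * t))); last first.
  by rewrite prodr_const card_ord.
apply: ler_prod => i _; apply/andP; split.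
  by apply: sumr_ge0 => c _; rewrite exprn_ge0// ltW.
rewrite (bigD1 (v i))//= eqxx expr0 lerD2l.
apply: (@le_trans _ _ (\sum_(c : 'I_k) t)); last first.
  by rewrite sumr_const card_ord mulr_natl.
rewrite [leRHS](bigD1 (v i))//= ler_wpDl ?(ltW t0)//; apply: ler_sum => c ci.
by rewrite eq_sym ci.
Qed.

End hamming.

Section empirical_measures.
Context {R : realType} {X : pointedMetricType R} (T : X -> X).

Local Notation Tb := (T : borel X -> borel X).

Let ge0_empirical_integral n (x : X) (f : borel X -> R) : (0 < n)%N ->
  bounded_measurable f -> (forall y, 0 <= f y) ->
  \int[empirical T n x]_y f y = n%:R^-1 * birkhoff_sum Tb f n x.
Proof.
move=> n0 bf f0.
have mf : measurable_fun setT (EFin \o f) by apply/measurable_EFinP; case: bf.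
have n0r : 0 <= n%:R^-1 :> R by rewrite invr_ge0.
pose r : {nonneg R} := NngNum n0r.
pose m := mscale r (msum (fun i => \d_(iter i Tb x)) n) : {measure set (borel X) -> \bar R}.
rewrite /Rintegral (eq_measure_integral m); last first.
  move=> A mA _; apply: etrans (empiricalE _ _ _ n0) _.
  by rewrite /m /mscale /msum.
rewrite ge0_integral_mscale//; last by move=> y _; rewrite lee_fin.
rewrite ge0_integral_measure_sum//; last by move=> y _; rewrite lee_fin.
rewrite (eq_bigr (fun i : 'I_n => (f (iter i T x))%:E)); last first.
  by move=> i _; rewrite integral_dirac// diracT mul1e.
by rewrite sumEFin.
Qed.

Lemma empirical_integral n (x : X) (f : borel X -> R) : (0 < n)%N ->
  bounded_measurable f ->
  \int[empirical T n x]_y f y = n%:R^-1 * birkhoff_sum Tb f n x.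
Proof.
move=> n0 bf; have [mf [M fM]] := bf.
have bM : bounded_measurable (fun _ : borel X => M) by exact: bounded_measurable_cst.
have := ge0_empirical_integral x n0 (bounded_measurableD bf bM).
rewrite Rintegral_add// Rintegral_const => H.
have : \int[empirical T n x]_y f y + M = n%:R^-1 * birkhoff_sum Tb f n x + M.
  rewrite {}H; last by move=> y; have := fM y; rewrite ler_norml; lra.
  rewrite /birkhoff_sum big_split/= sumr_const card_ord mulrDr; congr (_ + _).
  by rewrite -[M *+ n]mulr_natl mulrA mulVf ?mul1r// pnatr_eq0 -lt0n.
exact: addIr.
Qed.

End empirical_measures.

Lemma birkhoff_bad_set {R : realType} d {Y : measurableType d} (P : probability Y R)
    (phi : Y -> Y) : measurable_fun setT phi ->
  (forall A, measurable A -> P (phi @^-1` A) = P A) ->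
  (forall A, measurable A -> phi @^-1` A = A -> P A = 0%E \/ P A = 1%E) ->
  forall (fs : seq (Y -> R)) (t e : R), 0 < t -> 0 < e ->
  (forall f, List.In f fs -> bounded_measurable f) ->
  exists N, forall n, (N <= n)%N -> exists B : set Y, [/\ measurable B,
    fine (P B) <= e & forall x, ~ B x -> forall f, List.In f fs ->
      `|birkhoff_sum phi f n x - n%:R * \int[P]_x f x| <= t * n%:R].
Proof.
move=> mphi Pphi Perg fs t e t0; elim: fs e => [|f fs IH] e e0 bfs.
  by exists 0%N => n _; exists set0; split=> //; rewrite measure0 ltW.
(* One third for the remaining functions and one for each of the one-sided deviations of [f] and
   [-f]. *)
have e3 : 0 < e / 3 by rewrite divr_gt0.
have bf : bounded_measurable f by apply: bfs; left.
have bNf : bounded_measurable (fun x => -1 * f x).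
  by apply: bounded_measurableM => //; exact: bounded_measurable_cst.
have [|N1 HN1] := IH _ e3; first by move=> g gfs; apply: bfs; right.
have f1 : \int[P]_x f x < \int[P]_x f x + t by rewrite ltrDl.
have [N2 HN2] := ergodic_deviation mphi Pphi Perg bf f1 e3.
have f2 : \int[P]_x (-1 * f x) < - (\int[P]_x f x) + t.
  by rewrite Rintegral_scale// mulN1r ltrDl.
have [N3 HN3] := ergodic_deviation mphi Pphi Perg bNf f2 e3.
exists (maxn N1 (maxn N2 N3)) => n; rewrite !geq_max => /and3P[n1 n2 n3].
have [B [mB PB BP]] := HN1 n n1.
have mS (g : Y -> R) c : bounded_measurable g ->
    measurable [set x | c * n%:R <= birkhoff_sum phi g n x].
  move=> bg; apply: measurable_set_ler; first exact: measurable_cst.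
  by have [] := bounded_measurable_birkhoff mphi n bg.
have m1 := mS _ (\int[P]_x f x + t) bf.
have m2 := mS _ (- (\int[P]_x f x) + t) bNf.
exists (B `|` ([set x | (\int[P]_x f x + t) * n%:R <= birkhoff_sum phi f n x] `|`
  [set x | (- (\int[P]_x f x) + t) * n%:R <= birkhoff_sum phi (fun x => -1 * f x) n x])).
have m12 := measurableU _ _ m1 m2.
split; first exact: measurableU.
  apply: le_trans (fine_probability_setU P mB m12) _.
  have := fine_probability_setU P m1 m2; have := HN2 n n2; have := HN3 n n3.
  lra.
move=> x /not_orP[nB /not_orP[/= /negP h1 /negP h2]] g [<-|gfs]; last exact: BP.
move: h1 h2; rewrite -!ltNge.
have -> : birkhoff_sum phi (fun x => -1 * f x) n x = - birkhoff_sum phi f n x.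
  by rewrite /birkhoff_sum -sumrN; apply: eq_bigr => i _; rewrite mulN1r.
by rewrite !mulrDl mulNr ler_norml [n%:R * _]mulrC; lra.
Qed.

Section label_approximation.
Context {R : realType} {X : pointedMetricType R}.
Hypothesis cX : compact [set: X].

(** Labels are read as real numbers: off [Z], two points at which [f] differs by less than [1 / 2]
    have labels at distance less than [1], hence equal. *)
Lemma label_approx (mu : probability (borel X) R) k (A : 'I_k -> set (borel X))
    (Apart : mpartition A) (e : R) : 0 < e ->
  exists f : X -> R, continuous f /\
    let Z := [set x : borel X | 1 / 4 < `|f x - (label Apart x)%:R|] in
    measurable Z /\ fine (mu Z) <= e.
Proof.
move=> e0; have [mA _ _] := Apart.
(* The [4] comes from Markov's inequality at level [1 / 4], the sum from the weights of the
   indicators; [+ 1] keeps [K] positive when the only label is [0]. *)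
pose K : R := 4 * \sum_(i < k) i%:R + 1.
have K0 : 0 < K by rewrite ltr_wpDl// mulr_ge0// sumr_ge0.
have eK : 0 < e / K by rewrite divr_gt0.
have /choice[f fP] : forall i, exists f : X -> R, [/\ continuous f,
    forall x, 0 <= f x <= 1 & \int[mu]_x `|f x - \1_(A i) x| <= e / K].
  by move=> i; exact: (measurable_approximable cX mu (mA i)).
have cf i : continuous (f i) by have [] := fP i.
pose F x := \sum_(i < k) i%:R * f i x.
have cF : continuous F.
  by apply: continuous_sumr => i; apply: continuous_mulr => //; exact: continuous_cstr.
have labE (x : borel X) : (label Apart x)%:R = \sum_(i < k) i%:R * \1_(A i) x :> R.
  rewrite (bigD1 (label Apart x))//= indicE mem_set ?mulr1 ?big1 ?addr0//.
    move=> i il; rewrite indicE memNset ?mulr0// => /(labelP Apart) li.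
    by rewrite li eqxx in il.
  exact/(labelP Apart).
have bI i : bounded_measurable (\1_(A i) : borel X -> R).
  exact: bounded_measurable_indic.
have bl : bounded_measurable (fun x : borel X => (label Apart x)%:R : R).
  rewrite (_ : (fun _ => _) = fun x => \sum_(i < k) i%:R * \1_(A i) x).
    apply: bounded_measurable_sum => i; apply: bounded_measurableM => //.
    exact: bounded_measurable_cst.
  by apply/funext => x; exact: labE.
have bnorm (g : borel X -> R) : bounded_measurable g -> bounded_measurable (fun x => `|g x|).
  move=> [mg [M gM]]; split; first exact: measurableT_comp mg.
  by exists M => x; rewrite normr_id.
have bF : bounded_measurable (F : borel X -> R) by exact: continuous_bounded_measurable.
have bd : bounded_measurable (fun x : borel X => `|F x - (label Apart x)%:R|).
  by apply: bnorm; exact: bounded_measurableB.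
have bdi i : bounded_measurable (fun x : borel X => `|f i x - \1_(A i) x|).
  apply: bnorm; apply: bounded_measurableB => //.
  exact: continuous_bounded_measurable.
have bci (i : 'I_k) : bounded_measurable (fun x : borel X => i%:R * `|f i x - \1_(A i) x|).
  by apply: bounded_measurableM => //; exact: bounded_measurable_cst.
have mZ : measurable [set x : borel X | 1 / 4 < `|F x - (label Apart x)%:R|].
  by apply: measurable_set_ltr; [exact: measurable_cst|case: bd].
exists F; split=> //=; split=> //; rewrite -Rintegral_indic//.
apply: (@le_trans _ _ (\int[mu]_x (4 * `|F x - (label Apart x)%:R|))).
  apply: Rintegral_le; first exact: bounded_measurable_indic.
    by apply: bounded_measurableM => //; exact: bounded_measurable_cst.
  move=> x; rewrite indicE; have [Zx|nZx] := ltP (1 / 4) `|F x - (label Apart x)%:R|.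
    by rewrite mem_set// mulr1n; lra.
  by rewrite memNset ?mulr_ge0//=; apply/negP; rewrite -leNgt.
rewrite Rintegral_scale//.
have : \int[mu]_x `|F x - (label Apart x)%:R| <=
    \int[mu]_x (\sum_(i < k) i%:R * `|f i x - \1_(A i) x|).
  apply: Rintegral_le => //; first exact: bounded_measurable_sum.
  move=> x; rewrite labE /F -sumrB; apply: le_trans (ler_norm_sum _ _ _) _.
  by apply: ler_sum => i _; rewrite -mulrBr normrM ger0_norm.
rewrite Rintegral_sum// => h.
have h2 : \sum_(i < k) \int[mu]_x (i%:R * `|f i x - \1_(A i) x|) <=
    (\sum_(i < k) i%:R) * (e / K).
  rewrite mulr_suml; apply: ler_sum => i _; rewrite Rintegral_scale//.
  by rewrite ler_wpM2l//; have [] := fP i.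
have h3 : K * (e / K) = e by rewrite mulrC divfK// gt_eqF.
by move: h3; rewrite /K mulrDl mul1r -mulrA => h3; lra.
Qed.

End label_approximation.

Section separated_names.
Context {R : realType} {X : pointedMetricType R} (T : X -> X).

(** One point is chosen for each name seen on [G], and among these finitely many points a maximal
    separated set. By maximality the Hamming balls of radius [a] around its names cover all names
    seen on [G], and [hamming_ball_card] bounds each ball. *)
Lemma separated_names (k n a : nat) (N : X -> {ffun 'I_n -> 'I_k}) (G : set X) (e t : R) :
  0 < e -> 0 < t -> t <= 1 ->
  (forall x y, G x -> G y -> bowen_ball T x e n y -> (hamming (N x) (N y) <= a)%N) ->
  exists C : {fset X}, [/\ Defs.separated T e n C, forall x, x \in C -> G x &
    #|[set w | `[< exists2 x, G x & N x = w >]]%SET|%:R * t ^+ a <=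
    #|` C|%:R * (1 + k%:R * t) ^+ n].
Proof.
move=> e0 t0 t1 NG; set S := [set w | _]%SET.
have /choice[r rP] : forall w, exists x, w \in S -> G x /\ N x = w.
  move=> w; have [|_] := boolP (w \in S); last by exists point.
  by rewrite inE => /asboolP[x Gx Nx]; exists x.
pose sep (D : {set {ffun 'I_n -> 'I_k}}) := (D \subset S) && [forall w in D,
  forall w' in D, (w != w') ==> ~~ `[< bowen_ball T (r w) e n (r w') >]].
have [D /maxsetP[/andP[DS /forall_inP Dsep] Dmax]] : {D | maxset sep D}.
  apply: ex_maxset; exists finset.set0; apply/andP; split; first exact: finset.sub0set.
  by apply/forall_inP => w; rewrite inE.
have Bsym w w' : bowen_ball T (r w) e n (r w') -> bowen_ball T (r w') e n (r w).
  by move=> B i ni; rewrite metric_sym; exact: B.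
have Bcov w : w \in S -> exists2 w', w' \in D & bowen_ball T (r w') e n (r w).
  move=> wS; apply: contrapT => /forall2NP nw.
  have wD : w \notin D.
    apply/negP => wD; have [//|] := nw w; apply => i _.
    by rewrite mdistxx.
  suff /Dmax : sep (w |: D)%SET.
    by move=> /(_ (finset.subsetUr _ _)) wDD; move: wD; rewrite -wDD finset.setU11.
  apply/andP; split; first by rewrite finset.subUset DS finset.sub1set wS.
  apply/forall_inP => u uD; apply/forall_inP => v vD; apply/implyP => uv.
  move: uD vD uv; rewrite !finset.in_setU1 => /predU1P[->|uD] /predU1P[->|vD].
  - by rewrite eqxx.
  - by move=> _; apply/negP => /asboolP/Bsym; have [|] := nw v.
  - by move=> _; apply/negP => /asboolP; have [|] := nw u.
  - by have /forall_inP/(_ v vD)/implyP := Dsep u uD.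
have rS w : w \in D -> G (r w) /\ N (r w) = w.
  by move=> wD; apply: rP; exact: (fintype.subsetP DS).
have rinj : {in D &, injective r}.
  by move=> w w' /rS[_ Nw] /rS[_ Nw'] rww; rewrite -Nw -Nw' rww.
exists [fset r w | w in D]%fset; split.
- move=> _ _ /imfsetP[w /= wD ->] /imfsetP[w' /= w'D ->] ww' B.
  have /forall_inP/(_ w' w'D)/implyP := Dsep w wD.
  have ww : w != w' by apply/eqP => ww; apply: ww'; rewrite ww.
  by move=> /(_ ww)/negP; apply; apply/asboolP.
- by move=> _ /imfsetP[w /= wD ->]; have [] := rS w wD.
- rewrite card_in_imfset//= -cardE.
  apply: (@le_trans _ _ (\sum_(v in D) #|[set w | (hamming v w <= a)%N]%SET|%:R * t ^+ a)).
    rewrite -mulr_suml ler_wpM2r ?exprn_ge0 ?(ltW t0)// -natr_sum ler_nat.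
    rewrite -sum1_card.
    apply: (@leq_trans (\sum_(w in S) \sum_(v in D) (hamming v w <= a))%N).
      apply: leq_sum => w wS; have [v vD Bvw] := Bcov w wS.
      rewrite (bigD1 v)//=; suff -> : (hamming v w <= a)%N by [].
      have [Gv {1}<-] := rS v vD; have [Gw {1}<-] := rP w wS; exact: NG.
    rewrite exchange_big/=; apply: leq_sum => v vD.
    rewrite -sum1_card big_mkcond/= [leqRHS]big_mkcond/=; apply: leq_sum => w _.
    by case: ifP => // _; rewrite inE; case: (hamming v w <= a)%N.
  rewrite -[X in _ <= X%:R * _]sum1_card natr_sum mulr_suml.
  by apply: ler_sum => v vD; rewrite mul1r; exact: hamming_ball_card.
Qed.

End separated_names.

Lemma sum_ltn (m n : nat) : (\sum_(i < n) (i < m) <= m)%N.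
Proof.
suff -> : (\sum_(i < n) (i < m) = minn n m)%N by exact: geq_minr.
elim: n => [|n IH]; first by rewrite big_ord0 min0n.
by rewrite big_ord_recr/= IH; lia.
Qed.

Lemma sum_geq_sub (m n : nat) : (\sum_(i < n) (n <= i + m) <= m)%N.
Proof.
rewrite (reindex_inj rev_ord_inj)/=; apply: leq_trans (sum_ltn m n).
by apply: leq_sum => i _; have := ltn_ord i; lia.
Qed.

(** The four events are the possible causes of a disagreement in [lower_bound]: closeness to either
    end of the time interval, and a visit of either orbit to [Z]. *)
Lemma hamming_le k n (v w : {ffun 'I_n -> 'I_k}) (b1 b2 b3 b4 : 'I_n -> bool) :
  (forall i, v i != w i -> [|| b1 i, b2 i, b3 i | b4 i]) ->
  (hamming v w <= \sum_i b1 i + \sum_i b2 i + (\sum_i b3 i + \sum_i b4 i))%N.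
Proof.
move=> vw; rewrite /hamming -3!big_split/=; apply: leq_sum => i _.
case: (boolP (v i != w i)) => // /vw.
by case: (b1 i); case: (b2 i); case: (b3 i); case: (b4 i).
Qed.

Lemma ln_mulXn_le {R : realType} (x y t q b : R) (m n : nat) :
  0 < x -> 0 < y -> 0 < t -> 0 < q -> ln q <= b ->
  x * t ^+ m <= y * q ^+ n -> ln x + m%:R * ln t <= ln y + n%:R * b.
Proof.
move=> x0 y0 t0 q0 qb; have tm : 0 < t ^+ m by rewrite exprn_gt0.
have qn : 0 < q ^+ n by rewrite exprn_gt0.
rewrite -ler_ln ?posrE; [|exact: mulr_gt0|exact: mulr_gt0].
rewrite !lnM ?posrE// !lnXn// => /le_trans; rewrite mulr_natl; apply.
by rewrite lerD2l mulr_natl lerMn2r qb orbT.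
Qed.

Lemma shannon_le_visited {R : realType} d {Y : measurableType d} (P : probability Y R)
    (W : finType) (N : Y -> W) (B : set Y) (S : {set W}) :
  measurable_fibers N -> measurable B -> (0 < #|S|)%N ->
  (forall x, ~ B x -> N x \in S) ->
  shannon (distr P N) <= ln 2 + ln #|S|%:R + fine (P B) * ln #|W|%:R.
Proof.
move=> mN mB S0 NS.
apply: le_trans (shannon_le_split (distr_ge0 _ _) (sum_distr _ mN) S0) _.
have W0 : (0 < #|W|)%N by apply: leq_trans S0 _; exact: max_card.
rewrite lerD2l; apply: ler_wpM2r; first by rewrite ln_ge0// ler1n.
have := congr1 (fun g => g false) (law_distr P (fun w => w \in S) mN).
rewrite /law (eq_bigl (fun w => w \in ~: S)%SET) => [->|w]; last first.
  by rewrite finset.in_setC eqbF_neg.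
apply: le_fine_probability => //.
  have := measurable_preim (fun w => (w \in S) == false) mN; congr measurable.
  by apply/seteqP; split=> x /= /eqP.
by move=> x /= xS; apply: contrapT => nBx; move: xS; rewrite NS.
Qed.

(** The bookkeeping of [lower_bound]: [Hn] is the entropy of the names, [lS] and [lC] the logarithms
    of the numbers of visited names and of separated points, [al] the cost of the Hamming radius,
    [D] the mass of the bad set, [K = ln k] and [l = - ln t]. Each [h] pays for one of the ball
    growth, the constants, and the terms proportional to [D]. *)
Lemma entropy_count_arith {R : realType} (n Hn l2 lS lC al D K l h m : R) :
  0 < n -> 0 <= D -> lS - al <= lC + n * h -> Hn <= l2 + lS + D * (n * K) ->
  al <= m * l + 4 * D * n * l -> l2 + m * l <= n * h ->
  D * (1 + K + 4 * l) <= h -> n^-1 * Hn <= n^-1 * lC + 3 * h.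
Proof.
move=> n0 D0 h1 h2 h3 h4 h5; rewrite -(ler_pM2l n0) mulrDr !mulVKf ?gt_eqF//.
have h6 : n * (D * (1 + K + 4 * l)) <= n * h by rewrite ler_wpM2l// ltW.
have h7 : 0 <= n * D by rewrite mulr_ge0// ltW.
have e1 : n * (D * (1 + K + 4 * l)) = n * D + D * (n * K) + 4 * D * n * l by lra.
lra.
Qed.

Section lower_bound.
Context {R : realType} {X : pointedMetricType R} (T : X -> X).
Variable E : probability (borel X) R -> R.
Hypotheses (cX : compact [set: X]) (cT : continuous T) (cE : energy E).
Local Notation prob := (probability (borel X) R).

Lemma continuous_borel_measurable :
  measurable_fun [set: borel X] (T : borel X -> borel X).
Proof.
apply: (@measurability _ _ (borel X) (borel X) setT T (@open X) erefl).
move=> _ [U oU <-]; rewrite setTI; apply: open_borel.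
by move/continuousP : cT; apply.
Qed.

Lemma energy_weak_basic (mu : prob) (e : R) : 0 < e ->
  exists fs r, [/\ 0 < r, forall f, List.In f fs -> continuous f
    & forall nu, weak_basic mu fs r nu -> `|E mu - E nu| < e].
Proof.
move=> e0; have cEmu : {for (mu : weak_prob X), continuous (E : weak_prob X -> R)}.
  exact: cE.
move: cEmu => /cvgrPdist_lt/(_ _ e0) nE.
have {nE} : nbhs (mu : weak_prob X) [set nu : weak_prob X | `|E mu - E nu| < e] by exact: nE.
move=> /weak_nbhs_basic[fs [r [r0 cfs rE]]].
by exists fs, r; split=> // nu /rE.
Qed.

Let mT := continuous_borel_measurable.

Lemma growth_ge (eps : R) n (C : {fset X}) (c : R) : (0 < n)%N ->
  Defs.separated T eps n C -> (0 < #|` C|)%N ->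
  (forall x, x \in C -> c <= E (empirical T n x)) ->
  ((n%:R^-1 * ln #|` C|%:R + c)%:E <= growth T E eps n)%E.
Proof.
move=> n0 sC C0 Cc.
have n0r : 0 < n%:R :> R by rewrite ltr0n.
have C0r : 0 < #|` C|%:R :> R by rewrite ltr0n.
have wC : #|` C|%:R * expR (n%:R * c) <= weight T E n C.
  rewrite /weight -[X in X%:R]sum1_size natr_sum mulr_suml.
  rewrite big_seq [leRHS]big_seq; apply: ler_sum => x xC.
  by rewrite mul1r ler_expR ler_wpM2l// Cc.
have w0 : 0 < #|` C|%:R * expR (n%:R * c) by rewrite mulr_gt0// expR_gt0.
have -> : n%:R^-1 * ln #|` C|%:R + c =
    n%:R^-1 * ln (#|` C|%:R * expR (n%:R * c)).
  by rewrite lnM ?posrE ?expR_gt0// expRK mulrDr mulKf// gt_eqF.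
rewrite EFinM /growth; apply: lee_wpmul2l; first by rewrite lee_fin invr_ge0.
rewrite -lne_EFin//; have wz : ((weight T E n C)%:E <= zeta T E eps n)%E.
  by apply: ereal_sup_ubound; exists C.
have z0 : (0 <= zeta T E eps n)%E.
  by apply: le_trans wz; rewrite lee_fin (le_trans (ltW w0)).
rewrite lee_lne ?in_itv/= ?z0 ?leey ?lee_fin ?(ltW w0)//.
by apply: le_trans wz; rewrite lee_fin.
Qed.

(** Two scales, because labels are compared only away from the ends: [eps] depends on [nu], [A] and
    [eta] alone, and any scale [e0] that controls [eps] up to a margin [m] may follow. Taking
    [e0 = eps] and [m = 0] serves a general map; expansivity serves an [e0] fixed in advance. *)
Lemma lower_bound (nu : prob) k (A : 'I_k -> set (borel X)) (eta : R) :
  ergodic_measures T nu -> mpartition A -> 0 < eta ->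
  exists2 eps : R, 0 < eps & forall (e0 : R) (m : nat), 0 < e0 ->
    (forall n x y, (forall i, (i < n)%N -> mdist (iter i T x) (iter i T y) < e0) ->
      forall i, (m <= i)%N -> (i + m < n)%N -> mdist (iter i T x) (iter i T y) < eps) ->
    exists N, forall n, (N <= n)%N ->
      ((partition_entropy T nu A + E nu - eta)%:E <= growth T E e0 n)%E.
Proof.
move=> [nuT nuerg] Apart eta0.
have k0 : (0 < k)%N by apply: leq_ltn_trans (ltn_ord (label Apart point)).
have k1 : 1 <= k%:R :> R by rewrite ler1n.
have k0r : 0 < k%:R :> R by rewrite ltr0n.
(* Five errors of size [h] occur: three in [entropy_count_arith], one in the limit defining the
   partition entropy, one in the energy. *)
pose h := eta / 8; have h0 : 0 < h by rewrite divr_gt0.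
(* Makes [ln (1 + k t) <= h], the growth rate of the Hamming balls. *)
pose t : R := Num.min 1 (h / k%:R).
have t0 : 0 < t by rewrite lt_min ltr01 divr_gt0.
have t1 : t <= 1 by rewrite ge_min lexx.
have kt : k%:R * t <= h by rewrite mulrC -ler_pdivlMr// ge_min lexx orbT.
pose lt := - ln t; have lt0 : 0 <= lt by rewrite oppr_ge0 ln_le0.
have lnk : 0 <= ln k%:R :> R by rewrite ln_ge0.
have D0 : 0 < 1 + ln k%:R + 4 * lt by rewrite -addrA ltr_pwDl// addr_ge0// mulr_ge0.
(* Chosen after [t], since a Hamming radius of [4 dl n] costs [4 dl n] times [- ln t]; the bound
   [1 / 2] leaves points outside the bad set. *)
pose dl : R := Num.min (1 / 2) (h / (1 + ln k%:R + 4 * lt)).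
have dl0 : 0 < dl by rewrite lt_min !divr_gt0.
have dl2 : dl <= 1 / 2 by rewrite ge_min lexx.
have dlh : dl * (1 + ln k%:R + 4 * lt) <= h by rewrite -ler_pdivlMr// ge_min lexx orbT.
have [f [cf [mZ nuZ]]] := label_approx cX nu Apart dl0.
set Z := [set x : borel X | _] in mZ nuZ.
have [eps eps0 feps] := compact_uniform_continuous cX cf (divr_gt0 ltr01 (ltr0Sn R 1)).
have [fs [r [r0 cfs rE]]] := energy_weak_basic nu h0.
exists eps => // e0 m e00 em.
(* One accuracy for both uses of the ergodic theorem: visits to [Z] up to [dl], test functions of
   the energy up to [r]. *)
pose tau := Num.min dl r.
have tau0 : 0 < tau by rewrite lt_min dl0.
have bfs g : List.In g ((\1_Z : borel X -> R) :: fs) -> bounded_measurable (g : borel X -> R).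
  move=> [<-|gfs]; first exact: bounded_measurable_indic.
  by apply: continuous_bounded_measurable => //; exact: cfs.
have [N1 HN1] := birkhoff_bad_set mT nuT nuerg tau0 dl0 bfs.
have /cvgrPdist_le/(_ _ h0)[N2 _ HN2] := cvg_partition_entropy mT Apart nuT.
pose c0 := ln 2 + (2 * m)%:R * lt.
pose N3 := (Num.truncn (c0 / h)).+1.
exists (maxn (maxn N1 N2) (maxn N3 1)) => n; rewrite !geq_max => /andP[/andP[n1 n2] /andP[n3 n0]].
have n0r : 0 < n%:R :> R by rewrite ltr0n.
have [B [mB nuB BP]] := HN1 n n1.
have ZB x : ~ B x -> birkhoff_sum (T : borel X -> borel X) \1_Z n x <= 2 * dl * n%:R.
  move=> /BP/(_ \1_Z (or_introl erefl)); rewrite Rintegral_indic// ler_norml => /andP[_].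
  have : n%:R * fine (nu Z) <= n%:R * dl by rewrite ler_wpM2l.
  have : tau * n%:R <= dl * n%:R by rewrite ler_wpM2r// ge_min lexx.
  lra.
have EB x : ~ B x -> E nu - h <= E (empirical T n x).
  move=> nBx; suff /rE : weak_basic nu fs r (empirical T n x) by rewrite ltr_norml; lra.
  move=> g gfs; have bg := bfs g (or_intror gfs).
  rewrite empirical_integral//; have := BP x nBx g (or_intror gfs).
  have taur : tau * n%:R <= r * n%:R by rewrite ler_wpM2r// ge_min lexx orbT.
  move=> /le_trans/(_ taur).
  have -> : birkhoff_sum (T : borel X -> borel X) g n x - n%:R * \int[nu]_x g x =
    n%:R * (n%:R^-1 * birkhoff_sum (T : borel X -> borel X) g n x - \int[nu]_x g x).
    by rewrite mulrBr mulVKf// gt_eqF.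
  by rewrite normrM gtr0_norm// [r * _]mulrC ler_pM2l.
pose v (x : X) := (\sum_(i < n) (iter i T x \in Z))%N.
have vE (x : borel X) : (v x)%:R = birkhoff_sum (T : borel X -> borel X) \1_Z n x :> R.
  by rewrite /v natr_sum; apply: eq_bigr => i _; rewrite indicE.
(* The two ends count [m] times each; either orbit visits [Z] at most [2 dl n] times, namely [dl n]
   for the mass of [Z] and [dl n] for the deviation. *)
pose a := (m + m + Num.truncn (4 * dl * n%:R))%N.
have ham x y : ~ B x -> ~ B y -> bowen_ball T x e0 n y ->
    (hamming (name T Apart n x) (name T Apart n y) <= a)%N.
  move=> nBx nBy Bxy.
  have vxy : (v x + v y <= Num.truncn (4 * dl * n%:R))%N.
    rewrite truncn_ge_nat ?mulr_ge0 ?(ltW dl0)// natrD !vE.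
    by have := ZB x nBx; have := ZB y nBy; lra.
  apply: leq_trans (_ : (\sum_(i < n) (i < m) + \sum_(i < n) (n <= i + m) + (v x + v y))%N <= _)%N; last first.
    by rewrite leq_add// leq_add ?sum_ltn ?sum_geq_sub.
  apply: hamming_le => i; rewrite !ffunE => /eqP xy.
  apply: contraT => /norP[+ /norP[+ /norP[nZx nZy]]].
  rewrite -leqNgt -ltnNge => mi imn; exfalso; apply: xy.
  have dxy := em n y x Bxy i mi imn.
  move: nZx nZy; rewrite !notin_setE /Z/= => /negP + /negP; rewrite -!leNgt.
  have := feps _ _ dxy; set fx := f (iter i T x); set fy := f (iter i T y).
  set lx := label Apart (iter i T x); set ly := label Apart (iter i T y).
  rewrite ltr_norml !ler_norml => fxy hx hy; apply/val_inj/eqP => /=.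
  rewrite eqn_leq -ltnS -[X in _ && X]ltnS -!(ltr_nat R) -!natr1.
  by apply/andP; split; lra.
have [C [sC CB CS]] := @separated_names R X T k n a (name T Apart n) (fun x => ~ B x) e0 t e00 t0 t1 ham.
pose S : {set {ffun 'I_n -> 'I_k}} :=
  [set w | `[< exists2 x, ~ B x & name T Apart n x = w >]]%SET.
rewrite -/S in CS.
have [|x0 Bx0] := @probability_lt1_ex _ _ _ nu B.
  by apply: le_lt_trans nuB _; apply: le_lt_trans dl2 _; rewrite ltr_pdivrMr// mul1r ltr1n.
have S0 : (0 < #|S|)%N.
  by apply/card_gt0P; exists (name T Apart n x0); rewrite inE; apply/asboolP; exists x0.
have S0r : 0 < #|S|%:R :> R by rewrite ltr0n.
have t0a : 0 < t ^+ a by rewrite exprn_gt0.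
have kt0 : 0 < 1 + k%:R * t by rewrite ltr_pwDl// mulr_ge0// ltW.
have ktn : 0 < (1 + k%:R * t) ^+ n by rewrite exprn_gt0.
have C0 : (0 < #|` C|)%N.
  rewrite lt0n; apply/negP => /eqP C0; move: CS; rewrite C0 mul0r leNgt.
  by rewrite mulr_gt0.
have C0r : 0 < #|` C|%:R :> R by rewrite ltr0n.
have lnC : ln #|S|%:R - a%:R * lt <= ln #|` C|%:R + n%:R * h.
  have lnq : ln (1 + k%:R * t) <= h.
    apply: le_trans kt; apply: le_ln1Dx.
    by apply: (lt_le_trans (ltrN10 _)); apply: mulr_ge0 => //; exact: ltW.
  by have := ln_mulXn_le S0r C0r t0 kt0 lnq CS; rewrite /lt mulrN opprK.
have HS : join_entropy T nu A n <= ln 2 + ln #|S|%:R + dl * (n%:R * ln k%:R).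
  rewrite (join_entropyE _ Apart); have mN := @measurable_name _ _ _ mT _ _ Apart n.
  apply: le_trans (shannon_le_visited nu mN mB S0 _) _.
    by move=> x nBx; rewrite inE; apply/asboolP; exists x.
  rewrite lerD2l card_ffun !card_ord natrX lnXn// -[ln _ *+ n]mulr_natl.
  by apply: ler_wpM2r => //; rewrite mulr_ge0.
have lea : a%:R * lt <= (2 * m)%:R * lt + 4 * dl * n%:R * lt.
  rewrite -mulrDl ler_wpM2r// /a addnn -mul2n natrD lerD2l.
  by rewrite truncn_le// mulr_ge0// mulr_ge0// ltW.
have c0n : c0 <= n%:R * h.
  rewrite -ler_pdivrMr//; apply: le_trans (ltW (truncnS_gt _)) _.
  by rewrite ler_nat.
apply: le_trans (growth_ge n0 sC C0 (c := E nu - h) _); last first.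
  by move=> x xC; apply: EB; exact: CB.
rewrite lee_fin.
have HH := HN2 n n2; rewrite ler_norml in HH; move/andP : HH => [_ HH].
have key := entropy_count_arith n0r (ltW dl0) lnC HS lea c0n dlh.
have etah : eta = 8 * h by rewrite /h mulrC divfK.
move: HH key etah h0; move: (n%:R^-1 * _) (n%:R^-1 * _) (partition_entropy _ _ _) => u w z.
clear; lra.
Qed.

End lower_bound.

(** * Partitions into continuity sets *)

Section jordan_sets.
Context {R : realType} {X : pointedMetricType R}.
Hypothesis cX : compact [set: X].
Variable mu : probability (borel X) R.

Let cbm (f : X -> R) : continuous f -> bounded_measurable (f : borel X -> R).
Proof. exact: continuous_bounded_measurable. Qed.

(** Null boundary in functional form: squeezing the indicator between continuous functions makes
    Boolean operations and preimages algebraic, and it is what passing to the limit of functionals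
    uses. *)
Definition jordan (A : set X) := measurable (A : set (borel X)) /\
  forall e : R, 0 < e -> exists f g : X -> R, [/\ continuous f, continuous g,
    forall x, 0 <= f x <= \1_A x, forall x, \1_A x <= g x <= 1 &
    \int[mu]_x g x <= \int[mu]_x f x + e].

Lemma jordan_setT : jordan setT.
Proof.
split=> // e e0; exists (fun=> 1), (fun=> 1).
split; [exact: continuous_cstr|exact: continuous_cstr| | |by rewrite lerDl ltW];
  by move=> x; rewrite indicE in_setT ?ler01 lexx.
Qed.

Lemma jordan_setC A : jordan A -> jordan (~` A).
Proof.
move=> [mA jA]; split; first exact: measurableC.
have c1 : continuous (fun _ : X => 1 : R) by exact: continuous_cstr.
move=> e /jA[f [g [cf cg fA gA fg]]]; exists (fun x => 1 - g x), (fun x => 1 - f x).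
have b1 : bounded_measurable (fun _ : borel X => 1 : R) by exact: bounded_measurable_cst.
have bf := cbm cf; have bg := cbm cg.
split; [exact: continuous_subr|exact: continuous_subr| | | ].
- move=> x; have := gA x; rewrite !indicE in_setC.
  by case: (x \in A) => /=; rewrite ?mulr1n ?mulr0n; lra.
- move=> x; have := fA x; rewrite !indicE in_setC.
  by case: (x \in A) => /=; rewrite ?mulr1n ?mulr0n; lra.
- by rewrite !Rintegral_sub ?Rintegral_const//; first lra.
Qed.

Lemma jordan_setI A B : jordan A -> jordan B -> jordan (A `&` B).
Proof.
move=> [mA jA] [mB jB]; split; first exact: measurableI.
move=> e e0; have e2 : 0 < e / 2 by rewrite divr_gt0.
have [f [g [cf cg fA gA fg]]] := jA _ e2.
have [f' [g' [cf' cg' fB gB fg']]] := jB _ e2.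
exists (fun x => f x * f' x), (fun x => g x * g' x).
have cff := continuous_mulr cf cf'; have cgg := continuous_mulr cg cg'.
have cfg := continuous_addr cf cf'; have cgf := continuous_addr cg cg'.
have hA x : 0 <= (\1_A x : R) <= 1 by rewrite indicE; case: (x \in A); rewrite /= ?ler01 ?lexx.
have hB x : 0 <= (\1_B x : R) <= 1 by rewrite indicE; case: (x \in B); rewrite /= ?ler01 ?lexx.
split=> //.
- move=> x; have /andP[f0 fa] := fA x; have /andP[f0' fa'] := fB x.
  by rewrite mulr_ge0//= indicI ler_pM.
- move=> x; have /andP[ga g1] := gA x; have /andP[gb g1'] := gB x.
  have /andP[a0 a1] := hA x; have /andP[b0 b1] := hB x.
  rewrite indicI ler_pM//=; apply: (@le_trans _ _ (1 * 1)); last by rewrite mulr1.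
  by apply: ler_pM => //; [exact: le_trans ga|exact: le_trans gb].
(* The gap of the products is at most the sum of the gaps, written without subtraction; the
   difference of the two sides is [(1 - g) (g' - f') + (1 - f') (g - f)]. *)
- have : \int[mu]_x (g x * g' x + (f x + f' x)) <= \int[mu]_x (f x * f' x + (g x + g' x)).
    apply: Rintegral_le.
    + by apply: bounded_measurableD; exact: cbm.
    + by apply: bounded_measurableD; exact: cbm.
    + move=> x; have /andP[f0 fa] := fA x; have /andP[f0' fa'] := fB x.
      have /andP[ga g1] := gA x; have /andP[gb g1'] := gB x.
      have /andP[a0 a1] := hA x; have /andP[b0 b1] := hB x.
      have h1 : 0 <= (1 - g x) * (g' x - f' x) by rewrite mulr_ge0 ?subr_ge0//; lra.
      have h2 : 0 <= (1 - f' x) * (g x - f x) by rewrite mulr_ge0 ?subr_ge0//; lra.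
      by move: h1 h2; rewrite !mulrBr !mulrBl !mul1r; lra.
  rewrite !(Rintegral_add _ (cbm _) (cbm _))//; lra.
Qed.

Lemma jordan_preimage (T : X -> X) A : continuous T ->
  invariant_measures T mu -> jordan A -> jordan (T @^-1` A).
Proof.
move=> cT muT [mA jA]; have mT := continuous_borel_measurable cT.
split; first by rewrite -[_ @^-1` _]setTI; exact: mT.
move=> e /jA[f [g [cf cg fA gA fg]]]; exists (f \o T), (g \o T).
have cc (h : X -> R) : continuous h -> continuous (h \o T).
  by move=> ch x; apply: continuous_comp; [exact: cT|exact: ch].
split; [exact: cc|exact: cc| | |].
- by move=> x; have := fA (T x).
- by move=> x; have := gA (T x).
- have := invariant_Rintegral mT muT (cbm cf); have := invariant_Rintegral mT muT (cbm cg).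
  by rewrite /= => -> ->.
Qed.

Lemma jordan_iter (T : X -> X) A n : continuous T ->
  invariant_measures T mu -> jordan A -> jordan (iter n T @^-1` A).
Proof.
move=> cT muT; elim: n A => // n IH A jA.
have -> : iter n.+1 T @^-1` A = iter n T @^-1` (T @^-1` A) by [].
by apply: IH; exact: jordan_preimage.
Qed.

Lemma jordan_bigcap n (A : 'I_n -> set X) : (forall i, jordan (A i)) ->
  jordan (\bigcap_i A i).
Proof.
move=> jA; suff H (s : seq 'I_n) : jordan [set x | forall i, i \in s -> A i x].
  have := H (enum 'I_n); congr jordan.
  by apply/seteqP; split=> x /= Ax i => [_|_]; apply: Ax => //; rewrite mem_enum.
elim: s => [|i s IH].
  by have := jordan_setT; congr jordan; apply/seteqP; split.
have := jordan_setI (jA i) IH; congr jordan; apply/seteqP; split => x /=.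
  by move=> [Aix Asx] j; rewrite inE => /predU1P[->//|]; exact: Asx.
move=> Ax; split; first by apply: Ax; rewrite inE eqxx.
by move=> j js; apply: Ax; rewrite inE js orbT.
Qed.

(** Spheres of distinct radii are disjoint, so at most [n + 1] of them have measure at least
    [1 / (n + 1)]. If none were null, the interval of radii would be countable, against its positive
    Lebesgue measure. *)
Lemma null_sphere (x : X) (a b : R) : a < b -> exists c, [/\ a < c, c < b &
  mu [set y : borel X | mdist x y = c] = 0%E].
Proof.
move=> ab; apply: contrapT => nc.
pose S c := [set y : borel X | mdist x y = c].
have mS c : measurable (S c).
  have md : measurable_fun [set: borel X] (mdist x : borel X -> R).
    by apply: measurable_fun_borel; exact: mdist_continuous.
  by rewrite -[S c]setTI; exact: (md measurableT [set c] (measurable_set1 c)).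
pose H n := [set c | a < c < b /\ n.+1%:R^-1 <= fine (mu (S c))].
have finH n : finite_set (H n).
  apply: contrapT => /(@infinite_set_fset _ _ n.+2)[B BH nB].
  have bI c : bounded_measurable (\1_(S c) : borel X -> R).
    exact: bounded_measurable_indic.
  have h1 : \int[mu]_y (\sum_(c <- B) \1_(S c) y) <= \int[mu]_y 1.
    apply: Rintegral_le.
    - exact: bounded_measurable_sum.
    - exact: bounded_measurable_cst.
    - move=> y; have [yB|yB] := boolP (mdist x y \in B).
        rewrite (big_fsetD1 _ yB)/= big_seq big1 ?addr0.
          by rewrite indicE; case: (_ \in _).
        move=> c; rewrite !inE => /andP[cy cB]; rewrite indicE memNset// => yc.
        by move: cy; rewrite -yc eqxx.
      rewrite big_seq big1 ?ler01// => c cB; rewrite indicE memNset// => yc.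
      by move: yB; rewrite yc cB.
  move: h1; rewrite Rintegral_const Rintegral_sum// leNgt => /negP; apply.
  apply: (@lt_le_trans _ _ (\sum_(c <- B) n.+1%:R^-1)).
    rewrite big_const_seq count_predT iter_addr_0 -[X in _ < X]mulr_natl.
    by rewrite ltr_pdivlMr// mul1r ltr_nat.
  rewrite big_seq [leRHS]big_seq; apply: ler_sum => c cB.
  by rewrite Rintegral_indic//; have [_] := BH c cB.
have : countable (\bigcup_n H n).
  by apply: bigcup_countable => // n _; exact: finite_set_countable.
have -> : \bigcup_n H n = `]a, b[%classic.
  apply/seteqP; split=> c /=; first by move=> [n _ [acb _]]; rewrite in_itv.
  rewrite in_itv/= => /andP[ac cb].
  have S0 : 0 < fine (mu (S c)).
    rewrite fine_gt0// ltey_eq fin_num_measure//= andbT lt_neqAle measure_ge0 andbT.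
    by apply/eqP => /esym S0; apply: nc; exists c.
  exists (Num.truncn (fine (mu (S c)))^-1) => //; split; first by rewrite ac.
  by rewrite invf_ple ?posrE//; exact/ltW/truncnS_gt.
move=> /countable_lebesgue_measure0; rewrite lebesgue_measure_itv/= lte_fin ab.
by rewrite -EFinD => -[] /eqP; rewrite subr_eq0 gt_eqF.
Qed.

Lemma jordan_ball (x : X) (a b : R) : a < b -> exists c, [/\ a < c, c < b &
  jordan [set y | mdist x y < c]].
Proof.
move=> /(null_sphere x)[c [ac cb c0]]; exists c; split=> //.
have cd : continuous (mdist x) by exact: mdist_continuous.
have cc (r : R) : continuous (fun _ : X => r) by exact: continuous_cstr.
have mA : measurable ([set y | mdist x y < c] : set (borel X)).
  by apply: open_borel; exact: open_ltr.
split=> // e e0.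
pose F n := [set y : borel X | n.+1%:R * `|mdist x y - c| < 1].
have cnd n : continuous (fun y => n%:R * (mdist x y - c)).
  by apply: continuous_mulr => //; exact: continuous_subr.
have mF n : measurable (F n).
  apply: open_borel; apply: open_ltr => //; apply: continuous_mulr => //.
  by apply: continuous_normr; exact: continuous_subr.
have [||N /(_ N (leqnn N)) FN] := @probability_vanish _ _ _ mu F mF _ _ _ e0.
- by move=> n y; apply: le_lt_trans; rewrite ler_wpM2r// ler_nat.
- rewrite (_ : \bigcap_n F n = [set y : borel X | mdist x y = c])//.
  apply/seteqP; split=> y /= Fy; last by move=> n _; rewrite /F/= Fy subrr normr0 mulr0.
  apply/eqP; rewrite -subr_eq0 -normr_eq0; apply/negPn/negP => d0.
  have dp : 0 < `|mdist x y - c| by rewrite lt_neqAle eq_sym d0 normr_ge0.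
  have := Fy (Num.truncn `|mdist x y - c|^-1) Logic.I.
  rewrite /F/= -ltr_pdivlMr// mul1r; apply/negP; rewrite -leNgt.
  exact/ltW/truncnS_gt.
(* Ramps of slope [N + 1] just inside and just outside the sphere of radius [c]; they differ only in
   the shell [F N]. *)
exists (fun y => Num.max 0 (Num.min 1 (- (N.+1%:R * (mdist x y - c))))),
  (fun y => Num.min 1 (Num.max 0 (1 - N.+1%:R * (mdist x y - c)))).
have cf : continuous (fun y => Num.max 0 (Num.min 1 (- (N.+1%:R * (mdist x y - c))))).
  apply: continuous_maxr => //; apply: continuous_minr => //.
  rewrite (_ : (fun _ => _) = fun y => 0 - N.+1%:R * (mdist x y - c)).
    exact: continuous_subr.
  by apply/funext => y; rewrite sub0r.
have cg : continuous (fun y => Num.min 1 (Num.max 0 (1 - N.+1%:R * (mdist x y - c)))).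
  apply: continuous_minr => //; apply: continuous_maxr => //.
  exact: continuous_subr.
have sgnc (y : X) : mdist x y < c -> N.+1%:R * (mdist x y - c) <= 0.
  by move=> yc; rewrite pmulr_rle0// subr_le0 ltW.
have sgnc' (y : X) : c <= mdist x y -> 0 <= N.+1%:R * (mdist x y - c).
  by move=> yc; rewrite mulr_ge0// subr_ge0.
split=> //.
- move=> y; rewrite indicE; have [yc|yc] := ltP (mdist x y) c.
    by rewrite mem_set// le_max lexx/= ge_max ler01 ge_min lexx.
  rewrite memNset; last by apply/negP; rewrite -leNgt.
  rewrite le_max lexx/= ge_max lexx/= ge_min; apply/orP; right.
  by rewrite oppr_le0; exact: sgnc'.
- move=> y; rewrite indicE; have [yc|yc] := ltP (mdist x y) c.
    rewrite mem_set// ge_min lexx/= andbT le_min lexx/= le_max; apply/orP; right.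
    by have := sgnc y yc; rewrite mulr1n; lra.
  rewrite memNset; last by apply/negP; rewrite -leNgt.
  by rewrite ge_min lexx/= andbT le_min ler01/= le_max lexx.
- have b1 := bounded_measurable_indic (R := R) (mF N).
  apply: (@le_trans _ _ (\int[mu]_y (Num.max 0 (Num.min 1 (- (N.+1%:R * (mdist x y - c)))) + \1_(F N) y))).
    apply: Rintegral_le; [exact: cbm|by apply: bounded_measurableD => //; exact: cbm|].
    move=> y; rewrite indicE; have [Fy|nFy] := pselect (F N y).
      rewrite mem_set//; apply: (@le_trans _ _ 1); first by rewrite ge_min lexx.
      by rewrite lerDr le_max lexx.
    rewrite memNset// addr0; move: nFy => /negP; rewrite -leNgt.
    have [yc|yc] := ltP (mdist x y) c.
      rewrite ltr0_norm ?subr_lt0// mulrN => h; apply: (@le_trans _ _ 1).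
        by rewrite ge_min lexx.
      by rewrite le_max; apply/orP; right; rewrite le_min lexx.
    rewrite ger0_norm ?subr_ge0// => h.
    rewrite ge_min; apply/orP; right; rewrite ge_max le_max lexx/= le_max; apply/orP; left.
    by rewrite subr_le0.
  rewrite Rintegral_add//; last exact: cbm.
  by rewrite lerD2l Rintegral_indic.
Qed.

End jordan_sets.

Section jordan_partition.
Context {R : realType} {X : pointedMetricType R}.
Hypothesis cX : compact [set: X].
Variable mu : probability (borel X) R.

(** The index of the first member of the cover that contains the point makes the cover disjoint, by
    intersections and complements only. *)
Lemma jordan_find (V : X -> set X) (s : seq X) i : (forall t, jordan mu (V t)) ->
  jordan mu [set y | find (fun t => `[< V t y >]) s = i].
Proof.
move=> jV; elim: s i => [|t s IH] i.
  case: i => [|i].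
    by have := jordan_setT mu; congr jordan; apply/seteqP; split.
  have := jordan_setC cX (jordan_setT mu); congr jordan.
  by rewrite setCT; apply/seteqP; split.
case: i => [|i].
  have := jV t; congr jordan; apply/seteqP; split=> y /=.
    by move=> Vy; rewrite asboolT.
  by case: ifP => // /asboolP.
have := jordan_setI cX (jordan_setC cX (jV t)) (IH i); congr jordan.
apply/seteqP; split=> y /=; first by move=> [nVy <-]; rewrite asboolF.
by case: asboolP => // nVy [].
Qed.

Lemma jordan_partition (e : R) : 0 < e ->
  exists k (A : 'I_k -> set (borel X)) (Apart : mpartition A),
    (forall i, jordan mu (A i)) /\
    forall x y, label Apart x = label Apart y -> mdist x y < e.
Proof.
(* A radius below [e / 2] bounds the diameter of a cell by [e]; one above [e / 4] is positive, so
   the balls are neighbourhoods of their centres. *)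
move=> e0; have e24 : e / 4 < e / 2 by lra.
have /choice[c cP] := fun x => jordan_ball cX mu x e24.
pose V x := [set y | mdist x y < c x].
have jV t : jordan mu (V t) by have [] := cP t.
have [s sP] : exists s : seq X, forall x, exists2 t, t \in s & V t x.
  apply: compact_nbhs_cover => // t; apply: open_nbhs_nbhs; split.
    by apply: open_ltr; [exact: mdist_continuous|exact: continuous_cstr].
  by rewrite /V/= mdistxx; have [c1 _ _] := cP t; apply: lt_trans c1; rewrite divr_gt0.
pose fd y := find (fun t => `[< V t y >]) s.
have fds y : (fd y < size s)%N.
  by rewrite -has_find; have [t ts Vt] := sP y; apply/hasP; exists t => //; apply/asboolP.
pose A (i : 'I_(size s)) : set (borel X) := [set y | fd y = i].
have jA i : jordan mu (A i) by exact: jordan_find.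
have Apart : mpartition A.
  split; first by move=> i; have [] := jA i.
    apply/trivIsetP => i j _ _ ij; apply/seteqP; split => // y [/= iy jy].
    by move/eqP: ij; apply; apply/val_inj; rewrite /= -iy -jy.
  by apply/seteqP; split => // y _; exists (Ordinal (fds y)).
exists (size s), A, Apart; split=> // x y lxy.
have Ax : A (label Apart x) x by exact/labelP.
have Ay : A (label Apart x) y by apply/labelP.
pose t := nth point s (fd x).
have Vt z : fd z = fd x -> V t z.
  move=> zx; have := fds z; rewrite -has_find => /(nth_find point)/asboolP.
  by rewrite -/(fd z) zx.
have Vx := Vt x erefl; have Vy : V t y by apply: Vt; rewrite Ay Ax.
rewrite /V/= in Vx Vy; have [_ ct _] := cP t.
apply: le_lt_trans (metric_triangle x t y) _; rewrite [mdist x t]metric_sym.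
lra.
Qed.

Lemma cozero_approx (phi : X -> R) (e : R) : continuous phi ->
  (forall x, 0 <= phi x) -> 0 < e -> exists N : nat, forall n, (N <= n)%N ->
  fine (mu [set x | 0 < phi x]) - e <= \int[mu]_x Num.min 1 (n%:R * phi x).
Proof.
move=> cphi phi0 e0; set U : set (borel X) := [set x | 0 < phi x].
have cc (r : R) : continuous (fun _ : X => r) by exact: continuous_cstr.
have mU : measurable U by apply: open_borel; exact: open_ltr.
pose F n : set (borel X) := U `&` [set x | n%:R * phi x < 1].
have cn n : continuous (fun x => n%:R * phi x) by exact: continuous_mulr.
have mF n : measurable (F n).
  by apply: measurableI => //; apply: open_borel; apply: open_ltr.
have [||N FN] := @probability_vanish _ _ _ mu F mF _ _ _ e0.
- move=> n x [Ux /= xn]; split=> //=; apply: le_lt_trans xn.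
  by rewrite ler_wpM2r ?ler_nat.
- rewrite (_ : \bigcap_n F n = set0) ?measure0//; apply/seteqP; split => // x Fx.
  have [px _] := Fx 0%N Logic.I.
  have [_ /=] := Fx (Num.truncn (phi x)^-1).+1 Logic.I.
  rewrite -ltr_pdivlMr// mul1r; apply/negP; rewrite -leNgt; exact/ltW/truncnS_gt.
exists N => n /FN nF; rewrite lerBlDr; apply: le_trans (lerD (lexx _) nF).
have bF := bounded_measurable_indic (R := R) (mF n).
have bU := bounded_measurable_indic (R := R) mU.
have bm : bounded_measurable ((fun x => Num.min 1 (n%:R * phi x)) : borel X -> R).
  by apply: continuous_bounded_measurable => //; exact: continuous_minr.
rewrite -!Rintegral_indic// -Rintegral_add//; apply: Rintegral_le => //.
  exact: bounded_measurableD.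
move=> x; rewrite !indicE; have [Ux|nUx] := pselect (U x); last first.
  by rewrite (memNset nUx) addr_ge0// le_min ler01 mulr_ge0.
rewrite (mem_set Ux); have [x1|x1] := ltP (n%:R * phi x) 1.
  by rewrite mem_set// lerDr mulr_ge0.
by rewrite lerDl.
Qed.

(* On [phi > 0] the functions [min 1 (n phi)] increase to [1]. *)
Lemma invariant_of_continuous (T : X -> X) : continuous T ->
  (forall f : X -> R, continuous f -> \int[mu]_x f (T x) = \int[mu]_x f x) ->
  invariant_measures T mu.
Proof.
move=> cT TI; have mT := continuous_borel_measurable cT.
have mTU (A : set (borel X)) : measurable A -> measurable (T @^-1` A : set (borel X)).
  by move=> mA; rewrite -[_ @^-1` _]setTI; exact: mT.
have openE (U : set X) : open U -> mu (T @^-1` U) = mu U.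
  move=> oU; have [phi [cphi phi01 phiU]] := open_cozero oU.
  have phi0 x : 0 <= phi x by have /andP[] := phi01 x.
  have mU := open_borel oU.
  have UE : U = [set x | 0 < phi x] by apply/seteqP; split=> x /=; apply phiU.
  have TUE : T @^-1` U = [set x | 0 < phi (T x)] by rewrite UE.
  have cphiT : continuous (phi \o T).
    by move=> x; apply: continuous_comp; [exact: cT|exact: cphi].
  have le1 n (nu : probability (borel X) R) (psi : X -> R) : continuous psi ->
     (forall x, 0 <= psi x) -> \int[nu]_x Num.min 1 (n%:R * psi x) <=
     fine (nu [set x | 0 < psi x]).
    move=> cpsi psi0; have mpsi : measurable ([set x | 0 < psi x] : set (borel X)).
      by apply: open_borel; apply: open_ltr => //; exact: continuous_cstr.
    rewrite -Rintegral_indic//; apply: Rintegral_le.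
    - apply: continuous_bounded_measurable => //; apply: continuous_minr.
        exact: continuous_cstr.
      by apply: continuous_mulr => //; exact: continuous_cstr.
    - exact: bounded_measurable_indic.
    - move=> x; rewrite indicE; have [px|px] := ltP 0 (psi x).
        by rewrite mem_set// ge_min lexx.
      have -> : psi x = 0 by apply/eqP; rewrite eq_le px psi0.
      by rewrite mulr0 ge_min ler0n orbT.
  have intE n : \int[mu]_x Num.min 1 (n%:R * phi (T x)) = \int[mu]_x Num.min 1 (n%:R * phi x).
    apply: (TI (fun x => Num.min 1 (n%:R * phi x))); apply: continuous_minr.
      exact: continuous_cstr.
    by apply: continuous_mulr => //; exact: continuous_cstr.
  apply/eqP; rewrite -[X in X == _]fineK ?fin_num_measure//; last exact: mTU.
  rewrite -[X in _ == X]fineK ?fin_num_measure// eqe eq_le.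
  apply/andP; split; apply/ler_addgt0Pr => e e0; rewrite -lerBlDr.
    rewrite TUE; have [N /(_ N (leqnn N)) h] := cozero_approx cphiT (fun x => phi0 (T x)) e0.
    by apply: le_trans h _; rewrite /= intE UE; exact: le1.
  rewrite UE; have [N /(_ N (leqnn N)) h] := cozero_approx cphi phi0 e0.
  apply: le_trans h _; rewrite -intE -UE TUE.
  exact: (le1 N mu (phi \o T) cphiT (fun x => phi0 (T x))).
pose P : {measure set (borel X) -> \bar R} := mu.
move=> A mA; apply: (@g_sigma_algebra_measure_unique _ R (borel X) (@open X) _ (fun=> setT)
  _ _ (pushforward P (T : borel X -> borel X)) P) => //.
- by move=> U oU; exact: open_borel.
- by move=> _; exact: openT.
- by apply/seteqP; split => // x _; exists 0%N.
- by move=> U V oU oV; exact: openI.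
- move=> _; apply: (@le_lt_trans _ _ 1%E); last exact: ltry.
  by apply: (probability_le1 mu); exact: mTU.
Qed.

End jordan_partition.

(** * Upper bound *)

Section misiurewicz.
Context {R : realType} {X : pointedMetricType R} (T : X -> X).

(** The integral of [f] against the mean of the empirical measures of the points of [C]. As a
    functional on all functions it accepts continuous functions and indicators of names alike. *)
Definition orbit_average (C : {fset X}) n (f : X -> R) : R :=
  #|` C|%:R^-1 * \sum_(x <- C) (n%:R^-1 * \sum_(i < n) f (iter i T x)).

(* Each residue [r] modulo [q] yields a cover of [0, n) by the windows of length
   [q] starting at the [i < q] and at the [i] congruent to [r]; summing over [r]
   uses every window starting at [i < n] once, up to [q * q] exceptions. *)
Lemma misiurewicz (C : {fset X}) (e : R) (n q k : nat) (A : 'I_k -> set (borel X))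
    (Apart : mpartition A) : (0 < n)%N -> (0 < q)%N -> (0 < #|` C|)%N ->
  Defs.separated T e n C ->
  (forall x y, label Apart x = label Apart y -> mdist x y < e) ->
  q%:R * ln #|` C|%:R <= (q * q)%:R * ln (k ^ q)%:R +
    n%:R * shannon (fun w => orbit_average C n \1_(name T Apart q @^-1` [set w])).
Proof.
move=> n0 q0 C0 sC Ae.
have n0r : 0 < n%:R :> R by rewrite ltr0n.
have C0r : 0 < #|` C|%:R :> R by rewrite ltr0n.
pose p (x : C) : R := #|` C|%:R^-1.
have p0 x : 0 <= p x by rewrite invr_ge0.
have p1 : \sum_x p x = 1.
  by rewrite sumr_const -cardfE -[_ *+ _]mulr_natl divff// gt_eqF.
pose f i (x : C) := name T Apart q (iter i T (val x)).
have Hid : shannon (law p id) = ln #|` C|%:R.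
  rewrite law_id /shannon (eq_bigr (fun x => p x * - ln #|` C|%:R)).
    by rewrite -mulr_suml p1 mul1r opprK.
  by move=> x _; rewrite /p lnV ?posrE.
pose H i := shannon (law p (f i)).
have H0 i : 0 <= H i.
  apply: shannon_ge0 => w; rewrite law_ge0//= -(sum_law1 p1 (f i)).
  by rewrite (bigD1 w)//= lerDl sumr_ge0// => w' _; exact: law_ge0.
have Hk i : H i <= ln (k ^ q)%:R.
  have := shannon_le_card (law_ge0 p0 (f i)) (sum_law1 p1 (f i)).
  by rewrite card_ffun !card_ord.
have Hr r : (r < q)%N ->
    ln #|` C|%:R <= q%:R * ln (k ^ q)%:R + \sum_(i < n | (i %% q)%N == r) H i.
  move=> rq; rewrite -Hid.
  pose s := iota 0 (minn q n) ++ [seq i <- iota 0 n | (i %% q)%N == r].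
  apply: le_trans (shannon_law_sum p0 p1 (s := s) (f := f) _) _.
    (* Equal names in all windows of [s] put the two orbits in the same cell, hence within [e], at
       each time [j < n]; separation then forces equality. So the windows determine the point, whose
       entropy is [ln #|C|]. *)
    move=> x y xy; apply/val_inj; apply: contrapT => nxy.
    apply: (sC (val x) (val y) (valP x) (valP y) nxy) => j jn.
    apply: Ae.
    have [jr|rj] := ltnP j r.
      have : j \in s by rewrite mem_cat mem_iota/= add0n leq_min jn (ltn_trans jr rq).
      move=> /xy/ffunP/(_ (Ordinal q0)); rewrite !ffunE/=.
      by move=> ->.
    (* The last time up to [j] that is congruent to [r]; its window may extend beyond [n] but has
       [j] among its [q] positions. Times [j < r] are read off the window that starts at [j]
       itself. *)
    pose i := (j - (j - r) %% q)%N.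
    have jrq : ((j - r) %% q < q)%N by rewrite ltn_mod.
    have ij : (i + (j - r) %% q = j)%N.
      by rewrite subnK//; apply: leq_trans (leq_mod _ _) (leq_subr _ _).
    have ir : (i %% q = r)%N.
      have -> : i = ((j - r) %/ q * q + r)%N.
        by have := divn_eq (j - r) q; rewrite /i; lia.
      by rewrite modnMDl modn_small.
    have : i \in s.
      rewrite mem_cat mem_filter mem_iota ir eqxx/= mem_iota !add0n; apply/orP; right.
      by apply: leq_ltn_trans jn; exact: leq_subr.
    move=> /xy/ffunP/(_ (Ordinal jrq)); rewrite !ffunE/= -!iterD addnC ij.
    by move=> ->.
  rewrite big_cat/=; apply: lerD.
    apply: (@le_trans _ _ (\sum_(i <- iota 0 (minn q n)) ln (k ^ q)%:R)).
      by apply: ler_sum => i _; exact: Hk.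
    rewrite big_const_seq count_predT size_iota iter_addr_0 -[_ *+ _]mulr_natl.
    rewrite ler_wpM2r ?ler_nat ?geq_minl//.
    exact: le_trans (H0 0%N) (Hk 0%N).
  rewrite big_filter (_ : iota 0 n = index_iota 0 n); last by rewrite /index_iota subn0.
  by rewrite big_mkord.
have : \sum_(r < q) ln #|` C|%:R <=
    \sum_(r < q) (q%:R * ln (k ^ q)%:R + \sum_(i < n | (i %% q)%N == r) H i).
  by apply: ler_sum => r _; apply: Hr.
rewrite big_split/= !sumr_const !card_ord -!(mulr_natl (_ * _)) -(mulr_natl (ln _)).
have -> : \sum_(r < q) \sum_(i < n | (i %% q)%N == r) H i = \sum_(i < n) H i.
  rewrite [RHS](partition_big (fun i : 'I_n => Ordinal (ltn_pmod i q0)) xpredT)//=.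
have Hsum : \sum_(i < n) H i <=
    n%:R * shannon (fun w => orbit_average C n \1_(name T Apart q @^-1` [set w])).
  have := @concave_shannon R 'I_n _ (fun i => law p (f i)).
  rewrite card_ord => /(_ n0 (fun i => law_ge0 p0 (f i)) (fun i => sum_law1 p1 (f i))).
  move=> /le_trans; apply; rewrite ler_pM2l//.
  suff -> : (fun w => n%:R^-1 * \sum_(i < n) law p (f i) w) =
    fun w => orbit_average C n \1_(name T Apart q @^-1` [set w]) by [].
  apply/funext => w; rewrite /orbit_average big_seq_fsetE/= -mulr_sumr mulrCA.
  congr (_ * _); rewrite exchange_big/= mulr_sumr; apply: eq_bigr => i _.
  rewrite /law mulr_sumr big_mkcond/=; apply: eq_bigr => x _.
  rewrite indicE; case: eqP => fxw; first by rewrite mem_set// mulr1.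
  by rewrite memNset ?mulr0.
by move=> h; apply: le_trans h _; rewrite mulrA -natrM lerD2l; exact: Hsum.
Qed.

End misiurewicz.

Lemma limr_ge_cvg {R : realType} (I : Type) (F : set_system I) (u : I -> R) (l c : R) :
  ProperFilter F -> u @ F --> l -> F [set i | c <= u i] -> c <= l.
Proof.
move=> FF ul cu; rewrite -(cvg_lim _ ul)//; apply: limr_ge => //.
by apply/cvg_ex; exists l.
Qed.

(** Upper semicontinuity of entropy: against a fixed strictly positive [q], a slight smoothing of
    the limit [p], the Gibbs bound is linear in [p_ i] and passes to the limit. *)
Lemma shannon_limit {R : realType} (I : Type) (F : set_system I) (W : finType)
    (p_ : I -> W -> R) (p : W -> R) (u : I -> R) (c : R) : ProperFilter F ->
  (forall i w, 0 <= p_ i w) -> (forall i, \sum_w p_ i w = 1) ->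
  (forall w, 0 <= p w) -> \sum_w p w = 1 ->
  (forall w, p_^~ w @ F --> p w) -> u @ F --> (0 : R) ->
  (forall i, c <= u i + shannon (p_ i)) -> c <= shannon p.
Proof.
move=> FF p_0 p_1 p0 p1 pp u0 cu; apply/ler_addgt0Pr => e e0.
(* The normalising constant [Z] of the smoothing then satisfies [ln Z <= #|W| dl <= e]. *)
pose dl := e / (#|W|%:R + 1).
have W1 : 0 < #|W|%:R + 1 :> R by rewrite ltr_wpDl.
have dl0 : 0 < dl by rewrite divr_gt0.
pose Z := 1 + #|W|%:R * dl.
have Z0 : 0 < Z by rewrite ltr_pwDl// mulr_ge0// ltW.
pose q w := (p w + dl) / Z.
have q0 w : 0 < q w by rewrite divr_gt0// ltr_wpDl.
have q1 : \sum_w q w = 1.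
  by rewrite -mulr_suml big_split/= p1 sumr_const -mulr_natl divff// gt_eqF.
have : (fun i => u i + - \sum_w p_ i w * ln (q w)) @ F --> 0 + - \sum_w p w * ln (q w).
  apply: cvgD => //; apply: cvgN.
  elim: (index_enum W) => [|w s IH].
    rewrite big_nil (_ : (fun _ => _) = fun=> 0); first exact: cvg_cst.
    by apply/funext => i; rewrite big_nil.
  rewrite big_cons (_ : (fun _ => _) =
      fun i => p_ i w * ln (q w) + \sum_(w <- s) p_ i w * ln (q w)).
    by apply: cvgD => //; apply: cvgMl; exact: pp.
  by apply/funext => i; rewrite big_cons.
move=> /limr_ge_cvg h.
have {}h : c <= 0 + - \sum_w p w * ln (q w).
  apply: h; apply: filterE => i; apply: le_trans (cu i) _; rewrite lerD2l; apply: gibbs => //.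
    by move=> w; exact: ltW.
  by rewrite q1 p_1.
apply: le_trans h _; rewrite add0r.
have lnZ : ln Z <= e.
  apply: le_trans (le_ln1Dx _) _; first by rewrite (lt_le_trans (ltrN10 _))// mulr_ge0// ltW.
  by rewrite /dl mulrCA ler_piMr ?(ltW e0)// ler_pdivrMr// mul1r lerDl.
apply: le_trans (lerD (lexx _) lnZ); rewrite /shannon -lerBlDr -opprD lerN2.
rewrite -[X in _ + X]mul1r -p1 mulr_suml -big_split/=; apply: ler_sum => w _.
rewrite -mulrDr; have [->|pw0] := eqVneq (p w) 0; first by rewrite !mul0r.
have pw : 0 < p w by rewrite lt_neqAle eq_sym pw0 p0.
apply: ler_wpM2l => //; have pd : 0 < p w + dl by rewrite addr_gt0.
rewrite /q ln_div; [|by rewrite posrE|by rewrite posrE].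
by rewrite subrK ler_ln ?posrE// lerDl ltW.
Qed.

Section orbit_averages.
Context {R : realType} {X : pointedMetricType R} (T : X -> X) (C : {fset X}) (n : nat).
Hypotheses (C0 : (0 < #|` C|)%N) (n0 : (0 < n)%N).
Implicit Types f g : X -> R.

Let Cn : #|` C|%:R != 0 :> R.
Proof. by rewrite pnatr_eq0 -lt0n. Qed.

Let nn : n%:R != 0 :> R.
Proof. by rewrite pnatr_eq0 -lt0n. Qed.

Lemma orbit_average_le f g : (forall x, f x <= g x) ->
  orbit_average T C n f <= orbit_average T C n g.
Proof.
move=> fg; rewrite ler_wpM2l ?invr_ge0//; apply: ler_sum => x _.
by rewrite ler_wpM2l ?invr_ge0//; apply: ler_sum.
Qed.

Lemma orbit_averageD f g : orbit_average T C n (fun x => f x + g x) =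
  orbit_average T C n f + orbit_average T C n g.
Proof.
rewrite /orbit_average -mulrDr -big_split/=; congr (_ * _); apply: eq_bigr => x _.
by rewrite -mulrDr -big_split.
Qed.

Lemma orbit_averageZ c f : orbit_average T C n (fun x => c * f x) =
  c * orbit_average T C n f.
Proof.
rewrite /orbit_average [RHS]mulrCA; congr (_ * _); rewrite mulr_sumr.
by apply: eq_bigr => x _; rewrite [RHS]mulrCA [c * _]mulr_sumr.
Qed.

Lemma orbit_average_cst c : orbit_average T C n (fun=> c) = c.
Proof.
rewrite /orbit_average (eq_bigr (fun=> c)); last first.
  by move=> x _; rewrite sumr_const card_ord -[c *+ n]mulr_natl mulKf.
rewrite big_const_seq count_predT iter_addr_0 -[c *+ _]mulr_natl mulKf//.
Qed.

Lemma orbit_average_sum (I : Type) (s : seq I) (F : I -> X -> R) :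
  orbit_average T C n (fun x => \sum_(i <- s) F i x) =
  \sum_(i <- s) orbit_average T C n (F i).
Proof.
elim: s => [|i s IH].
  rewrite big_nil -[RHS](orbit_average_cst 0); congr orbit_average.
  by apply/funext => x; rewrite big_nil.
rewrite big_cons -IH -orbit_averageD; congr orbit_average.
by apply/funext => x; rewrite big_cons.
Qed.

Lemma orbit_average_ge0 f : (forall x, 0 <= f x) -> 0 <= orbit_average T C n f.
Proof. by move=> f0; rewrite -(orbit_average_cst 0); exact: orbit_average_le. Qed.

Lemma orbit_average_shift f (M : R) : (forall x, `|f x| <= M) ->
  `|orbit_average T C n (fun x => f (T x)) - orbit_average T C n f| <= 2 * M / n%:R.
Proof.
move=> fM; rewrite /orbit_average -mulrBr -sumrB normrM ger0_norm ?invr_ge0//.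
rewrite ler_pdivrMl ?ltr0n//; apply: le_trans (ler_norm_sum _ _ _) _.
apply: (@le_trans _ _ (\sum_(x <- C) (2 * M / n%:R))); last first.
  by rewrite big_const_seq count_predT iter_addr_0 -[_ *+ _]mulr_natl.
apply: ler_sum => x _; rewrite -mulrBr normrM ger0_norm ?invr_ge0// mulrC.
rewrite ler_wpM2r ?invr_ge0// -sumrB.
rewrite (eq_bigr (fun i : 'I_n => f (iter i.+1 T x) - f (iter i T x)))//.
rewrite -(big_mkord xpredT (fun i => f (iter i.+1 T x) - f (iter i T x))) telescope_sumr//.
by rewrite mulr_natl mulr2n (le_trans (ler_normB _ _))// lerD.
Qed.

(** Convexity of the basic neighbourhoods: a bound for each empirical measure passes to their
    mean. *)
Lemma orbit_average_empirical f (c r : R) : compact [set: X] -> continuous f ->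
  (forall x, x \in C -> `|\int[empirical T n x]_y f y - c| <= r) ->
  `|orbit_average T C n f - c| <= r.
Proof.
move=> cX cf fC; have bf : bounded_measurable (f : borel X -> R).
  exact: continuous_bounded_measurable.
have -> : orbit_average T C n f - c =
    #|` C|%:R^-1 * \sum_(x <- C) (\int[empirical T n x]_y f y - c).
  rewrite sumrB mulrBr big_const_seq count_predT iter_addr_0 -[c *+ _]mulr_natl mulKf//.
  congr (_ * _ - _); apply: eq_bigr => x _; by rewrite empirical_integral.
rewrite normrM ger0_norm ?invr_ge0// ler_pdivrMl ?ltr0n//.
apply: le_trans (ler_norm_sum _ _ _) _.
apply: (@le_trans _ _ (\sum_(x <- C) r)); last first.
  by rewrite big_const_seq count_predT iter_addr_0 -[_ *+ _]mulr_natl.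
by rewrite big_seq [leRHS]big_seq; apply: ler_sum.
Qed.

End orbit_averages.

Section jordan_limits.
Context {R : realType} {X : pointedMetricType R}.
Hypothesis cX : compact [set: X].

(** The portmanteau argument for functionals: monotonicity on all functions squeezes the value at
    the indicator between values at continuous functions. *)
Lemma jordan_cvg (mu : probability (borel X) R) (I : Type) (F : set_system I)
    (L : I -> (X -> R) -> R) (A : set X) : ProperFilter F ->
  (forall i f g, (forall x, f x <= g x) -> L i f <= L i g) ->
  (forall f, continuous f -> L^~ f @ F --> (\int[mu]_x f x : R)) ->
  jordan mu A -> L^~ (\1_A : X -> R) @ F --> fine (mu A).
Proof.
move=> FF Lle Lmu [mA jA]; apply/cvgrPdist_le => e e0.
have e2 : 0 < e / 2 by rewrite divr_gt0.
have [f [g [cf cg fA gA fg]]] := jA _ e2.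
have /cvgrPdist_le/(_ _ e2) Lf := Lmu f cf.
have /cvgrPdist_le/(_ _ e2) Lg := Lmu g cg.
have bI := bounded_measurable_indic (R := R) mA.
have bf := continuous_bounded_measurable cX cf.
have bg := continuous_bounded_measurable cX cg.
have fmu : \int[mu]_x f x <= fine (mu A).
  by rewrite -Rintegral_indic//; apply: Rintegral_le => // x; have /andP[] := fA x.
have gmu : fine (mu A) <= \int[mu]_x g x.
  by rewrite -Rintegral_indic//; apply: Rintegral_le => // x; have /andP[] := gA x.
apply: filterS (filterI Lf Lg) => i [].
have : L i f <= L i \1_A by apply: Lle => x; have /andP[] := fA x.
have : L i \1_A <= L i g by apply: Lle => x; have /andP[] := gA x.
by rewrite !ler_norml; lra.
Qed.

End jordan_limits.

Section upper_bound.
Context {R : realType} {X : pointedMetricType R} (T : X -> X).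
Variable E : probability (borel X) R -> R.
Hypotheses (cX : compact [set: X]) (cT : continuous T) (cE : energy E).
Local Notation prob := (probability (borel X) R).

Lemma growth_frequently (eps a : R) N : (a%:E < limn_esup (growth T E eps))%E ->
  exists2 n, (N <= n)%N & (a%:E < growth T E eps n)%E.
Proof.
move=> ag; apply: contrapT => nN; move: ag; rewrite ltNge => /negP; apply.
apply: ge_ereal_inf; exists (ereal_sup (growth T E eps @` [set n | (N <= n)%N])).
  by exists [set n | (N <= n)%N] => //; exists N.
apply: ge_ereal_sup => _ [n /= Nn <-]; rewrite leNgt; apply/negP => an.
by apply: nN; exists n.
Qed.

Lemma growth_gt_weight (eps a : R) n : (0 < n)%N -> (a%:E < growth T E eps n)%E ->
  exists2 C, Defs.separated T eps n C & expR (n%:R * a) < weight T E n C.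
Proof.
move=> n0 an; have n0r : 0 < n%:R :> R by rewrite ltr0n.
have : ((expR (n%:R * a))%:E < zeta T E eps n)%E.
  rewrite ltNge; apply/negP => ze; move: an; rewrite ltNge => /negP; apply.
  have -> : a%:E = ((n%:R^-1)%:E * lne (expR (n%:R * a))%:E)%E.
    by rewrite lne_EFin ?expR_gt0// expRK -EFinM mulKf// gt_eqF.
  apply: lee_wpmul2l; first by rewrite lee_fin invr_ge0.
  have z0 : (0 <= zeta T E eps n)%E.
    by apply: ereal_sup_ubound; exists fset0 => //; rewrite /weight big_seq_fset0.
  by rewrite lee_lne ?in_itv/= ?z0 ?leey// lee_fin expR_ge0.
by move=> /ereal_sup_gt[_ [C sC <-]]; rewrite lte_fin; exists C.
Qed.

Definition clustered (nu : prob) (fs : seq (X -> R)) (r eps b : R) n (C : {fset X}) :=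
  [/\ Defs.separated T eps n C, (0 < #|` C|)%N,
    forall x, x \in C -> weak_basic nu fs r (empirical T n x) &
    n%:R * b <= ln #|` C|%:R].

(** The points of [C] near [nu] weigh at most [exp (n (E nu + eta))] each. Were they fewer than
    [exp (n (a - E nu - 2 eta))] for every [nu] of the cover, the total weight would be at most
    [size s] times [exp (n (a - eta))]. One [eta] is the oscillation of the energy, the other
    absorbs [size s]. *)
Lemma weight_pigeonhole (eps a eta : R) (s : seq prob)
    (fs : prob -> seq (X -> R)) (r : prob -> R) n (C : {fset X}) :
  (0 < n)%N -> Defs.separated T eps n C -> expR (n%:R * a) < weight T E n C ->
  (forall nu mu, weak_basic nu (fs nu) (r nu) mu -> `|E nu - E mu| < eta) ->
  (forall mu, exists2 nu, nu \in s & weak_basic nu (fs nu) (r nu) mu) ->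
  (ln (size s)%:R <= n%:R * eta) ->
  exists2 nu, nu \in s & exists C', clustered nu (fs nu) (r nu) eps (a - E nu - 2 * eta) n C'.
Proof.
move=> n0 sC wC sE scov slog; apply: contrapT => ns.
pose D nu := [fset x in C | `[< weak_basic nu (fs nu) (r nu) (empirical T n x) >]]%fset.
have DP nu x : (x \in D nu) = (x \in C) && `[< weak_basic nu (fs nu) (r nu) (empirical T n x) >].
  by rewrite !inE.
have DC nu : nu \in s -> #|` D nu|%:R <= expR (n%:R * (a - E nu - 2 * eta)).
  move=> nus; rewrite leNgt; apply/negP => nD; apply: ns; exists nu => //; exists (D nu).
  have D0 : 0 < #|` D nu|%:R :> R by apply: le_lt_trans nD; exact: expR_ge0.
  split.
  - by move=> x x'; rewrite !DP => /andP[xC _] /andP[x'C _]; exact: sC.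
  - by rewrite -(ltr0n R).
  - by move=> x; rewrite DP => /andP[_ /asboolP].
  - by rewrite -[leLHS]expRK ler_ln ?posrE ?expR_gt0// ltW.
have [nu0 nu0s _] := scov (empirical T n point).
have s0 : 0 < (size s)%:R :> R by rewrite ltr0n; case: (s) nu0s.
suff : weight T E n C <= expR (n%:R * a) by rewrite leNgt wC.
apply: (@le_trans _ _ (\sum_(nu <- s) #|` D nu|%:R * expR (n%:R * (E nu + eta)))).
  apply: (@le_trans _ _ (\sum_(x <- C) \sum_(nu <- s)
      (if x \in D nu then expR (n%:R * (E nu + eta)) else 0))).
    rewrite /weight big_seq [leRHS]big_seq; apply: ler_sum => x xC.
    have [nu nus nux] := scov (empirical T n x).
    rewrite (big_rem nu)//= DP xC asboolT//= ler_wpDr//.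
      by apply: sumr_ge0 => v _; case: ifP => _ //; exact: expR_ge0.
    rewrite ler_expR ler_wpM2l//; have := sE _ _ nux; rewrite ltr_norml; lra.
  rewrite exchange_big/=; apply: ler_sum => nu _.
  rewrite -big_mkcond/= big_const_seq iter_addr_0 -[X in X <= _]mulr_natl.
  rewrite ler_wpM2r ?expR_ge0// ler_nat -size_filter.
  apply: uniq_leq_size; first by apply: filter_uniq; exact: fset_uniq.
  by move=> x; rewrite mem_filter => /andP[].
apply: (@le_trans _ _ (\sum_(nu <- s) expR (n%:R * (a - eta)))).
  rewrite big_seq [leRHS]big_seq; apply: ler_sum => nu nus.
  have -> : n%:R * (a - eta) = n%:R * (a - E nu - 2 * eta) + n%:R * (E nu + eta).
    by rewrite -mulrDr; congr (_ * _); lra.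
  by rewrite expRD ler_wpM2r ?expR_ge0// DC.
rewrite big_const_seq count_predT iter_addr_0 -[X in X <= _]mulr_natl.
rewrite -[X in X * _](@lnK R) ?posrE// -expRD ler_expR mulrBr; lra.
Qed.

Lemma eventually_cst_le (c e : R) : 0 < e -> exists N, forall n, (N <= n)%N -> c <= n%:R * e.
Proof.
move=> e0; exists (Num.truncn (c / e)).+1 => n nN.
rewrite -ler_pdivrMr//; apply: le_trans (ltW (truncnS_gt _)) _.
by rewrite ler_nat.
Qed.

(** A second pigeonhole: the [nu] given by [weight_pigeonhole] depends on [n], but it ranges over a
    finite cover, so one of them serves arbitrarily large [n]. *)
Lemma clustered_sequence (eps a eta : R) : (a%:E < limn_esup (growth T E eps))%E -> 0 < eta ->
  exists nu fs r, [/\ forall f, List.In f fs -> continuous f,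
    forall mu, weak_basic nu fs r mu -> `|E nu - E mu| < eta &
    forall N, exists n C, (N < n)%N /\ clustered nu fs r eps (a - E nu - 2 * eta) n C].
Proof.
move=> ag eta0.
have /choice[fs /choice[r frP]] := fun nu => energy_weak_basic cE nu eta0.
have cfs nu f : List.In f (fs nu) -> continuous f by have [_ + _] := frP nu; apply.
have fE nu mu : weak_basic nu (fs nu) (r nu) mu -> `|E nu - E mu| < eta.
  by have [_ _] := frP nu; apply.
have [s sP] : exists s : seq prob, forall mu, exists2 nu, nu \in s & weak_basic nu (fs nu) (r nu) mu.
  apply: (@compact_nbhs_cover (weak_prob X) (fun nu => weak_basic nu (fs nu) (r nu))).
    exact: weak_prob_compact.
  move=> nu; apply: nbhs_weak_basic; first by have [] := frP nu.
  exact: cfs.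
have [N0 HN0] := eventually_cst_le (ln (size s)%:R) eta0.
have step N : exists2 nu, nu \in s &
    exists n C, (N < n)%N /\ clustered nu (fs nu) (r nu) eps (a - E nu - 2 * eta) n C.
  have [n nN an] := growth_frequently (maxn N.+1 N0) ag.
  have [nN1 nN0] : (N < n)%N /\ (N0 <= n)%N by move: nN; rewrite geq_max => /andP.
  have n0 : (0 < n)%N by apply: leq_ltn_trans nN1.
  have [C sC wC] := growth_gt_weight n0 an.
  have [nu nus [C' HC']] := weight_pigeonhole n0 sC wC fE sP (HN0 _ nN0).
  by exists nu => //; exists n, C'.
suff [nu _ nuP] : exists2 nu, nu \in s & forall N, exists n C, (N < n)%N /\
    clustered nu (fs nu) (r nu) eps (a - E nu - 2 * eta) n C.
  by exists nu, (fs nu), (r nu); split=> //; [exact: cfs|exact: fE].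
apply: contrapT => nnu.
have /choice[M MP] : forall nu, exists M, nu \in s -> forall n C, (M < n)%N ->
    ~ clustered nu (fs nu) (r nu) eps (a - E nu - 2 * eta) n C.
  move=> nu; have [nus|] := boolP (nu \in s); last by exists 0%N.
  apply: contrapT => nM; apply: nnu; exists nu => // N; apply: contrapT => nC.
  by apply: nM; exists N => _ n C Nn Cc; apply: nC; exists n, C.
have [nu nus [n [C [Mn HC]]]] := step (\max_(nu <- s) M nu)%N.
apply: (MP nu nus n C _ HC); apply: leq_ltn_trans Mn.
exact: leq_bigmax_seq.
Qed.

(** Of the [3 * eta], two are lost in [weight_pigeonhole] and one in comparing [E nu] with
    [E mu]. *)
Lemma upper_bound (eps a eta : R) : 0 < eps ->
  (a%:E < limn_esup (growth T E eps))%E -> 0 < eta ->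
  exists (mu : prob) k (A : 'I_k -> set (borel X)), [/\ invariant_measures T mu,
    mpartition A & a - 3 * eta <= partition_entropy T mu A + E mu].
Proof.
move=> eps0 ag eta0.
have [nu [fs [r [cfs fE seqP]]]] := clustered_sequence ag eta0.
have /choice[n /choice[C HC]] := seqP.
have n_gt j : (j < n j)%N by have [] := HC j.
have n0 j : (0 < n j)%N by apply: leq_ltn_trans (n_gt j).
have C0 j : (0 < #|` C j|)%N by have [_ []] := HC j.
(* Finer than the filter at infinity, so that the errors of order [1 / n j] still tend to [0]. *)
have [F [FU Foo]] := @ultraFilterLemma nat \oo _.
have FF : ProperFilter F by exact: ultra_proper.
pose L j := @orbit_average R X T (C j) (n j).
have inv0 (c : R) : (fun j => c / (n j)%:R) @ F --> (0 : R).
  apply: (@cvg_trans _ ((fun j => c / (n j)%:R) @ \oo)).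
    by move=> B; apply: Foo.
  apply/cvgrPdist_le => e e0; have [N HN] := eventually_cst_le `|c| e0.
  exists N => // j /= Nj; rewrite sub0r normrN normrM normfV normr_nat.
  rewrite ler_pdivrMr ?ltr0n// [leRHS]mulrC; apply: HN; exact: leq_trans Nj (ltnW (n_gt j)).
have [||||mu muL] := @riesz_ultralimit R X nat F L cX FU.
- by move=> j f _; exact: orbit_average_ge0.
- by move=> j f g _ _; exact: orbit_averageD.
- by move=> j c f _; exact: orbit_averageZ.
- by move=> j; exact: orbit_average_cst.
have cT' (f : X -> R) : continuous f -> continuous (fun x => f (T x)).
  by move=> cf x; apply: continuous_comp; [exact: cT|exact: cf].
have muT : invariant_measures T mu.
  apply: invariant_of_continuous => // f cf.
  have [M fM] := continuous_compact_bounded cX cf.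
  have h : (fun j => L j (fun x => f (T x)) - L j f) @ F --> (0 : R).
    apply/cvgrPdist_le => e e0.
    have /cvgrPdist_le/(_ _ e0) := inv0 (2 * M).
    apply: filterS => j; rewrite !sub0r !normrN.
    move=> /(le_trans (ler_norm _)) h1; apply: le_trans h1.
    exact: (orbit_average_shift T _ (C0 j) fM).
  have h2 : (fun j => L j (fun x => f (T x)) - L j f) @ F -->
      (\int[mu]_x f (T x) - \int[mu]_x f x : R).
    by apply: cvgB; apply: muL => //; exact: cT'.
  apply/eqP; rewrite -subr_eq0; apply/eqP.
  by rewrite -(cvg_lim _ h2)// (cvg_lim _ h).
have muE : `|E nu - E mu| < eta.
  apply: fE => f ffs; have cf := cfs f ffs.
  have h : (fun j => r - `|L j f - \int[nu]_x f x|) @ F -->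
      (r - `|\int[mu]_x f x - \int[nu]_x f x| : R).
    apply: cvgB; first exact: cvg_cst.
    apply: cvg_norm; apply: cvgB; [exact: muL|exact: cvg_cst].
  have : 0 <= r - `|\int[mu]_x f x - \int[nu]_x f x|.
    apply: (limr_ge_cvg FF h); apply: filterE => j; rewrite /= subr_ge0.
    apply: orbit_average_empirical => // x xC.
    by have [_ [_ _ /(_ x xC)/(_ f ffs)]] := HC j.
  by rewrite subr_ge0.
have [k [A [Apart [jA Ae]]]] := jordan_partition cX mu eps0.
exists mu, k, A; split=> //.
suff : a - E nu - 2 * eta <= partition_entropy T mu A by move: muE; rewrite ltr_norml; lra.
set b := a - E nu - 2 * eta.
have mT := continuous_borel_measurable cT.
(* The window length [q] is fixed while [n j] grows, and the error [c0 / n j] of [misiurewicz]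
   vanishes; only afterwards does [q] tend to infinity. *)
have bq q : (0 < q)%N -> b <= q%:R^-1 * join_entropy T mu A q.
  move=> q0; have q0r : 0 < q%:R :> R by rewrite ltr0n.
  rewrite ler_pdivlMl// (join_entropyE _ Apart).
  have mN := @measurable_name _ _ _ mT _ _ Apart q.
  pose p_ j w := L j (\1_(name T Apart q @^-1` [set w]) : X -> R).
  pose c0 := (q * q)%:R * ln (k ^ q)%:R : R.
  apply: (@shannon_limit R nat F _ p_ _ (fun j => c0 / (n j)%:R)) => //.
  - by move=> j w; apply: orbit_average_ge0 => // x; rewrite indicE.
  - move=> j; rewrite /p_ /L -orbit_average_sum//.
    rewrite -[RHS](orbit_average_cst T (C0 j) (n0 j) 1); congr orbit_average.
    apply/funext => x; rewrite (bigD1 (name T Apart q x))//= big1 ?addr0.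
      by rewrite indicE mem_set.
    by move=> w wN; rewrite indicE memNset//= => Nw; rewrite Nw eqxx in wN.
  - by move=> w; exact: distr_ge0.
  - exact: sum_distr.
  - move=> w.
    apply: (@jordan_cvg _ _ cX mu nat F L) => //.
      by move=> j f g; exact: orbit_average_le.
    rewrite -join_atomE; apply: jordan_bigcap => // i.
    exact: jordan_iter.
  - move=> j; have [_ [sC _ _ bC]] := HC j.
    have n0r : 0 < (n j)%:R :> R by rewrite ltr0n.
    have := @misiurewicz R X T (C j) eps (n j) q k A Apart (n0 j) q0 (C0 j) sC Ae.
    rewrite -/c0 -/(p_ j) => h.
    rewrite /= -(ler_pM2l n0r) [leRHS]mulrDr [_ * (c0 / _)]mulrC divfK ?gt_eqF//.
    by apply: le_trans h; rewrite mulrCA ler_pM2l.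
apply: (limr_ge_cvg _ (cvg_partition_entropy mT Apart muT)).
by exists 1%N => // q /= q1; exact: bq.
Qed.

End upper_bound.

(** * Limits of the growth rates *)

Section ereal_limits.
Context {R : realType}.
Implicit Types (u v : (\bar R)^nat) (x y : \bar R).

Lemma lee_of_lt_reals x y : (forall a : R, (a%:E < x)%E -> (a%:E <= y)%E) -> (x <= y)%E.
Proof.
move=> xy; case: x xy => [r| |] xy.
- apply/lee_subgt0Pr => e e0; rewrite -EFinB; apply: xy.
  by rewrite lte_fin ltrBlDr ltrDl.
- case: y xy => [s| |] // xy; last by have := xy 0 (ltry _).
  by have := xy (s + 1) (ltry _); rewrite lee_fin gerDl ler10.
- exact: leNye.
Qed.

Lemma limn_esup_le_near u x : (exists N, forall n, (N <= n)%N -> (u n <= x)%E) ->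
  (limn_esup u <= x)%E.
Proof.
move=> [N uN]; apply: ge_ereal_inf; exists (ereal_sup (u @` [set n | (N <= n)%N])).
  by exists [set n | (N <= n)%N] => //; exists N.
by apply: ge_ereal_sup => _ [n /= Nn <-]; exact: uN.
Qed.

Lemma limn_einf_ge_near u x : (exists N, forall n, (N <= n)%N -> (x <= u n)%E) ->
  (x <= limn_einf u)%E.
Proof.
move=> [N uN]; rewrite leeNr; apply: limn_esup_le_near; exists N => n /uN.
by rewrite leeN2.
Qed.

Lemma le_limn_esup u v : (forall n, (u n <= v n)%E) -> (limn_esup u <= limn_esup v)%E.
Proof.
move=> uv; apply: le_ereal_inf_tmp => _ [V FV <-]; apply: ge_ereal_inf.
exists (ereal_sup (u @` V)); first by exists V.
apply: ge_ereal_sup => _ [n Vn <-]; apply: le_trans (uv n) _.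
by apply: ereal_sup_ubound; exists n.
Qed.

Lemma le_limn_einf u v : (forall n, (u n <= v n)%E) -> (limn_einf u <= limn_einf v)%E.
Proof. by move=> uv; rewrite leeN2; apply: le_limn_esup => n; rewrite leeN2. Qed.

Lemma cvg_limn_esup_einf u x : (limn_esup u <= x)%E -> (x <= limn_einf u)%E ->
  u @ \oo --> x.
Proof.
move=> ux xu; have eu : limn_esup u = x.
  by apply/eqP; rewrite eq_le ux (le_trans xu)// limn_einf_sup.
have iu : limn_einf u = x.
  by apply/eqP; rewrite eq_le xu andbT -eu limn_einf_sup.
apply: (@squeeze_cvge _ _ _ R (einfs u) u (esups u)).
- apply: nearW => n; apply/andP; split.
    by apply: ereal_inf_lbound; exists n => //=.
  by apply: ereal_sup_ubound; exists n => //=.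
- by rewrite -iu limn_einf_lim; exact: is_cvg_einfs.
- by rewrite -eu limn_esup_lim; exact: is_cvg_esups.
Qed.

Variable G : R -> \bar R.
Hypothesis G_noninc : forall e e', e <= e' -> (G e' <= G e)%E.
Hypothesis G_cvg : cvg (G e @[e --> 0^'+]).

(** Monotonicity in the scale makes the limit at [0] a supremum over positive scales; this is the
    upper-bound half. *)
Lemma lim_at_right0_ge e : 0 < e -> (G e <= lim (G e @[e --> 0^'+]))%E.
Proof.
move=> e0; apply: lime_ge => //; near=> d; apply: G_noninc.
by near: d; exact: nbhs_right_le.
Unshelve. all: by end_near. Qed.

Lemma lim_at_right0_le x : (forall e, 0 < e -> (G e <= x)%E) ->
  (lim (G e @[e --> 0^'+]) <= x)%E.
Proof.
move=> Gx; apply: lime_le => //; near=> d; apply: Gx.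
by near: d; exact: nbhs_right_gt.
Unshelve. all: by end_near. Qed.

End ereal_limits.

(** * Uniform expansivity *)

Section expansive_window.
Context {R : realType} {X : pointedMetricType R}.

Lemma mdist_continuous2 (Z : topologicalType) (f g : Z -> X) :
  continuous f -> continuous g -> continuous (fun z => mdist (f z) (g z)).
Proof.
move=> cf cg z; apply/cvgrPdist_lt => e e0; have e2 : 0 < e / 2 by rewrite divr_gt0.
have nf : \forall t \near z, mdist (f z) (f t) < e / 2.
  have := cf z _ (nbhsx_ballx (f z) _ e2); rewrite ballEmdist; exact.
have ng : \forall t \near z, mdist (g z) (g t) < e / 2.
  have := cg z _ (nbhsx_ballx (g z) _ e2); rewrite ballEmdist; exact.
near=> t.
have ft : mdist (f z) (f t) < e / 2 by near: t.
have gt : mdist (g z) (g t) < e / 2 by near: t.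
have := metric_triangle (f z) (f t) (g z); have := metric_triangle (f t) (g t) (g z).
have := metric_triangle (f t) (f z) (g t); have := metric_triangle (f z) (g z) (g t).
rewrite [mdist (f t) (f z)]metric_sym [mdist (g t) (g z)]metric_sym.
by rewrite ltr_norml; lra.
Unshelve. all: by end_near. Qed.

Lemma continuous_iter (T : X -> X) n : continuous T -> continuous (iter n T).
Proof.
move=> cT; elim: n => [|n IH]; first by move=> x; exact: cvg_id.
by move=> x; apply: continuous_comp; [exact: IH|exact: cT].
Qed.

(** The pairs that are [eps]-close, or further than [eps0] apart at some time between [-m] and [m],
    form an open set [W m] that increases with [m]. Expansivity says that these sets cover the
    compact square, so a single [m] suffices. *)
Lemma expansive_window (T : X -> X) (eps0 eps : R) : compact [set: X] ->
  expansive_homeo T eps0 -> 0 < eps ->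
  exists m, forall n x y, (forall i, (i < n)%N -> mdist (iter i T x) (iter i T y) < eps0) ->
    forall i, (m <= i)%N -> (i + m < n)%N -> mdist (iter i T x) (iter i T y) < eps.
Proof.
move=> cX [S [cT cS TS ST Texp]] eps_gt0.
pose D (U : X -> X) j (z : X * X) := mdist (iter j U z.1) (iter j U z.2).
have cD U j : continuous U -> continuous (D U j).
  move=> cU; apply: mdist_continuous2 => z.
    by apply: continuous_comp; [exact: cvg_fst|exact: continuous_iter].
  by apply: continuous_comp; [exact: cvg_snd|exact: continuous_iter].
pose W m : set (X * X) := [set z | D T 0%N z < eps] `|`
  \bigcup_(j in [set j | (j <= m)%N]) ([set z | eps0 < D T j z] `|` [set z | eps0 < D S j z]).
have cc (c : R) : continuous (fun _ : X * X => c) by exact: continuous_cstr.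
have cXX : compact [set: X * X].
  by rewrite -setXTT; exact: compact_setX.
have [|||m mW] := @compact_nondecreasing_cover (X * X)%type W cXX.
- move=> m; apply: openU; first by apply: open_ltr => //; exact: cD.
  by apply: bigcup_open => j _; apply: openU; apply: open_ltr => //; exact: cD.
- move=> m n mn z [zeps|[j /= jm zj]]; [by left|right].
  by exists j => //=; exact: leq_trans mn.
- move=> z; apply: contrapT => /forallNP nW.
  have Tle j : D T j z <= eps0.
    by rewrite leNgt; apply/negP => jz; apply: (nW j); right; exists j => //=; left.
  have Sle j : D S j z <= eps0.
    by rewrite leNgt; apply/negP => jz; apply: (nW j); right; exists j => //=; right.
  have z12 : z.1 = z.2.
    apply: Texp; apply: ge_ereal_sup => _ [[j|j] _ <-]; rewrite lee_fin.
      exact: Tle.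
    exact: (Sle j.+1).
  by apply: (nW 0%N); left; rewrite /D/= z12 mdistxx.
exists m => n x y xy i mi imn.
(* Times [-j] relative to [i] are the times [i - j] of the same forward orbit, which exist because
   [j <= m <= i]. *)
have iterTS j k z : iter j S (iter (k + j) T z) = iter k T z.
  elim: j => [|j IH]; first by rewrite addn0.
  by rewrite addnS iterSr/= TS IH.
have [|[j /= jm]] := mW (iter i T x, iter i T y); first by [].
rewrite /D/= => -[].
  rewrite -!iterD => h; exfalso; move: h; apply/negP; rewrite -leNgt ltW//; apply: xy.
  by apply: leq_ltn_trans imn; rewrite addnC leq_add2l.
rewrite -(subnK (leq_trans jm mi)) !iterTS => h.
exfalso; move: h; apply/negP; rewrite -leNgt ltW//; apply: xy.
apply: leq_ltn_trans imn; apply: leq_trans (leq_subr _ _) (leq_addr _ _).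
Qed.

End expansive_window.

(** * Comparison of the pressures *)

Section pressure_bounds.
Context {R : realType} {X : pointedMetricType R} (T : X -> X).
Variable E : probability (borel X) R -> R.
Hypotheses (cX : compact [set: X]) (cT : continuous T) (cE : energy E).
Local Notation prob := (probability (borel X) R).

Lemma pressure_le (nu : prob) (c : \bar R) :
  (forall k (A : 'I_k -> set (borel X)) eta, mpartition A -> 0 < eta ->
    ((partition_entropy T nu A + E nu - eta)%:E <= c)%E) ->
  (pressure T E nu <= c)%E.
Proof.
move=> pc; rewrite /pressure -leeBrDr//; apply: ge_ereal_sup => _ [k [A Apart ->]].
rewrite leeBrDr// -EFinD; apply/lee_subgt0Pr => e e0; rewrite -EFinB.
exact: pc.
Qed.

Lemma partition_le_pressure (mu : prob) k (A : 'I_k -> set (borel X)) :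
  mpartition A -> ((partition_entropy T mu A + E mu)%:E <= pressure T E mu)%E.
Proof.
move=> Apart; rewrite EFinD leeD2r//; apply: ereal_sup_ubound.
by exists k, A.
Qed.

(** The two cases of [ergodic_abundance] match the two ways to approach a pressure from below: by
    all reals if it is infinite, by subtracting [e] otherwise. *)
Lemma abundance_le (c : \bar R) : ergodic_abundance T E ->
  (forall nu, ergodic_measures T nu -> (pressure T E nu <= c)%E) ->
  forall mu, invariant_measures T mu -> (pressure T E mu <= c)%E.
Proof.
move=> abT ergc mu muT; have := abT mu muT; case: eqP => [muoo|muoo] H.
  rewrite muoo; apply: lee_of_lt_reals => a _; have [nu nuerg anu] := H a.
  exact: le_trans (ltW anu) (ergc nu nuerg).
apply/lee_subgt0Pr => e e0; have [nu nuerg anu] := H e e0.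
exact: le_trans (ltW anu) (ergc nu nuerg).
Qed.

Lemma pressure_le_growth (nu : prob) (e0 : R) : ergodic_measures T nu -> 0 < e0 ->
  (forall eps, 0 < eps -> exists m, forall n x y,
    (forall i, (i < n)%N -> mdist (iter i T x) (iter i T y) < e0) ->
    forall i, (m <= i)%N -> (i + m < n)%N -> mdist (iter i T x) (iter i T y) < eps) ->
  (pressure T E nu <= limn_einf (growth T E e0))%E.
Proof.
move=> nuerg e00 win; apply: pressure_le => k A eta Apart eta0.
apply: limn_einf_ge_near; have [eps eps0 low] := lower_bound cX cT cE nuerg Apart eta0.
by have [m mwin] := win eps eps0; exact: low mwin.
Qed.

Lemma growth_limn_einf_noninc e e' : e <= e' ->
  (limn_einf (growth T E e') <= limn_einf (growth T E e))%E.
Proof. by move=> ee'; apply: le_limn_einf => n; exact: growth_nonincreasing. Qed.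

Lemma growth_limn_esup_noninc e e' : e <= e' ->
  (limn_esup (growth T E e') <= limn_esup (growth T E e))%E.
Proof. by move=> ee'; apply: le_limn_esup => n; exact: growth_nonincreasing. Qed.

Lemma pressure_le_lower (nu : prob) : ergodic_measures T nu ->
  (pressure T E nu <= lower_top_pressure T E)%E.
Proof.
move=> nuerg; apply: pressure_le => k A eta Apart eta0.
have [eps eps0 low] := lower_bound cX cT cE nuerg Apart eta0.
apply: (@le_trans _ _ (limn_einf (growth T E eps))).
  by apply: limn_einf_ge_near; apply: (low eps 0%N) => // n x y xy i _; rewrite addn0; exact: xy.
apply: (lim_at_right0_ge growth_limn_einf_noninc) => //.
exact: is_cvg_lower_top_pressure.
Qed.

Lemma top_pressure_le (c : \bar R) :
  (forall mu, invariant_measures T mu -> (pressure T E mu <= c)%E) ->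
  (top_pressure T E <= c)%E.
Proof.
move=> muc; apply: lim_at_right0_le; first exact: is_cvg_top_pressure.
move=> eps eps0; apply: lee_of_lt_reals => a ag.
apply/lee_subgt0Pr => e e0; rewrite -EFinB; have e3 : 0 < e / 3 by rewrite divr_gt0.
have [mu [k [A [muT Apart ale]]]] := upper_bound cX cT cE eps0 ag e3.
apply: le_trans (muc mu muT); apply: le_trans (partition_le_pressure mu Apart).
by rewrite lee_fin; lra.
Qed.

Lemma lower_top_pressure_le : (lower_top_pressure T E <= top_pressure T E)%E.
Proof.
apply: lim_at_right0_le; first exact: is_cvg_lower_top_pressure.
move=> e e0; apply: (@le_trans _ _ (limn_esup (growth T E e))).
  exact: limn_einf_sup.
apply: (lim_at_right0_ge growth_limn_esup_noninc) => //.
exact: is_cvg_top_pressure.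
Qed.

End pressure_bounds.

Theorem theorem1 (R : realType) (X : pointedMetricType R) (T : X -> X)
    (E : probability (borel X) R -> R) :
  compact [set: X] -> continuous T -> energy E -> ergodic_abundance T E ->
  [/\ ereal_sup [set pressure T E mu | mu in invariant_measures T] = top_pressure T E,
      top_pressure T E = lower_top_pressure T E &
      forall eps0 : R, 0 < eps0 -> expansive_homeo T eps0 ->
        growth T E eps0 n @[n --> \oo] --> top_pressure T E].
Proof.
move=> cX cT cE abT; set S := ereal_sup _.
have SP (c : \bar R) : (forall nu, ergodic_measures T nu -> (pressure T E nu <= c)%E) ->
    (S <= c)%E.
  move=> ergc; apply: ge_ereal_sup => _ [mu muT <-]; exact: abundance_le muT.
have Slow : (S <= lower_top_pressure T E)%E.
  by apply: SP => nu; exact: pressure_le_lower.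
have topS : (top_pressure T E <= S)%E.
  by apply: top_pressure_le => // mu muT; apply: ereal_sup_ubound; exists mu.
have lowtop := lower_top_pressure_le T E.
have ST : S = top_pressure T E.
  by apply/eqP; rewrite eq_le topS (le_trans Slow).
split=> //.
  by apply/eqP; rewrite eq_le lowtop (le_trans topS).
(* At the fixed scale [eps0], monotonicity in the scale bounds the limsup by the topological
   pressure, while [pressure_le_growth] puts the supremum of the pressures, equal to it, below the
   liminf. *)
move=> eps0 eps00 Texp; apply: cvg_limn_esup_einf.
  apply: (lim_at_right0_ge (growth_limn_esup_noninc T E)) => //.
  exact: is_cvg_top_pressure.
rewrite -ST; apply: SP => nu nuerg; apply: pressure_le_growth => // eps eps_gt0.
exact: expansive_window Texp eps_gt0.
Qed.
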